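(* Let $\Lambda$ be a cyclic Nakayama algebra and $\Theta$ a Nakayama algebra such that $\boldsymbol\varepsilon(\Lambda)\cong\Theta$. Suppose that $\operatorname{def}\Theta\neq 0$. Then: (1) if $\operatorname{def}\Lambda>\operatorname{def}\Theta$, then $\operatorname{dom.dim}\Lambda\leq 2$; (2) if $\operatorname{def}\Lambda=\operatorname{def}\Theta$, then $\operatorname{dom.dim}\Lambda=\operatorname{dom.dim}\Theta+2$.
   Context: A Nakayama algebra is an algebra $\mathbb{K}Q/I$ over a field $\mathbb{K}$ with $I$ admissible, where $Q$ is an oriented cycle (cyclic case) or a disjoint union of linearly oriented quivers of type $\mathbb{A}$ (linear case). Modules are finitely generated right modules, $\tau$ is the Auslander--Reiten translate, $P(-)$ is the projective cover. Defect: for an indecomposable projective $P$, $\operatorname{def}P$ is the number of (nonzero) proper injective quotients of $P$; $\operatorname{def}\Lambda=\sum_P\operatorname{def}P$ over isomorphism classes of indecomposable projectives, equivalently the number of indecomposable injective non-projective modules up to isomorphism. Syzygy filtered algebra: for a cyclic Nakayama algebra $\Lambda$, let $\mathcal{S}(\Lambda)$ be a complete set of representatives of isomorphism classes of socles of indecomposable projective $\Lambda$-modules. Then $\boldsymbol\varepsilon(\Lambda):=\operatorname{End}_\Lambda\big(\bigoplus_{S\in\mathcal{S}(\Lambda)}P(\tau S)\big)$. Dominant dimension: for a module $M$ with minimal injective resolution $0\to M\to I_0\to I_1\to\cdots$, $\operatorname{dom.dim}M$ is the maximal $t$ (or $\infty$) such that $I_j$ is projective for all $j<t$; $\operatorname{dom.dim}A=\inf\{\operatorname{dom.dim}P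 \mid P \text{ projective non-injective } A\text{-module}\}$. *)

(* Defs.v *)
From HB Require Import structures.
From mathcomp Require Import all_boot all_order all_algebra all_field.
From mathcomp Require Import finmap monalg.
From mathcomp Require Import boolp classical_sets cardinality.

Set Implicit Arguments.
Unset Strict Implicit.
Unset Printing Implicit Defensive.

Import GRing.Theory.
Local Open Scope ring_scope.

(* [None] is infinity. *)
Definition enat := option nat.

Definition enat_le (x y : enat) : bool :=
  match x, y with
  | _, None => true
  | Some m, Some n => (m <= n)%N
  | None, Some _ => false
  end.

Definition enat_add (x : enat) (n : nat) : enat := omap (fun m => m + n)%N x.

Definition is_enat_sup (S : set enat) (d : enat) : Prop :=
  (forall s, S s -> enat_le s d) /\
  (forall e, (forall s, S s -> enat_le s e) -> enat_le d e).

Definition is_enat_inf (S : set enat) (d : enat) : Prop :=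
  (forall s, S s -> enat_le d s) /\
  (forall e, (forall s, S s -> enat_le e s) -> enat_le e d).

Definition enat_sup (S : set enat) : enat :=
  xget None [set d | is_enat_sup S d]%classic.
Definition enat_inf (S : set enat) : enat :=
  xget None [set d | is_enat_inf S d]%classic.

Lemma enat_supP (S : set enat) : is_enat_sup S (enat_sup S).
Proof.
suff [d Sd] : exists d, is_enat_sup S d.
  by apply: (@xgetPex _ None (is_enat_sup S)); exists d.
pose ub n := `[< forall s, S s -> enat_le s (Some n) >].
have [exub|noub] := pselect (exists n, ub n).
  case: (ex_minnP exub) => m /asboolP mub mmin; exists (Some m); split=> //.
  by move=> [e|] // eub; apply: mmin; apply/asboolP.
exists None; split=> [[s|] //|[e|] // eub].
by case: noub; exists e; apply/asboolP.
Qed.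

Lemma enat_infP (S : set enat) : is_enat_inf S (enat_inf S).
Proof.
suff [d Sd] : exists d, is_enat_inf S d.
  by apply: (@xgetPex _ None (is_enat_inf S)); exists d.
pose fin n := `[< S (Some n) >].
have [exfin|nofin] := pselect (exists n, fin n).
  case: (ex_minnP exfin) => m /asboolP mS mmin; exists (Some m).
  split=> [[s|] // sS|e elb].
    by apply: mmin; apply/asboolP.
  exact: elb.
exists None; split=> [[s|] // sS|[e|] //].
by case: nofin; exists s; apply/asboolP.
Qed.

Record quiver := Quiver {
  vertex : finType;
  arrow : finType;
  src : arrow -> vertex;
  tgt : arrow -> vertex
}.

Section Paths.
Variable Q : quiver.

Fixpoint is_walk (v : vertex Q) (s : seq (arrow Q)) : bool :=
  if s is a :: s' then (src a == v) && is_walk (tgt a) s' else true.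

(* A path is its source together with its arrows; (v, [::]) is the trivial
   path at v. *)
Definition qpath := {p : vertex Q * seq (arrow Q) | is_walk p.1 p.2}.

Definition psrc (p : qpath) : vertex Q := (val p).1.
Definition parrows (p : qpath) : seq (arrow Q) := (val p).2.
Definition ptgt (p : qpath) : vertex Q := last (psrc p) (map (@tgt Q) (parrows p)).
Definition plen (p : qpath) : nat := size (parrows p).

Definition pnil (v : vertex Q) : qpath :=
  exist (fun p => is_walk p.1 p.2) (v, [::]) isT.

Lemma is_walk_cat v s t :
  is_walk v (s ++ t) = is_walk v s && is_walk (last v (map (@tgt Q) s)) t.
Proof. by elim: s v => //= a s IH v; rewrite IH andbA. Qed.

Lemma pcat_proof (p q : qpath) : ptgt p = psrc q ->
  is_walk (psrc p, parrows p ++ parrows q).1 (psrc p, parrows p ++ parrows q).2.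
Proof.
move=> pq; rewrite /= is_walk_cat (valP p) /=.
by rewrite -[last _ _]/(ptgt p) pq (valP q).
Qed.

Definition pcat (p q : qpath) : option qpath :=
  if ptgt p =P psrc q is ReflectT pq
  then Some (exist (fun p => is_walk p.1 p.2) _ (pcat_proof pq)) else None.

Lemma pcatP (p q r : qpath) :
  pcat p q = Some r <->
  [/\ ptgt p = psrc q, psrc r = psrc p & parrows r = parrows p ++ parrows q].
Proof.
rewrite /pcat; case: (_ =P _) => [pq|npq]; last by split=> // -[].
split=> [[<-]|[_ rp ra]]; first by split.
congr Some; apply: val_inj => /=.
by rewrite -rp -ra; case: {rp ra} r => [[]].
Qed.

Lemma pcat_None (p q : qpath) : ptgt p != psrc q -> pcat p q = None.
Proof. by rewrite /pcat; case: (_ =P _) => // ->; rewrite eqxx. Qed.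

Lemma pcat_Some (p q : qpath) : ptgt p = psrc q -> pcat p q <> None.
Proof. by rewrite /pcat; case: (_ =P _). Qed.

Lemma pcat_ptgt (p q r : qpath) : pcat p q = Some r -> ptgt r = ptgt q.
Proof.
case/pcatP=> pq rp ra; rewrite /ptgt ra rp map_cat last_cat.
by rewrite -[last (psrc p) _]/(ptgt p) pq.
Qed.

Lemma qpath_eq (p q : qpath) : psrc p = psrc q -> parrows p = parrows q -> p = q.
Proof.
move=> e1 e2; apply: val_inj; case: p q e1 e2 => [[v s] ?] [[w t] ?].
by rewrite /psrc /parrows /= => -> ->.
Qed.

Lemma pcatA (p q r : qpath) :
  obind (fun u => pcat u r) (pcat p q) = obind (pcat p) (pcat q r).
Proof.
case Epq : (pcat p q) => [u|]; case Eqr : (pcat q r) => [w|] //=.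
- have [pq up ua] := (pcatP _ _ _).1 Epq; have [qr wq wa] := (pcatP _ _ _).1 Eqr.
  case Epw : (pcat p w) => [z|]; last by case: (@pcat_Some p w); rewrite ?wq.
  have [_ zp za] := (pcatP _ _ _).1 Epw.
  apply/pcatP; split; rewrite ?(pcat_ptgt Epq) ?zp ?up //.
  by rewrite za ua wa catA.
- rewrite pcat_None // (pcat_ptgt Epq); apply/eqP=> qr.
  by case: (pcat_Some qr).
- rewrite pcat_None //; have [_ -> _] := (pcatP _ _ _).1 Eqr.
  by apply/eqP=> pq; case: (pcat_Some pq).
Qed.

Lemma pcat0p (p : qpath) v : pcat (pnil v) p = if v == psrc p then Some p else None.
Proof.
case: eqP => [vp|/eqP vp]; last by rewrite pcat_None.
by apply/pcatP.
Qed.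

Lemma pcatp0 (p : qpath) v : pcat p (pnil v) = if ptgt p == v then Some p else None.
Proof.
case: eqP => [vp|/eqP vp]; last by rewrite pcat_None.
by apply/pcatP; rewrite cats0.
Qed.

End Paths.

Section PathAlgebra.
Variables (K : fieldType) (Q : quiver).
Notation P := (qpath Q).

Definition path_alg := {malg K[P]}.
HB.instance Definition _ := GRing.Lmodule.on path_alg.

(* The locks only keep unification from unfolding generators and products. *)
Fact pgen_key : unit. Proof. by []. Qed.
Definition pgen : P -> path_alg := locked_with pgen_key (fun p => << p >>).

Lemma pgenE p : pgen p = << p >>.
Proof. by rewrite [pgen]unlock. Qed.

Definition plin (V : lmodType K) (h : P -> V) (x : path_alg) : V :=
  \sum_(p <- msupp x) x@_p *: h p.

Definition pbasis (o : option P) : path_alg := if o is Some p then pgen p else 0.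

Fact pmul_key : unit. Proof. by []. Qed.

(* In the product p q, the path p is followed first. *)
Definition pmul : path_alg -> path_alg -> path_alg :=
  locked_with pmul_key
    (fun x y => plin (fun p => plin (fun q => pbasis (pcat p q)) y) x).

Lemma pmulE x y : pmul x y = plin (fun p => plin (fun q => pbasis (pcat p q)) y) x.
Proof. by rewrite [pmul]unlock. Qed.

Definition pone : path_alg := \sum_(v : vertex Q) pgen (pnil v).

Lemma plinEw (V : lmodType K) (h : P -> V) (x : path_alg) (d : {fset P}) :
  (msupp x `<=` d)%fset -> plin h x = \sum_(p <- d) x@_p *: h p.
Proof.
move=> le; rewrite /plin (big_fset_incl _ le) // => p _ /mcoeff_outdom ->.
by rewrite scale0r.
Qed.

Lemma plin_linear (V : lmodType K) (h : P -> V) : linear (plin h).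
Proof.
move=> c x y; pose d := (msupp x `|` msupp y)%fset.
have lexy : (msupp (c *: x + y) `<=` d)%fset.
  apply: fsubset_trans (msuppD_le _ _) _.
  by apply: fsetSU; exact: msuppZ_le.
rewrite (plinEw h lexy) (plinEw h (fsubsetUl _ _ : (msupp x `<=` d)%fset)).
rewrite (plinEw h (fsubsetUr _ _ : (msupp y `<=` d)%fset)).
rewrite scaler_sumr -big_split; apply: eq_bigr => p _ /=.
by rewrite mcoeffD mcoeffZ scalerDl scalerA.
Qed.
HB.instance Definition _ (V : lmodType K) (h : P -> V) :=
  GRing.isLinear.Build K path_alg V _ (plin h) (plin_linear h).

Lemma plinU (V : lmodType K) (h : P -> V) p : plin h (pgen p) = h p.
Proof. by rewrite pgenE /plin msuppU oner_eq0 big_seq_fset1 mcoeffUU scale1r. Qed.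

Lemma plin_id (x : path_alg) : plin pgen x = x.
Proof.
rewrite [RHS]monalgE; apply: eq_bigr => p _; rewrite pgenE; apply/malgP => q.
rewrite (mcoeffU p (x@_p)).
rewrite mcoeffZ.
rewrite mcoeffU.
by rewrite mulr_natr.
Qed.

Lemma plin_comp (V W : lmodType K) (g : {linear V -> W}) (h : P -> V) x :
  g (plin h x) = plin (fun p => g (h p)) x.
Proof. by rewrite /plin linear_sum; apply: eq_bigr => p _; rewrite linearZ. Qed.

Lemma eq_plin (V : lmodType K) (h h' : P -> V) : h =1 h' -> plin h =1 plin h'.
Proof. by move=> e x; apply: eq_bigr => p _; rewrite e. Qed.

Lemma pmul_linl y : linear (pmul^~ y).
Proof. by move=> c x x'; rewrite !pmulE; exact: plin_linear. Qed.

Lemma plin_combine (V : lmodType K) c (h h' : P -> V) x :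
  plin (fun p => c *: h p + h' p) x = c *: plin h x + plin h' x.
Proof.
rewrite /plin scaler_sumr -big_split; apply: eq_bigr => p _ /=.
by rewrite scalerDr !scalerA mulrC.
Qed.

Lemma pmul_linr x : linear (pmul x).
Proof.
move=> c y y'; rewrite !pmulE; apply: etrans (plin_combine _ _ _ _).
by apply: eq_plin => p; exact: plin_linear.
Qed.
HB.instance Definition _ x :=
  GRing.isLinear.Build K path_alg path_alg _ (pmul x) (pmul_linr x).
Definition pmulr y x := pmul x y.
HB.instance Definition _ y :=
  GRing.isLinear.Build K path_alg path_alg _ (pmulr y) (pmul_linl y).

Lemma pmulUU p q : pmul (pgen p) (pgen q) = pbasis (pcat p q).
Proof. by rewrite pmulE !plinU. Qed.

Lemma path_alg_ext (V : lmodType K) (f g : {linear path_alg -> V}) :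
  (forall p, f (pgen p) = g (pgen p)) -> f =1 g.
Proof.
move=> fg x; rewrite -[x]plin_id.
by apply: etrans (plin_comp _ _ _) (etrans _ (esym (plin_comp _ _ _))); exact: eq_plin.
Qed.

Lemma pmul0l y : pmul 0 y = 0. Proof. exact: (linear0 (pmulr y)). Qed.
Lemma pmul0r x : pmul x 0 = 0. Proof. exact: (linear0 (pmul x)). Qed.

Lemma pmulAU p q r :
  pmul (pgen p) (pmul (pgen q) (pgen r)) = pmul (pmul (pgen p) (pgen q)) (pgen r).
Proof.
rewrite (pmulUU q r) (pmulUU p q).
have := pcatA p q r; case: (pcat p q) => [u|]; case: (pcat q r) => [w|] /=.
- by rewrite !pmulUU => ->.
- by rewrite pmulUU pmul0r => ->.
- by rewrite pmulUU pmul0l => <-.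
- by rewrite pmul0l pmul0r.
Qed.

Lemma pmulA : associative pmul.
Proof.
move=> x y z.
refine (path_alg_ext (f := pmulr (pmul y z)) (g := pmulr z \o pmulr y) _ x) => p.
refine (path_alg_ext (f := pmul (pgen p) \o pmulr z)
  (g := pmulr z \o pmul (pgen p)) _ y) => q.
refine (path_alg_ext (f := pmul (pgen p) \o pmul (pgen q))
  (g := pmul (pmul (pgen p) (pgen q))) _ z) => r.
exact: pmulAU.
Qed.

Lemma pmul1 : left_id pone pmul.
Proof.
move=> x; refine (path_alg_ext (f := pmul pone) (g := idfun) _ x) => p.
apply: etrans (linear_sum (pmulr (pgen p)) _ _ _) _.
rewrite (bigD1 (psrc p)) //= big1 => [|v vp]; rewrite /pmulr pmulUU pcat0p.
  by rewrite eqxx addr0.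
by rewrite (negbTE vp).
Qed.

Lemma pmulr1 : right_id pone pmul.
Proof.
move=> x; refine (path_alg_ext (f := pmulr pone) (g := idfun) _ x) => p.
apply: etrans (linear_sum (pmul (pgen p)) _ _ _) _.
rewrite (bigD1 (ptgt p)) //= big1 => [|v vp]; rewrite pmulUU pcatp0.
  by rewrite eqxx addr0.
by rewrite eq_sym (negbTE vp).
Qed.

Lemma pmulDl : left_distributive pmul +%R.
Proof. by move=> x y z; exact: (linearD (pmulr z)). Qed.

Lemma pmulDr : right_distributive pmul +%R.
Proof. by move=> x y z; exact: (linearD (pmul x)). Qed.

HB.instance Definition _ := GRing.Zmodule_isPzRing.Build path_alg
  pmulA pmul1 pmulr1 pmulDl pmulDr.

(* The m-th power of the arrow ideal is spanned by the paths of length >= m. *)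
Definition in_arrow_ideal (m : nat) (x : path_alg) : Prop :=
  forall p, p \in msupp x -> (m <= plen p)%N.

Definition admissible (I : path_alg -> Prop) : Prop :=
  (exists2 m, (2 <= m)%N & forall x, in_arrow_ideal m x -> I x) /\
  (forall x, I x -> in_arrow_ideal 2 x).

End PathAlgebra.

(* A is isomorphic to KQ/I for some admissible ideal I, namely the kernel of
   the surjective K-algebra morphism KQ -> A. *)
Definition bound_quiver_algebra (K : fieldType) (A : falgType K) (Q : quiver) :=
  exists f : {rmorphism path_alg K Q -> A},
    [/\ forall (c : K) x, f (c *: x) = c *: f x,
        forall a, exists x, f x = a
      & admissible (fun x => f x = 0)].

Definition cycle_quiver (n : nat) : quiver :=
  @Quiver 'I_n.+1 'I_n.+1 id (@ordS n.+1).

(* The disjoint union, over i < k, of linearly oriented quivers of type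
   A_(n i).+1. *)
Definition linear_quiver (k : nat) (n : 'I_k -> nat) : quiver :=
  @Quiver {i : 'I_k & 'I_(n i).+1} {i : 'I_k & 'I_(n i)}
    (fun a => Tagged (fun i => 'I_(n i).+1) (widen_ord (leqnSn _) (tagged a)))
    (fun a => Tagged (fun i => 'I_(n i).+1) (lift ord0 (tagged a))).

Definition cyclic_nakayama (K : fieldType) (A : falgType K) : Prop :=
  exists n, bound_quiver_algebra A (cycle_quiver n).

Definition linear_nakayama (K : fieldType) (A : falgType K) : Prop :=
  exists k (n : 'I_k -> nat), bound_quiver_algebra A (linear_quiver n).

Definition nakayama (K : fieldType) (A : falgType K) : Prop :=
  cyclic_nakayama A \/ linear_nakayama A.

Section Opposite.
Variables (K : fieldType) (A : falgType K).

HB.instance Definition _ := Vector.copy A^c A.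

Fact opp_scaleAl (a : K) (x y : A^c) : a *: (x * y) = (a *: x : A^c) * y.
Proof. exact: (@scalerAr _ A a y x). Qed.
Fact opp_scaleAr (a : K) (x y : A^c) : a *: (x * y) = x * (a *: y : A^c).
Proof. exact: (@scalerAl _ A a y x). Qed.

HB.instance Definition _ := GRing.Lmodule_isLalgebra.Build K A^c opp_scaleAl.
HB.instance Definition _ := GRing.Lalgebra_isAlgebra.Build K A^c opp_scaleAr.

End Opposite.

(* Finitely generated right modules: over a finite dimensional algebra,
   finitely generated means finite dimensional.  Left A-modules are the right
   A^c-modules. *)
Record fmod (K : fieldType) (A : falgType K) := FMod {
  fcar :> vectType K;
  ract : fcar -> A -> fcar;
  ract_linl : forall a, linear (ract^~ a);
  ract_linr : forall x, linear (ract x);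
  ract1 : forall x, ract x 1 = x;
  ractA : forall x a b, ract x (a * b) = ract (ract x a) b
}.
Arguments ract {K A f} x a.

Section Modules.
Variables (K : fieldType) (A : falgType K).
Implicit Types M N P S T : fmod A.

Definition mhom M N (f : 'Hom(M, N)) : Prop :=
  forall x a, f (ract x a) = ract (f x) a.

Definition mepi M N (f : 'Hom(M, N)) : Prop := mhom f /\ limg f = fullv.
Definition mmono M N (f : 'Hom(M, N)) : Prop := mhom f /\ lker f = 0%VS.

Definition miso M N : Prop := exists2 f : 'Hom(M, N), mmono f & mepi f.

Definition submod M (U : {vspace M}) : Prop :=
  forall x a, x \in U -> ract x a \in U.

Definition superfluous M (U : {vspace M}) : Prop :=
  forall V : {vspace M}, submod V -> (U + V)%VS = fullv -> V = fullv.

Definition essential M (U : {vspace M}) : Prop :=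
  forall V : {vspace M}, submod V -> (U :&: V)%VS = 0%VS -> V = 0%VS.

Definition simple_submod M (U : {vspace M}) : Prop :=
  [/\ submod U, U <> 0%VS
    & forall V : {vspace M}, submod V -> (V <= U)%VS -> V = 0%VS \/ V = U].

(* U is the sum of all the simple submodules of M. *)
Definition is_socle M (U : {vspace M}) : Prop :=
  (forall V : {vspace M}, simple_submod V -> (V <= U)%VS) /\
  (forall W : {vspace M},
     (forall V : {vspace M}, simple_submod V -> (V <= W)%VS) -> (U <= W)%VS).

Definition iso_socle S M : Prop :=
  exists f : 'Hom(S, M), mmono f /\ is_socle (limg f).

Definition indecomposable M : Prop :=
  (fullv : {vspace M}) <> 0%VS /\
  forall U V : {vspace M}, submod U -> submod V ->
    (U + V)%VS = fullv -> (U :&: V)%VS = 0%VS -> U = 0%VS \/ V = 0%VS.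

Definition projective P : Prop :=
  forall M N (g : 'Hom(M, N)) (f : 'Hom(P, N)), mepi g -> mhom f ->
    exists2 h : 'Hom(P, M), mhom h & (g \o h)%VF = f.

Definition injective_mod S : Prop :=
  forall M N (g : 'Hom(M, N)) (f : 'Hom(M, S)), mmono g -> mhom f ->
    exists2 h : 'Hom(N, S), mhom h & (h \o g)%VF = f.

Definition projective_cover M P (p : 'Hom(P, M)) : Prop :=
  [/\ projective P, mepi p & superfluous (lker p)].

Definition is_projective_cover M P : Prop :=
  exists p : 'Hom(P, M), projective_cover p.

Definition min_proj_presentation M P0 P1 (f : 'Hom(P1, P0)) (g : 'Hom(P0, M)) :=
  [/\ projective_cover g, projective P1, mhom f, limg f = lker g
    & superfluous (lker f)].

(* 0 -> M -> I 0 -> I 1 -> ... *)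
Definition min_inj_resolution M (I : nat -> fmod A) (eta : 'Hom(M, I 0%N))
    (d : forall j, 'Hom(I j, I j.+1)) : Prop :=
  [/\ forall j, injective_mod (I j),
      mmono eta /\ (forall j, mhom (d j)),
      limg eta = lker (d 0%N) /\ (forall j, limg (d j) = lker (d j.+1))
    & essential (limg eta) /\ (forall j, essential (limg (d j)))].

(* P_0, ..., P_(n-1) is a complete irredundant list of representatives of the
   isomorphism classes of modules satisfying C (C is assumed to be invariant
   under isomorphism). *)
Definition representatives (C : fmod A -> Prop) (n : nat) (P : 'I_n -> fmod A) :=
  [/\ forall i, C (P i),
      forall i j, miso (P i) (P j) -> i = j
    & forall M, C M -> exists i, miso M (P i)].

Definition indec_proj P : Prop := projective P /\ indecomposable P.

(* U is the kernel of a surjection from P onto a nonzero injective module,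
   that is, P/U is a nonzero injective module, and it is a proper quotient. *)
Definition proper_injective_quotient P (U : {vspace P}) : Prop :=
  [/\ U <> 0%VS, U <> fullv
    & exists N (f : 'Hom(P, N)), [/\ mepi f, lker f = U & injective_mod N]].

(* [fset_set] of a finite set is that set; indecomposable projective modules
   over a Nakayama algebra have finitely many submodules. *)
Definition def_proj P : nat :=
  #|` fset_set [set U | proper_injective_quotient (P := P) U]%classic |.

Definition is_defect (d : nat) : Prop :=
  exists n (P : 'I_n -> fmod A),
    representatives indec_proj P /\ d = (\sum_(i < n) def_proj (P i))%N.

Definition domdim_mod M : enat :=
  enat_sup [set s | exists t I eta d,
    [/\ s = Some t, @min_inj_resolution M I eta d
      & forall j, (j < t)%N -> projective (I j)]]%classic.

Fact rV0_eq (y z : 'rV[K]_0) : y = z.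
Proof. by rewrite !thinmx0. Qed.

Definition mzero : fmod A :=
  @FMod K A 'rV[K]_0 (fun x _ => x)
    (fun _ _ _ _ => erefl) (fun x _ _ _ => rV0_eq _ _)
    (fun _ => erefl) (fun _ _ _ => erefl).

Section DirectSum.
Variables M N : fmod A.
Definition mprod_act (x : (M * N)%type) (a : A) : (M * N)%type :=
  (ract x.1 a, ract x.2 a).
Fact mprod_linl a : linear (mprod_act^~ a).
Proof.
move=> c [x y] [x' y']; rewrite /mprod_act /=.
by rewrite (ract_linl a c x x') (ract_linl a c y y').
Qed.
Fact mprod_linr x : linear (mprod_act x).
Proof.
move=> c a b; rewrite /mprod_act /=.
by rewrite (ract_linr _ c a b) (ract_linr _ c a b).
Qed.
Fact mprod1 x : mprod_act x 1 = x.
Proof. by case: x => x y; rewrite /mprod_act /= !ract1. Qed.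
Fact mprodA x a b : mprod_act x (a * b) = mprod_act (mprod_act x a) b.
Proof. by rewrite /mprod_act /= !ractA. Qed.
Definition mprod : fmod A :=
  @FMod K A (M * N)%type mprod_act mprod_linl mprod_linr mprod1 mprodA.
End DirectSum.

Definition mdsum (n : nat) (M : 'I_n -> fmod A) : fmod A :=
  \big[mprod/mzero]_(i < n) M i.

Fact regmod_linl (a : A) : linear (fun x : A => x * a).
Proof. by move=> c x y; rewrite mulrDl scalerAl. Qed.
Fact regmod_linr (x : A) : linear (fun a : A => x * a).
Proof. by move=> c a b; rewrite mulrDr scalerAr. Qed.
Definition regmod : fmod A :=
  @FMod K A A (fun x a => x * a) regmod_linl regmod_linr (@mulr1 A) (@mulrA A).

(* A-linearity is tested on bases of M and A; see HomsP. *)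
Section HomSpace.
Variables M N : fmod A.
Definition hom_defect (x : M) (a : A) (f : 'Hom(M, N)) : N :=
  f (ract x a) - ract (f x) a.
Fact hom_defect_linear x a : linear (hom_defect x a).
Proof.
move=> c f g; rewrite /hom_defect !lfunE /= !lfunE /=.
by rewrite (ract_linl a c (f x) (g x)) opprD scalerBr addrACA.
Qed.
HB.instance Definition _ x a :=
  GRing.isLinear.Build K 'Hom(M, N) N _ (hom_defect x a) (hom_defect_linear x a).

Definition Homs : {vspace 'Hom(M, N)} :=
  (\bigcap_(i < \dim {:M}) \bigcap_(j < \dim {:A})
     lker (linfun (hom_defect (vbasis {:M})`_i (vbasis {:A})`_j)))%VS.

Lemma linear_vbasis0 (V : vectType K) (W : lmodType K) (g : V -> W) :
  linear g -> (forall i : 'I_(\dim {:V}), g (vbasis {:V})`_i = 0) ->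
  forall x, g x = 0.
Proof.
move=> gl g0 x.
pose G : {linear V -> W} := HB.pack g (GRing.isLinear.Build K V W _ g gl).
rewrite -[g x]/(G x) (coord_vbasis (memvf x)) linear_sum big1 // => i _.
by rewrite linearZ /= g0 scaler0.
Qed.

Lemma HomsP (f : 'Hom(M, N)) : f \in Homs <-> mhom f.
Proof.
split=> [fH x a|fH]; last first.
  rewrite memvE; apply/subv_bigcapP => i _; apply/subv_bigcapP => j _.
  by rewrite -memvE memv_ker lfunE /= /hom_defect fH subrr.
apply/eqP; rewrite -subr_eq0; apply/eqP; move: x.
apply: linear_vbasis0 => [c x y|i].
  rewrite (ract_linl a c x y) !(linearP f) (ract_linl a c (f x) (f y)).
  by rewrite scalerBr opprD addrACA.
move: a; apply: linear_vbasis0 => [c a b|j].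
  rewrite !(ract_linr _ c a b) !(linearP f).
  by rewrite scalerBr opprD addrACA.
move: fH; rewrite memvE => /subv_bigcapP /(_ i isT) /subv_bigcapP /(_ j isT).
by rewrite -memvE memv_ker lfunE /= => /eqP.
Qed.

End HomSpace.

(* The left A-module Hom_A(P, A). *)
Section Star.
Variable P : fmod A.
Notation H := (subvs_of (Homs P regmod)).

Fact star_proof (h : H) (a : A) : (amull a \o vsval h)%VF \in Homs P regmod.
Proof.
apply/HomsP => x b; rewrite !comp_lfunE /=.
rewrite ((HomsP _).1 (subvsP h)).
by rewrite /ract /= !lfunE /= mulrA.
Qed.

Definition star_act (h : H) (a : A^c) : H := Subvs (star_proof h a).

Lemma star_actE (h : H) (a : A^c) (x : P) :
  vsval (star_act h a) x = (a : A) * vsval h x.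
Proof. by rewrite /= comp_lfunE lfunE. Qed.

Fact star_linl a : linear (star_act^~ a).
Proof.
move=> c g h; apply: val_inj; apply/lfunP => x.
rewrite star_actE !(linearP vsval) !add_lfunE !scale_lfunE !star_actE.
by rewrite mulrDr -scalerAr.
Qed.
Fact star_linr h : linear (star_act h).
Proof.
move=> c a b; apply: val_inj; apply/lfunP => x.
rewrite star_actE (linearP vsval) add_lfunE scale_lfunE !star_actE.
by rewrite mulrDl -scalerAl.
Qed.
Fact star1 h : star_act h 1 = h.
Proof. by apply: val_inj; apply/lfunP => x; rewrite star_actE mul1r. Qed.
Fact starA h (a b : A^c) : star_act h (a * b) = star_act (star_act h a) b.
Proof. by apply: val_inj; apply/lfunP => x; rewrite !star_actE mulrA. Qed.

Definition star : fmod A^c := @FMod K A^c H star_act star_linl star_linr star1 starA.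
End Star.

(* The map h |-> h o f, for f A-linear; [vsproj] only casts h o f, which is
   then in Hom_A(P1, A), to that subspace (see star_mapE). *)
Section StarMap.
Variables (P0 P1 : fmod A) (f : 'Hom(P1, P0)).

Definition star_fun (h : star P0) : star P1 :=
  vsproj (Homs P1 regmod) (vsval h \o f)%VF.
Fact star_fun_linear : linear star_fun.
Proof.
move=> c g h; rewrite /star_fun (linearP vsval) comp_lfunDl -comp_lfunZl.
exact: (linearP (vsproj (Homs P1 regmod))).
Qed.
HB.instance Definition _ :=
  GRing.isLinear.Build K (star P0) (star P1) _ star_fun star_fun_linear.

Definition star_map : 'Hom(star P0, star P1) := linfun star_fun.

Lemma star_mapE (h : star P0) (x : P1) :
  mhom f -> vsval (star_map h) x = vsval h (f x).
Proof.
move=> fA; have hf : (vsval h \o f)%VF \in Homs P1 regmod.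
  by apply/HomsP => y a; rewrite !comp_lfunE fA ((HomsP _).1 (subvsP h)).
by rewrite lfunE /= vsprojK // comp_lfunE.
Qed.
End StarMap.

(* The right A-module Hom_K(T, K), for T a left A-module. *)
Section Dual.
Variable T : fmod A^c.
Notation D := 'Hom(T, K^o).

Definition dual_fun (xi : D) (a : A) (t : T) : K^o := xi (ract t (a : A^c)).
Fact dual_fun_linear xi a : linear (dual_fun xi a).
Proof.
by move=> c t u; rewrite /dual_fun (ract_linl (a : A^c) c t u) (linearP xi).
Qed.
HB.instance Definition _ xi a :=
  GRing.isLinear.Build K T K^o _ (dual_fun xi a) (dual_fun_linear xi a).

Definition dual_act (xi : D) (a : A) : D := linfun (dual_fun xi a).

Lemma dual_actE xi a t : dual_act xi a t = xi (ract t (a : A^c)).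
Proof. by rewrite lfunE. Qed.

Fact dual_linl a : linear (dual_act^~ a).
Proof.
by move=> c f g; apply/lfunP => t; rewrite !(add_lfunE, scale_lfunE, dual_actE).
Qed.
Fact dual_linr xi : linear (dual_act xi).
Proof.
move=> c a b; apply/lfunP => t; rewrite add_lfunE scale_lfunE !dual_actE.
by rewrite (ract_linr t c (a : A^c) b) (linearP xi).
Qed.
Fact dual1 xi : dual_act xi 1 = xi.
Proof. by apply/lfunP => t; rewrite dual_actE (ract1 t). Qed.
Fact dualA xi a b : dual_act xi (a * b) = dual_act (dual_act xi a) b.
Proof.
apply/lfunP => t; rewrite !dual_actE; congr (xi _).
exact: (ractA t (b : A^c) (a : A^c)).
Qed.

Definition dual : fmod A := @FMod K A D dual_act dual_linl dual_linr dual1 dualA.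
End Dual.

End Modules.

Section Translate.
Variables (K : fieldType) (A : falgType K).
Implicit Types M N : fmod A.

(* T is the transpose of M: for a minimal projective presentation
   P1 -> P0 -> M -> 0, the sequence
   Hom_A(P0, A) -> Hom_A(P1, A) -> T -> 0 of left A-modules is exact. *)
Definition is_transpose M (T : fmod A^c) : Prop :=
  exists (P0 P1 : fmod A) (f : 'Hom(P1, P0)) (g : 'Hom(P0, M)) (q : 'Hom(star P1, T)),
    [/\ min_proj_presentation f g, mepi q & lker q = limg (star_map f)].

Definition is_AR_translate M N : Prop :=
  exists2 T : fmod A^c, is_transpose M T & miso N (dual T).

(* B is isomorphic to End_A(M), whose product is composition. *)
Definition iso_End M (B : falgType K) : Prop :=
  exists phi : 'Hom(B, 'End(M)),
    [/\ lker phi = 0%VS, limg phi = Homs M M, phi 1 = \1%VF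
      & forall x y, phi (x * y) = (phi x \o phi y)%VF].

End Translate.

Section Algebras.
Variables (K : fieldType) (A : falgType K).

Definition defect : nat := xget 0%N [set d | is_defect A d]%classic.

(* The infimum of the empty set (A self-injective) is infinity. *)
Definition domdim : enat :=
  enat_inf [set d | exists P : fmod A,
    [/\ projective P, ~ injective_mod P & d = domdim_mod P]]%classic.

(* B is isomorphic to the syzygy filtered algebra of A: S runs over the socles
   of the indecomposable projectives, T i = tau (S i) and P i = P(T i). *)
Definition iso_syzygy_filtered (B : falgType K) : Prop :=
  exists n (S T P : 'I_n -> fmod A),
    [/\ representatives (fun S => exists2 P, indec_proj P & iso_socle S P) S,
        forall i, is_AR_translate (S i) (T i),
        forall i, is_projective_cover (T i) (P i)
      & iso_End (mdsum P) B].

End Algebras.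

(* Main.v *)
From HB Require Import structures.
Require Import Defs.
From mathcomp Require Import all_boot all_order all_algebra all_field.
From mathcomp Require Import finmap monalg boolp classical_sets cardinality zify.

(** Let [f i = i + length P_i] for a cyclic Nakayama algebra, with the vertices
    lifted to the integers.  Indecomposable modules are intervals [[i, j)] with
    [j <= f i]; such a module is projective iff [j = f i] and injective iff
    [f (i - 1) < j], and its minimal injective resolution is
    [[i, j) -> [g j, j) -> [g i, i) -> [g (g j), g j) -> ...] where [g j] is the
    least [k] with [j <= f k].  Hence the defect counts the vertices outside
    [Y = Im f], and the dominant dimension counts how long the endpoints of this
    resolution stay in [Y].  Since [tau] shifts socles into [Y], the syzygy
    filtered algebra is the corner [eps Lambda eps] at the vertices of [Y], which
    is again of this kind, for [f] restricted to [Y].  Counting the fibres of [f]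
    shows [def Theta <= def Lambda], with equality iff every fibre of [f] with two
    elements is contained in [Y].  If some fibre is not, it contains a projective
    of dominant dimension at most 2; if all are, the resolutions over the two
    algebras run through the same endpoints [j], and the condition [j \in f Y] of
    [Theta] is the condition [g j \in Y] that [Lambda] imposes two steps later. *)
Set Implicit Arguments.
Unset Strict Implicit.
Unset Printing Implicit Defensive.

Import Order.TTheory GRing.Theory Num.Theory.
Local Open Scope ring_scope.

Local Notation "m • a" := (ract m a) (at level 40, left associativity).

(** * Modules over a finite dimensional algebra *)

Section LinearMaps.
Variable K : fieldType.

(** All facts about modules are derived from the record [nakayama_basis], and both algebras receive
    an instance of it: [Lambda] from its quiver, [Theta] through the isomorphism with an
    endomorphism algebra. One set of formulas for defect and dominant dimension then serves both.
    Vertices are integers rather than residues because a module may wind around the cycle several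
    times, and because most arguments rest on the monotonicity of [f]. The dominant dimension ranges
    over all projective modules, decomposable ones included; this is why injective hulls are
    followed through isomorphisms and direct sums. The shift by 2 arises as follows: a non-injective
    projective [i, f i) has f (i - 1) = f i, so if the fibres with two elements lie in Y, then both
    its endpoints lie in Y and the first two conditions on its resolution hold for free.
    Admissibility enters as f i >= i + 2: arrows are nonzero, which fixes the translate of a simple
    module and keeps certain cosyzygies from vanishing. *)

Lemma lin_hom (V W : vectType K) (g : V -> W) :
  linear g -> exists h : 'Hom(V, W), h =1 g.
Proof.
move=> gl.
pose G : {linear V -> W} := HB.pack g (GRing.isLinear.Build K V W _ g gl).
by exists (linfun G) => v; rewrite lfunE.
Qed.

Lemma limgP (V W : vectType K) (f : 'Hom(V, W)) w :
  reflect (exists v, w = f v) (w \in limg f).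
Proof.
apply: (iffP memv_imgP) => [[v _ ->]|[v ->]]; first by exists v.
by exists v; rewrite ?memvf.
Qed.

Lemma vspace_full (V : vectType K) (U : {vspace V}) :
  (forall v, v \in U) -> U = fullv.
Proof. by move=> h; apply/vspaceP => v; rewrite h memvf. Qed.

Lemma vspace_zero (V : vectType K) (U : {vspace V}) :
  (forall v, v \in U -> v = 0) -> U = 0%VS.
Proof. by move=> h; apply/eqP; rewrite -subv0; apply/subvP => v /h ->; rewrite mem0v. Qed.

Lemma vspace_nonzero (V : vectType K) (U : {vspace V}) :
  U <> 0%VS -> exists2 v, v \in U & v != 0.
Proof.
move/eqP; rewrite -vpick0 => h; exists (vpick U) => //; exact: memv_pick.
Qed.

Section HomEqns.
Variables (V W : vectType K) (f : 'Hom(V, W)).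
Lemma homD x y : f (x + y) = f x + f y. Proof. exact: linearD. Qed.
Lemma homB x y : f (x - y) = f x - f y. Proof. exact: linearB. Qed.
Lemma hom0 : f 0 = 0. Proof. exact: linear0. Qed.
Lemma homZ c x : f (c *: x) = c *: f x. Proof. exact: linearZ. Qed.
Lemma hom_sum I r (P : pred I) (F : I -> V) :
  f (\sum_(i <- r | P i) F i) = \sum_(i <- r | P i) f (F i).
Proof. exact: linear_sum. Qed.
End HomEqns.

End LinearMaps.

(** * Right modules: submodules, quotients, factorizations, direct sums *)

Section FMod.
Variables (K : fieldType) (A : falgType K).
Implicit Types (M N E P Q : fmod A).

Lemma ractDl M (x y : M) (a : A) : (x + y) • a = x • a + y • a.
Proof. by have := ract_linl a 1 x y; rewrite !scale1r. Qed.
Lemma ractDr M (x : M) (a b : A) : x • (a + b) = x • a + x • b.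
Proof. by have := ract_linr x 1 a b; rewrite !scale1r. Qed.
Lemma ract0l M (a : A) : (0 : M) • a = 0.
Proof. by apply: (addrI ((0 : M) • a)); rewrite -ractDl !addr0. Qed.
Lemma ract0r M (x : M) : x • 0 = 0.
Proof. by apply: (addrI (x • 0)); rewrite -ractDr !addr0. Qed.
Lemma ractZl M c (x : M) (a : A) : (c *: x) • a = c *: (x • a).
Proof. by have := ract_linl a c x 0; rewrite !addr0 ract0l addr0. Qed.
Lemma ractZr M c (x : M) (a : A) : x • (c *: a) = c *: (x • a).
Proof. by have := ract_linr x c a 0; rewrite !addr0 ract0r addr0. Qed.
Lemma ractNl M (x : M) (a : A) : (- x) • a = - (x • a).
Proof. by rewrite -scaleN1r ractZl scaleN1r. Qed.
Lemma ractNr M (x : M) (a : A) : x • (- a) = - (x • a).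
Proof. by rewrite -scaleN1r ractZr scaleN1r. Qed.
Lemma ractBl M (x y : M) (a : A) : (x - y) • a = x • a - y • a.
Proof. by rewrite ractDl ractNl. Qed.
Lemma ractBr M (x : M) (a b : A) : x • (a - b) = x • a - x • b.
Proof. by rewrite ractDr ractNr. Qed.
Lemma ract_suml M I r (P : pred I) (F : I -> M) (a : A) :
  (\sum_(i <- r | P i) F i) • a = \sum_(i <- r | P i) F i • a.
Proof. by apply: (big_morph (fun x => x • a)) => [x y|]; rewrite ?ractDl ?ract0l. Qed.
Lemma ract_sumr M I r (P : pred I) (F : I -> A) (x : M) :
  x • (\sum_(i <- r | P i) F i) = \sum_(i <- r | P i) x • F i.
Proof. by apply: (big_morph (ract x)) => [a b|]; rewrite ?ractDr ?ract0r. Qed.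

Lemma mhom_id M : mhom (\1%VF : 'Hom(M, M)).
Proof. by move=> x a; rewrite !id_lfunE. Qed.
Lemma mhom_comp M N P (f : 'Hom(N, P)) (g : 'Hom(M, N)) :
  mhom f -> mhom g -> mhom (f \o g)%VF.
Proof. by move=> hf hg x a; rewrite !comp_lfunE hg hf. Qed.
Lemma mhom0 M N : mhom (0 : 'Hom(M, N)).
Proof. by move=> x a; rewrite !zero_lfunE ract0l. Qed.

Lemma mepiP M N (f : 'Hom(M, N)) :
  mepi f <-> mhom f /\ forall y, exists x, y = f x.
Proof.
split=> -[hf h]; split=> //.
  by move=> y; apply/limgP; rewrite h memvf.
by apply: vspace_full => y; apply/limgP.
Qed.

Lemma mmonoP M N (f : 'Hom(M, N)) :
  mmono f <-> mhom f /\ forall x, f x = 0 -> x = 0.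
Proof.
split=> -[hf h]; split=> //.
  by move=> x fx; apply/eqP; rewrite -memv0 -h memv_ker fx.
by apply: vspace_zero => v; rewrite memv_ker => /eqP /h.
Qed.

Definition retract M N : Prop :=
  exists (s : 'Hom(M, N)) (r : 'Hom(N, M)),
    [/\ mhom s, mhom r & forall x, r (s x) = x].

Lemma misoP M N : miso M N <->
  exists (s : 'Hom(M, N)) (r : 'Hom(N, M)),
    [/\ mhom s, mhom r, forall x, r (s x) = x & forall y, s (r y) = y].
Proof.
split=> [[f fm fe]|[s [r [hs hr rs sr]]]].
  have [hf finj] := (mmonoP f).1 fm; have [_ fsur] := (mepiP f).1 fe.
  have ker0 : lker f == 0%VS by case: fm => _ ->.
  have fK : forall x, (f^-1)%VF (f x) = x by apply: lker0_lfunK.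
  exists f, (f^-1)%VF; split=> //.
    by move=> y a; have [x ->] := fsur y; rewrite -hf !fK.
  by move=> y; have [x ->] := fsur y; rewrite fK.
exists s; first by apply/mmonoP; split=> // x sx; rewrite -[x]rs sx hom0.
by apply/mepiP; split=> // y; exists (r y).
Qed.

Lemma miso_sym M N : miso M N -> miso N M.
Proof. by move/misoP=> [s [r [hs hr rs sr]]]; apply/misoP; exists r, s. Qed.
Lemma miso_retract M N : miso M N -> retract M N.
Proof. by move=> /misoP[s [r [hs hr rs sr]]]; exists s, r. Qed.

Lemma retract_projective M N : retract M N -> projective N -> projective M.
Proof.
move=> [s [r [hs hr rs]]] Np M' N' g f ge hf.
have [h hh gh] := Np _ _ g (f \o r)%VF ge (mhom_comp hf hr).
exists (h \o s)%VF; first exact: mhom_comp.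
apply/lfunP => x; rewrite !comp_lfunE -comp_lfunE gh comp_lfunE.
by rewrite rs.
Qed.

Lemma sub_exists M (U : {vspace M}) : submod U ->
  exists (S : fmod A) (i : 'Hom(S, M)), mmono i /\ limg i = U.
Proof.
move=> hU.
pose act (y : subvs_of U) (a : A) : subvs_of U := Subvs (hU _ a (subvsP y)).
have actE y a : vsval (act y a) = vsval y • a by [].
have vinj (y z : subvs_of U) : vsval y = vsval z -> y = z by exact: val_inj.
have vlin c (y z : subvs_of U) : vsval (c *: y + z) = c *: vsval y + vsval z.
  by rewrite linearP.
have l1 a : linear (act^~ a).
  by move=> c y z; apply: vinj; rewrite vlin !actE vlin ractDl ractZl.
have l2 y : linear (act y).
  by move=> c a b; apply: vinj; rewrite vlin !actE ractDr ractZr.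
have a1 y : act y 1 = y by apply: vinj; rewrite actE ract1.
have aA y a b : act y (a * b) = act (act y a) b.
  by apply: vinj; rewrite !actE ractA.
exists (FMod l1 l2 a1 aA).
have [i iE] : exists i : 'Hom(subvs_of U, M), i =1 vsval.
  by apply: lin_hom => c y z; rewrite linearP.
exists i; split.
  apply/mmonoP; split=> [y a|y]; first by rewrite !iE.
  by rewrite iE => y0; apply: vinj; rewrite /= y0.
apply/vspaceP => v; apply/limgP/idP => [[y ->]|vU].
  by rewrite iE subvsP.
by exists (vsproj U v); rewrite iE vsprojK.
Qed.

(** The quotient lives on a linear complement of [U]; its action is transported along a linear
    section of the projection, whose choice does not matter because [U] is a submodule. *)
Lemma quo_exists M (U : {vspace M}) : submod U ->
  exists (Q : fmod A) (q : 'Hom(M, Q)), mepi q /\ lker q = U.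
Proof.
move=> hU; pose C := (U^C)%VS.
have UC0 : (U :&: C = 0)%VS by rewrite capv_compl.
have CU0 : (C :&: U = 0)%VS by rewrite capvC capv_compl.
have [q qE] : exists q : 'Hom(M, subvs_of C), forall v,
    vsval (q v) = daddv_pi C U v.
  have [q qE] := @lin_hom _ M (subvs_of C) (fun v => vsproj C (daddv_pi C U v))
     (fun c y z => etrans (congr1 _ (linearP _ _ _ _)) (linearP _ _ _ _)).
  by exists q => v; rewrite qE vsprojK ?memv_pi.
have qker v : (q v == 0) = (v \in U).
  have -> : (q v == 0) = (daddv_pi C U v == 0).
    by rewrite -qE -(inj_eq val_inj) /= .
  have vE : v = daddv_pi C U v + daddv_pi U C v.
    by rewrite daddv_pi_add // addvC addv_complf memvf.
  apply/eqP/idP => [v0|vU]; first by rewrite vE v0 add0r memv_pi.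
  have : daddv_pi C U v \in (C :&: U)%VS.
    rewrite memv_cap memv_pi /=.
    have -> : daddv_pi C U v = v - daddv_pi U C v by rewrite {2}vE addrK.
    by rewrite memvB // memv_pi.
  by rewrite CU0 memv0 => /eqP.
have qsur y : exists v, y = q v.
  exists (vsval y); apply: val_inj; rewrite /= qE daddv_pi_id //; exact: subvsP.
have qlim : limg q = fullv by apply: vspace_full => y; apply/limgP.
have qK y : q ((q^-1)%VF y) = y by rewrite limg_lfunVK // qlim memvf.
have qcong v w a : q v = q w -> q (v • a) = q (w • a).
  move=> e; apply/eqP; rewrite -subr_eq0 -homB -ractBl qker; apply: hU.
  by rewrite -qker homB e subrr.
pose act y a := q ((q^-1)%VF y • a).
have actq v a : act (q v) a = q (v • a) by apply: qcong; rewrite qK.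
have l1 a : linear (act^~ a).
  by move=> c y z; rewrite /act homD homZ ractDl ractZl homD homZ.
have l2 y : linear (act y) by move=> c a b; rewrite /act ractDr ractZr homD homZ.
have a1 y : act y 1 = y by rewrite /act ract1 qK.
have aA y a b : act y (a * b) = act (act y a) b.
  by have [v ->] := qsur y; rewrite !actq ractA.
exists (FMod l1 l2 a1 aA), q; split.
  by apply/mepiP; split=> // v a; rewrite /= actq.
by apply/vspaceP => v; rewrite memv_ker qker.
Qed.

Lemma factor_epi M N P (q : 'Hom(M, N)) (f : 'Hom(M, P)) :
  mepi q -> mhom f -> (forall v, q v = 0 -> f v = 0) ->
  exists2 h : 'Hom(N, P), mhom h & forall v, h (q v) = f v.
Proof.
move=> /mepiP[hq qsur] hf kqf.
have qlim : limg q = fullv by apply: vspace_full => y; apply/limgP.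
have qK y : q ((q^-1)%VF y) = y by rewrite limg_lfunVK // qlim memvf.
have hE v : (f \o q^-1)%VF (q v) = f v.
  rewrite comp_lfunE; apply/eqP; rewrite -subr_eq0 -homB; apply/eqP/kqf.
  by rewrite homB qK subrr.
exists (f \o q^-1)%VF => // y a; have [v ->] := qsur y.
by rewrite -hq !hE hf.
Qed.

Lemma factor_mono M N P (i : 'Hom(N, P)) (f : 'Hom(M, P)) :
  mmono i -> mhom f -> (forall v, f v \in limg i) ->
  exists2 h : 'Hom(M, N), mhom h & forall v, i (h v) = f v.
Proof.
move=> /mmonoP[hi iinj] hf fi.
have hE v : i ((i^-1 \o f)%VF v) = f v by rewrite comp_lfunE limg_lfunVK.
exists (i^-1 \o f)%VF => // v a; apply/eqP; rewrite -subr_eq0; apply/eqP/iinj.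
by rewrite homB hi !hE hf subrr.
Qed.

(** A linear section of [a -> u • a] followed by [a -> v • a] does not depend on the section,
    because the annihilator of [u] kills [v]. *)
Lemma cyclic_hom M N (u : M) (v : N) :
  (forall m, exists a, m = u • a) -> (forall a, u • a = 0 -> v • a = 0) ->
  exists2 h : 'Hom(M, N), mhom h & h u = v.
Proof.
move=> ugen uv.
have [L LE] : exists L : 'Hom(A, M), L =1 ract u.
  by apply: lin_hom => c a b; rewrite ractDr ractZr.
have [L' LE'] : exists L : 'Hom(A, N), L =1 ract v.
  by apply: lin_hom => c a b; rewrite ractDr ractZr.
have hE a : (L' \o L^-1)%VF (u • a) = v • a.
  rewrite comp_lfunE -LE -LE'; apply/eqP; rewrite -subr_eq0 -homB LE'.
  apply/eqP/uv; rewrite -LE homB limg_lfunVK ?subrr //.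
  by apply/limgP; exists a.
exists (L' \o L^-1)%VF; last by rewrite -[u]ract1 hE ract1.
by move=> m a; have [b ->] := ugen m; rewrite -ractA !hE ractA.
Qed.

Lemma mprod_maps M N : exists (i1 : 'Hom(M, mprod M N)) (i2 : 'Hom(N, mprod M N))
   (p1 : 'Hom(mprod M N, M)) (p2 : 'Hom(mprod M N, N)),
  [/\ [/\ mhom i1, mhom i2, mhom p1 & mhom p2],
      [/\ forall x, p1 (i1 x) = x, forall x, p2 (i2 x) = x,
          forall x, p2 (i1 x) = 0 & forall x, p1 (i2 x) = 0]
    & forall z, z = i1 (p1 z) + i2 (p2 z)].
Proof.
have [i1 i1E] : exists h : 'Hom(M, mprod M N), forall x, h x = (x, 0).
  apply: lin_hom => c x y; congr pair => /=.
  by rewrite scaler0 addr0.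
have [i2 i2E] : exists h : 'Hom(N, mprod M N), forall x, h x = (0, x).
  apply: lin_hom => c x y; congr pair => /=.
  by rewrite scaler0 addr0.
have [p1 p1E] : exists h : 'Hom(mprod M N, M), forall x, h x = x.1.
  by apply: lin_hom => c x y.
have [p2 p2E] : exists h : 'Hom(mprod M N, N), forall x, h x = x.2.
  by apply: lin_hom => c x y.
have actE (z : mprod M N) a : z • a = (z.1 • a, z.2 • a) by [].
exists i1, i2, p1, p2; split; first split.
- by move=> x a; rewrite !i1E actE /= ract0l.
- by move=> x a; rewrite !i2E actE /= ract0l.
- by move=> x a; rewrite !p1E actE.
- by move=> x a; rewrite !p2E actE.
- by split=> x; rewrite ?p1E ?p2E ?i1E ?i2E.
- move=> [x y]; rewrite i1E i2E p1E p2E /=.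
  by congr pair; rewrite /= ?addr0 ?add0r.
Qed.

Lemma retract_mprodl M N : retract M (mprod M N).
Proof. by have [i1 [i2 [p1 [p2 [[? ? ? ?] [? ? ? ?] _]]]]] := mprod_maps M N; exists i1, p1. Qed.
Lemma retract_mprodr M N : retract N (mprod M N).
Proof. by have [i1 [i2 [p1 [p2 [[? ? ? ?] [? ? ? ?] _]]]]] := mprod_maps M N; exists i2, p2. Qed.

Lemma mprod_projective M N : projective M -> projective N -> projective (mprod M N).
Proof.
have [i1 [i2 [p1 [p2 [[hi1 hi2 hp1 hp2] [p1i1 p2i2 p2i1 p1i2] zE]]]]] := mprod_maps M N.
move=> Mp Np M' N' g f ge hf.
have [h1 hh1 gh1] := Mp _ _ g (f \o i1)%VF ge (mhom_comp hf hi1).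
have [h2 hh2 gh2] := Np _ _ g (f \o i2)%VF ge (mhom_comp hf hi2).
exists ((h1 \o p1) + (h2 \o p2))%VF.
  by move=> z a; rewrite !add_lfunE !comp_lfunE hp1 hp2 hh1 hh2 ractDl.
apply/lfunP => z; rewrite comp_lfunE add_lfunE !comp_lfunE homD.
rewrite -[g (h1 _)]comp_lfunE gh1 -[g (h2 _)]comp_lfunE gh2 !comp_lfunE.
by rewrite -homD -zE.
Qed.

Lemma mprod_injective M N :
  injective_mod M -> injective_mod N -> injective_mod (mprod M N).
Proof.
have [i1 [i2 [p1 [p2 [[hi1 hi2 hp1 hp2] [p1i1 p2i2 p2i1 p1i2] zE]]]]] := mprod_maps M N.
move=> Mp Np M' N' g f ge hf.
have [h1 hh1 gh1] := Mp _ _ g (p1 \o f)%VF ge (mhom_comp hp1 hf).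
have [h2 hh2 gh2] := Np _ _ g (p2 \o f)%VF ge (mhom_comp hp2 hf).
exists ((i1 \o h1) + (i2 \o h2))%VF.
  by move=> z a; rewrite !add_lfunE !comp_lfunE hh1 hh2 hi1 hi2 ractDl.
apply/lfunP => z; rewrite comp_lfunE add_lfunE !comp_lfunE.
rewrite -[h1 (g _)]comp_lfunE gh1 -[h2 (g _)]comp_lfunE gh2 !comp_lfunE.
by rewrite -zE.
Qed.

End FMod.

(** * Uniserial modules over a Nakayama algebra *)

(* The vertices are lifted to the integers: [e i] is the idempotent at [i] mod [N],
   [x] is the sum of the arrows, and the projective [e i A] has length [f i - i]. *)
Record nakayama_basis (K : fieldType) (A : falgType K) (N : nat) (e : int -> A) (x : A)
    (f : int -> int) : Prop := NakayamaBasis {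
  nak_gt0 : (0 < N)%N;
  nak_per : forall i, e (i + N%:Z) = e i;
  nak_orth : forall i j, e i * e j = if (i == j %[mod N%:Z])%Z then e i else 0;
  nak_sum : \sum_(0 <= i < N) e i%:Z = 1;
  nak_comm : forall i, e i * x = x * e (i + 1);
  nak_pow : forall i (a : nat), (e i * x ^+ a == 0) = (f i <= i + a%:Z);
  nak_gt : forall i, i < f i;
  nak_span : forall Q : A -> Prop, Q 0 ->
    (forall c a b, Q a -> Q b -> Q (c *: a + b)) ->
    (forall i k, Q (e i * x ^+ k)) -> forall a, Q a
}.

Section Intervals.
Variables (K : fieldType) (A : falgType K).
Variables (N : nat) (e : int -> A) (x : A) (f : int -> int).
Hypothesis H : nakayama_basis N e x f.
Implicit Types (M E P : fmod A).

Lemma nak_mod i j : (i = j %[mod N%:Z])%Z -> e i = e j.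
Proof.
have per k (n : nat) : e (k + n%:Z * N%:Z) = e k.
  elim: n => [|n IH]; first by rewrite mul0r addr0.
  by rewrite -addn1 PoszD mulrDl mul1r addrA (nak_per H).
move=> /eqP; rewrite eqz_mod_dvd => /dvdzP [q qE].
have -> : i = j + q * N%:Z by rewrite -qE addrC subrK.
case: q {qE} => [n|n]; first exact: per.
by rewrite -[LHS](per _ n.+1) NegzE mulNr subrK.
Qed.

Lemma nak_idem i : e i * e i = e i.
Proof. by rewrite (nak_orth H) eqxx. Qed.

Lemma nak_commX i (a : nat) : e i * x ^+ a = x ^+ a * e (i + a%:Z).
Proof.
elim: a i => [|a IH] i; first by rewrite expr0 mul1r mulr1 addr0.
rewrite exprS mulrA (nak_comm H) -mulrA IH mulrA; congr (_ * e _); lia.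
Qed.

(** The radical of [e k A] is [x e (k + 1) A], a quotient of [e (k + 1) A]; compare the lengths. *)
Lemma nak_mono i j : i <= j -> f i <= f j.
Proof.
have step k : f k <= f (k + 1).
  have [a fa] : exists a : nat, f (k + 1) = k + 1 + a%:Z.
    by have := nak_gt H (k + 1); exists (absz (f (k + 1) - (k + 1))%R); lia.
  have e0 : e (k + 1) * x ^+ a = 0 by apply/eqP; rewrite (nak_pow H) fa.
  have : (e k * x ^+ a.+1 == 0) by rewrite exprS mulrA (nak_comm H) -mulrA e0 mulr0.
  by rewrite (nak_pow H); lia.
move=> ij; have -> : j = i + (absz (j - i)%R)%:Z by lia.
elim: (absz _) => [|n IH]; first by rewrite addr0.
have -> : i + n.+1%:Z = i + n%:Z + 1 by lia.
exact: le_trans (step _).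
Qed.

Lemma nak_fper i : f (i + N%:Z) = f i + N%:Z.
Proof.
have := nak_gt H i; have := nak_gt H (i + N%:Z) => g1 g2.
have E a : (f (i + N%:Z) <= i + N%:Z + a%:Z) = (f i <= i + a%:Z).
  by rewrite -!(nak_pow H) (nak_per H).
have := E (absz (f i - i)%R); have := E (absz (f (i + N%:Z) - (i + N%:Z))%R); lia.
Qed.

Lemma nak_fperZ i k : f (i + k * N%:Z) = f i + k * N%:Z.
Proof.
have per i0 (n : nat) : f (i0 + n%:Z * N%:Z) = f i0 + n%:Z * N%:Z.
  elim: n => [|n IH]; first by rewrite mul0r !addr0.
  have -> : n.+1%:Z * N%:Z = n%:Z * N%:Z + N%:Z by rewrite -addn1 PoszD mulrDl mul1r.
  by rewrite !addrA nak_fper IH.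
case: k => [n|n]; first exact: per.
have := per (i + Negz n * N%:Z) n.+1.
by rewrite NegzE mulNr subrK => ->; rewrite addrK.
Qed.

Lemma nak_nil : exists B : nat, x ^+ B = 0.
Proof.
exists (\max_(i < N) absz (f i%:Z - i%:Z)%R).
rewrite -[LHS]mul1r -(nak_sum H) mulr_suml big_mkord big1 // => i _.
apply/eqP; rewrite (nak_pow H).
have := leq_bigmax (F := fun i : 'I_N => absz (f i%:Z - i%:Z)%R) i.
by move=> /=; move: (\max_(_ < _) _) => m; lia.
Qed.

(** [A x^k] lies in [x^k A]; hence a power of [x] that kills [u] kills all of [u A]. *)
Lemma nak_normal a k : exists b, a * x ^+ k = x ^+ k * b.
Proof.
elim/(nak_span H): a => [|c a b [a' Ea] [b' Eb]|i n].
- by exists 0; rewrite mul0r mulr0.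
- by exists (c *: a' + b'); rewrite mulrDl mulrDr -scalerAl -scalerAr Ea Eb.
have -> : e i = e (i - k%:Z + k%:Z) by congr e; lia.
exists (e (i - k%:Z + k%:Z + k%:Z) * x ^+ n).
by rewrite -mulrA -exprD addnC exprD mulrA nak_commX -!mulrA.
Qed.

(** The coefficients do not depend on the cutoff [n], so one sequence can be truncated at any
    vanishing power. *)
Lemma nak_expand M (u : M) i a : u • e i = u ->
  exists al : nat -> K, forall n, u • x ^+ n = 0 ->
    u • a = \sum_(0 <= b < n) al b *: (u • x ^+ b).
Proof.
move=> ue; elim/(nak_span H): a => [|c a b [al Ea] [be Eb]|j k].
- exists (fun=> 0) => n _; rewrite ract0r big1 // => b _; by rewrite scale0r.
- exists (fun n => c * al n + be n) => n un.
  rewrite ractDr ractZr (Ea _ un) (Eb _ un) scaler_sumr -big_split.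
  by apply: eq_bigr => k _ /=; rewrite scalerDl scalerA.
have -> : u • (e j * x ^+ k) = if (i == j %[mod N%:Z])%Z then u • x ^+ k else 0.
  have -> : u • (e j * x ^+ k) = u • (e i * e j) • x ^+ k by rewrite !ractA ue.
  by rewrite (nak_orth H); case: ifP => _; rewrite ?ue // ract0r ract0l.
case: ifP => _; last first.
  by exists (fun=> 0) => n _; rewrite big1 // => b _; rewrite scale0r.
exists (fun n => (n == k)%:R) => n un.
have [kn|nk] := ltnP k n.
  rewrite (bigD1_seq k) ?mem_index_iota ?iota_uniq //= eqxx scale1r big1 ?addr0 //.
  by move=> b /negbTE ->; rewrite scale0r.
rewrite big_nat big1 => [|b /andP[_ bn]]; last first.
  by have -> : (b == k) = false; [lia|rewrite scale0r].
by rewrite -(subnKC nk) exprD ractA un ract0l.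
Qed.

Lemma nak_vanish M (v : M) a : v • x ^+ a = 0 -> forall b, (a <= b)%N -> v • x ^+ b = 0.
Proof. by move=> va b /subnKC <-; rewrite exprD ractA va ract0l. Qed.

(** With [l] the least exponent such that [x ^+ l] kills [v], multiplication by [x ^+ (l.-1 - b)]
    kills all terms after the [b]-th, and the earlier ones vanish by induction. *)
Lemma nak_indep M (v : M) (al : nat -> K) n :
  \sum_(0 <= b < n) al b *: (v • x ^+ b) = 0 ->
  forall b, (b < n)%N -> v • x ^+ b != 0 -> al b = 0.
Proof.
move=> s0; elim/ltn_ind => b IH bn vb.
have exl : exists l, v • x ^+ l == 0.
  by have [B xB] := nak_nil; exists B; rewrite xB ract0r.
case: (ex_minnP exl) => l /eqP vl lmin.
have bl : (b < l)%N by rewrite ltnNge; apply: contra vb => lb; rewrite (nak_vanish vl lb).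
have := congr1 (fun y => y • x ^+ (l.-1 - b)) s0.
rewrite ract0l ract_suml (bigD1_seq b) ?mem_index_iota ?iota_uniq //= big1_seq; last first.
  move=> c /andP[cb]; rewrite mem_index_iota => /andP[_ cn].
  have [clb|blc] := ltnP c b.
    rewrite IH ?scale0r ?ract0l //.
    apply: contra vb => /eqP vc; rewrite (nak_vanish vc) //; exact: ltnW.
  by rewrite ractZl -ractA -exprD (nak_vanish vl) ?scaler0 //; lia.
rewrite addr0 ractZl -ractA -exprD => /eqP.
have -> : (b + (l.-1 - b) = l.-1)%N by lia.
by rewrite scaler_eq0 => /orP[/eqP //|/lmin]; lia.
Qed.

(* [u] generates the uniserial module with composition factors, from the top,
   [i, i + 1, ..., i + l - 1]; for [l = 0] the module is zero. *)
Definition igen M (i : int) (l : nat) (u : M) : Prop :=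
  [/\ u • e i = u, forall a, (u • x ^+ a == 0) = (l <= a)%N & forall m, exists a, m = u • a].

Definition isiv M i l : Prop := exists u : M, igen i l u.

Lemma igen_neq0 M i l (u : M) a : igen i l u -> (a < l)%N -> u • x ^+ a != 0.
Proof. by case=> _ -> _ al; rewrite -ltnNge. Qed.
Lemma igen_eq0 M i l (u : M) a : igen i l u -> (l <= a)%N -> u • x ^+ a = 0.
Proof. by case=> _ h _ la; apply/eqP; rewrite h. Qed.

Lemma igen_expand M i l (u : M) m : igen i l u ->
  exists al : nat -> K, m = \sum_(0 <= b < l) al b *: (u • x ^+ b).
Proof.
move=> g; have [ue _ us] := g; have [a ->] := us m.
have [al h] := nak_expand a ue; exists al; apply: h; exact: igen_eq0 g _.
Qed.

(** This is the universal property of [e i A / e i x^l A]. Expanding [e i * a] in the regular module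
    gives coefficients that serve [u] and [v] at the same time; the vanishing of [u • a] then kills
    those below [l]. *)
Lemma igen_ann M M' i l (u : M) (v : M') : igen i l u -> v • e i = v ->
  v • x ^+ l = 0 -> forall a, u • a = 0 -> v • a = 0.
Proof.
move=> g ve vl a ua.
have [ue _ _] := g.
have [al hal] : exists al : nat -> K, forall (M0 : fmod A) (w : M0), w • e i = w ->
    forall n, w • x ^+ n = 0 -> w • a = \sum_(0 <= b < n) al b *: (w • x ^+ b).
  have := @nak_expand (regmod A) (e i) i a (nak_idem i).
  case=> al h; exists al => M0 w we n wn.
  have [B xB] := nak_nil.
  have {}h := h B; rewrite xB /ract /= mulr0 in h; have {}h := h erefl.
  rewrite -we -ractA h ract_sumr we.
  have -> : \sum_(0 <= b < B) w • (al b *: (e i * x ^+ b)) =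
      \sum_(0 <= b < B) al b *: (w • x ^+ b).
    by apply: eq_bigr => b _; rewrite ractZr ractA we.
  have wB : w • x ^+ B = 0 by rewrite xB ract0r.
  have cut p q : (p <= q)%N -> w • x ^+ p = 0 ->
     \sum_(0 <= b < q) al b *: (w • x ^+ b) = \sum_(0 <= b < p) al b *: (w • x ^+ b).
    move=> pq wp; rewrite (big_cat_nat (n := p)) //= [X in _ + X]big_nat.
    rewrite [X in _ + X]big1 ?addr0 // => b /andP[pb _].
    by rewrite (nak_vanish wp pb) scaler0.
  by case: (leqP n B) => [nB|/ltnW Bn]; [exact: cut|rewrite -(cut B n)].
rewrite (hal _ v ve _ vl); rewrite (hal _ u ue _ (igen_eq0 g (leqnn l))) in ua.
rewrite big_nat big1 // => b /andP[_ bl].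
by rewrite (nak_indep ua bl (igen_neq0 g bl)) scale0r.
Qed.

Lemma igen_hom M M' i l (u : M) (v : M') : igen i l u -> v • e i = v ->
  v • x ^+ l = 0 -> exists2 h : 'Hom(M, M'), mhom h & h u = v.
Proof.
move=> g ve vl; apply: cyclic_hom; first by case: g.
exact: igen_ann g ve vl.
Qed.

Lemma igen_iso M M' i l (u : M) (v : M') : igen i l u -> igen i l v -> miso M M'.
Proof.
move=> gu gv; have [ue _ us] := gu; have [ve _ vs] := gv.
have [h hh hu] := igen_hom gu ve (igen_eq0 gv (leqnn l)).
have [k hk kv] := igen_hom gv ue (igen_eq0 gu (leqnn l)).
apply/misoP; exists h, k; split=> // m.
  by have [a ->] := us m; rewrite hh hk hu kv.
by have [a ->] := vs m; rewrite hk hh kv hu.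
Qed.

Lemma igen_transport M M' i l (u : M) (s : 'Hom(M, M')) : igen i l u ->
  mhom s -> (forall v, s v = 0 -> v = 0) -> (forall y, exists v, y = s v) -> igen i l (s u).
Proof.
move=> [ue ux us] hs sinj ssur; split.
- by rewrite -hs ue.
- move=> a; rewrite -hs -ux; apply/eqP/eqP => [/sinj //|->]; exact: hom0.
- by move=> m; have [v ->] := ssur m; have [a ->] := us v; exists a; rewrite hs.
Qed.

Lemma isiv_iso M M' i l : miso M M' -> isiv M i l -> isiv M' i l.
Proof.
move=> /misoP[s [r [hs hr rs sr]]] [u g]; exists (s u).
apply: igen_transport g hs _ _ => [v sv|y]; last by exists (r y).
by rewrite -[v]rs sv hom0.
Qed.

Lemma isiv_miso M M' i l : isiv M i l -> isiv M' i l -> miso M M'.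
Proof. by move=> [u gu] [v gv]; exact: igen_iso gu gv. Qed.

Lemma isiv_mod M i j l : (i = j %[mod N%:Z])%Z -> isiv M i l -> isiv M j l.
Proof. by move=> /nak_mod ij [u [ue ux us]]; exists u; split=> //; rewrite -ij. Qed.

Lemma isiv_le M i l : isiv M i l -> i + l%:Z <= f i.
Proof.
move=> [u g]; have [ue ux us] := g; case: l g ux => [|l] g ux; first by have := nak_gt H i; lia.
have : u • x ^+ l != 0 by apply: igen_neq0 g _.
have -> : u • x ^+ l = u • (e i * x ^+ l) by rewrite ractA ue.
have := nak_pow H i l; case: eqP => [->|_]; first by rewrite ract0r eqxx.
by move=> h _; lia.
Qed.

Lemma isiv_exists i (l : nat) : i + l%:Z <= f i -> exists M, isiv M i l.
Proof.
move=> il.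
have [L LE] : exists L : 'Hom(A, A), forall a, L a = e i * a.
  by apply: lin_hom => c a b; rewrite mulrDr scalerAr.
have [L' LE'] : exists L' : 'Hom(A, A), forall a, L' a = e i * x ^+ l * a.
  by apply: lin_hom => c a b; rewrite mulrDr scalerAr.
(* [U] contains [(1 - e i) A], so the quotient of the regular module by [U] is [e i A / e i x^l A],
   generated by the class of 1. *)
pose U : {vspace regmod A} := (L @^-1: limg L')%VS.
have UP a : a \in U <-> exists b, e i * a = e i * x ^+ l * b.
  rewrite -memv_preim LE; split=> [/limgP[b ->]|[b ->]]; first by exists b; rewrite LE'.
  by apply/limgP; exists b; rewrite LE'.
have sU : submod U.
  move=> a c /UP[b ab]; apply/UP; exists (b * c).
  by have /(congr1 (fun y => y * c)) := ab; rewrite -!mulrA.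
have [Q [q [/mepiP[hq qsur] kq]]] := quo_exists sU.
have q0 (a : regmod A) : (q a == 0) = (a \in U) by rewrite -kq memv_ker.
have qact (a b : regmod A) : q a • b = q (a * b) by rewrite -hq.
exists Q, (q (1 : A)); split.
- rewrite qact mul1r; apply/eqP; rewrite -subr_eq0 -homB q0.
  by apply/UP; exists 0; rewrite mulrBr mulr1 nak_idem subrr mulr0.
- move=> a; rewrite qact mul1r q0.
  apply/idP/idP => [/UP[b ab]|la]; last first.
    by apply/UP; exists (x ^+ (a - l)); rewrite -mulrA -exprD subnKC.
  rewrite leqNgt; apply/negP => al.
  (* This exponent carries [e i * x ^+ a] to the socle of [e i A], where the right side has already
     vanished because [a < l]. *)
  have /(congr1 (fun y => y * x ^+ (absz (f i - i)%R - 1 - a))) := ab.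
  have [b' Eb] := nak_normal b (absz (f i - i)%R - 1 - a).
  rewrite -!mulrA Eb -!exprD !mulrA => h.
  have fi := nak_gt H i.
  have : e i * x ^+ (a + (absz (f i - i)%R - 1 - a)) == 0.
    rewrite h -[_ * x ^+ l * _]mulrA -exprD.
    have -> : e i * x ^+ (l + (absz (f i - i)%R - 1 - a)) = 0.
      by apply/eqP; rewrite (nak_pow H); lia.
    by rewrite mul0r.
  by rewrite (nak_pow H); lia.
- by move=> m; have [a ->] := qsur m; exists a; rewrite qact mul1r.
Qed.

End Intervals.

(** * Injective hulls and direct complements *)

Section Hulls.
Variables (K : fieldType) (A : falgType K).

(** An injective hull together with its cosyzygy [C], which is one step of a minimal injective
    resolution. *)
Definition hull (M E C : fmod A) (i : 'Hom(M, E)) (p : 'Hom(E, C)) : Prop :=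
  [/\ mmono i, mepi p, limg i = lker p, injective_mod E & essential (limg i)].

Lemma split_iso (S M : fmod A) (s : 'Hom(S, M)) (r : 'Hom(M, S)) :
  mhom s -> mhom r -> (forall v, r (s v) = v) ->
  exists R : fmod A, miso M (mprod S R) /\ \dim {:R} = \dim (lker r).
Proof.
move=> hs hr rs.
have sk : submod (lker r).
  by move=> v a; rewrite !memv_ker hr => /eqP ->; rewrite ract0l.
have [R [j [jm jl]]] := sub_exists sk; exists R.
have [hj jinj] := (mmonoP j).1 jm.
split; last first.
  by rewrite -jl limg_dim_eq //; case: jm => _ ->; rewrite capv0.
have [k hk kE] : exists2 k : 'Hom(M, R), mhom k & forall v, j (k v) = (\1 - (s \o r))%VF v.
  apply: factor_mono => //.
    move=> v a; rewrite !add_lfunE !opp_lfunE !id_lfunE !comp_lfunE.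
    by rewrite hr hs ractBl.
  move=> v; rewrite jl memv_ker add_lfunE opp_lfunE id_lfunE comp_lfunE.
  by rewrite homB rs subrr.
have {}kE v : j (k v) = v - s (r v).
  by rewrite kE add_lfunE opp_lfunE id_lfunE comp_lfunE.
have rj v : r (j v) = 0.
  by apply/eqP; rewrite -memv_ker -jl; apply/limgP; exists v.
have [i1 [i2 [p1 [p2 [[hi1 hi2 hp1 hp2] [p1i1 p2i2 p2i1 p1i2] zE]]]]] := mprod_maps S R.
apply/misoP; exists ((i1 \o r) + (i2 \o k))%VF, ((s \o p1) + (j \o p2))%VF; split.
- by move=> v a; rewrite !add_lfunE !comp_lfunE hr hk hi1 hi2 ractDl.
- by move=> v a; rewrite !add_lfunE !comp_lfunE hp1 hp2 hs hj ractDl.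
- move=> v; rewrite !add_lfunE !comp_lfunE !homD p1i1 p1i2 p2i1 p2i2.
  by rewrite !hom0 addr0 add0r addrC kE subrK.
- move=> z; rewrite !add_lfunE !comp_lfunE !homD rs rj hom0 addr0.
  have -> : k (s (p1 z)) = 0 by apply: jinj; rewrite kE rs subrr.
  have -> : k (j (p2 z)) = p2 z.
    by apply/eqP; rewrite -subr_eq0; apply/eqP/jinj; rewrite homB kE rj hom0 subr0 subrr.
  by rewrite ?hom0 add0r -zE.
Qed.

End Hulls.

(** * Injective, projective and indecomposable intervals; decomposition into intervals *)

Section IntervalTheory.
Variables (K : fieldType) (A : falgType K).
Variables (N : nat) (e : int -> A) (x : A) (f : int -> int).
Hypothesis H : nakayama_basis N e x f.
Implicit Types (M E P : fmod A).
Local Notation igen := (igen e x).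
Local Notation isiv := (isiv e x).

Lemma igen_act_e M i l (u : M) a j : igen i l u ->
  u • x ^+ a • e j = if (i + a%:Z == j %[mod N%:Z])%Z then u • x ^+ a else 0.
Proof.
case=> ue _ _.
have E : u • x ^+ a • e (i + a%:Z) = u • x ^+ a by rewrite -ractA -(nak_commX H) ractA ue.
by rewrite -{1}E -ractA (nak_orth H); case: ifP => _; rewrite ?E ?ract0r.
Qed.

Lemma igen_functional M i l (u : M) : igen i l u -> (0 < l)%N ->
  exists xi : 'Hom(M, K^o), forall a, xi (u • x ^+ a) = (a == l.-1)%:R.
Proof.
move=> g l0; pose X := [tuple u • x ^+ val j | j < l].
have XE (j : 'I_l) : X`_j = u • x ^+ j by rewrite (nth_mktuple (fun j : 'I_l => u • x ^+ val j)).
have freeX : free X.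
  apply/freeP => k s0 j.
  pose al n := if insub n is Some i0 then k i0 else 0.
  have alE (i0 : 'I_l) : al i0 = k i0 by rewrite /al valK.
  rewrite -alE; apply: (nak_indep H (v := u) (n := l)) => //; last exact: igen_neq0 g _.
  by rewrite big_mkord -[RHS]s0; apply: eq_bigr => i0 _; rewrite alE XE.
have l1 : (l.-1 < l)%N by case: (l) l0.
pose j := Ordinal l1.
have [xi xiE] : exists xi : 'Hom(M, K^o), xi =1 coord X j.
  by apply: lin_hom => c y z; rewrite linearP.
exists xi => a; rewrite xiE.
have [al|la] := ltnP a l.
  by have <- := XE (Ordinal al); rewrite coord_free // -val_eqE.
rewrite (igen_eq0 g la) linear0; case: eqP => // al; move: la; rewrite al leqNgt l1 //.
Qed.

Lemma mhom_gen M E (h : 'Hom(M, E)) : (forall m j, h (m • e j) = h m • e j) ->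
  (forall m, h (m • x) = h m • x) -> mhom h.
Proof.
move=> he hx m a; move: a m; apply: (nak_span H) => [m|c a b IHa IHb m|i k m].
- by rewrite !ract0r hom0.
- by rewrite !ractDr !ractZr homD homZ IHa IHb.
rewrite !ractA -he; move: (m • e i) => {}m.
elim: k => [|k IH]; first by rewrite !expr0 !ract1.
by rewrite exprSr !ractA hx IH.
Qed.

(** A map into a uniserial module is recovered from its socle coordinate [xi]: the coefficient of
    [u • x ^+ a] in [h m] is [xi (h (m • (e (i + a) * x ^+ (l.-1 - a))))]. Extending that functional
    linearly to [M'] gives [h']. The last hypothesis makes it commute with [x]; it holds if
    [e (i - 1) * x ^+ l] is zero in [A] (injectivity of [E]) and if [x ^+ l] kills [M'] (splitting
    off a longest interval). *)
Lemma igen_extend E M M' i l (u : E) (g : 'Hom(M, M')) (h : 'Hom(M, E)) :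
  igen i l u -> mmono g -> mhom h -> (forall n : M', n • (e (i - 1) * x ^+ l) = 0) ->
  exists2 h' : 'Hom(M', E), mhom h' & (h' \o g)%VF = h.
Proof.
move=> gu gm hh kil.
have [u0|l0] := posnP l.
  exists 0; first exact: mhom0.
  apply/lfunP => m; rewrite comp_lfun0l; have [ue ux us] := gu.
  have [a ->] := us (h m).
  have /eqP : u • x ^+ 0 == 0 by rewrite ux u0.
  by rewrite expr0 ract1 => ->; rewrite ract0l zero_lfunE.
have [xi xiE] := igen_functional gu l0.
pose eta := (xi \o h \o g^-1)%VF.
have etaE m : eta (g m) = xi (h m).
  by rewrite !comp_lfunE lker0_lfunK //; case: gm => _ ->.
have [hg ginj] := (mmonoP g).1 gm.
pose F n a := eta (n • (e (i + a%:Z) * x ^+ (l.-1 - a))) : K.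
have [h' h'E] : exists h' : 'Hom(M', E), forall n,
    h' n = \sum_(0 <= a < l) F n a *: (u • x ^+ a).
  apply: lin_hom => c y z; rewrite scaler_sumr -big_split; apply: eq_bigr => a _ /=.
  by rewrite /F ractDl ractZl homD homZ scalerDl scalerA.
exists h'.
  apply: mhom_gen => [n j|n].
    rewrite !h'E ract_suml; apply: eq_bigr => a _; rewrite ractZl (igen_act_e _ _ gu).
    rewrite /F -!ractA mulrA (nak_orth H) eq_sym.
    case: eqP => [/(nak_mod H) ->//|_].
    by rewrite mul0r ract0r hom0 scale0r scaler0.
  pose G a := (eta (n • (e (i + a%:Z - 1) * x ^+ (l - a))) : K) *: (u • x ^+ a).
  have -> : h' (n • x) = \sum_(0 <= a < l) G a.
    rewrite h'E; apply: eq_big_nat => a /andP[_ al]; rewrite /F /G -ractA; congr (eta _ *: _).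
    have -> : i + a%:Z = (i + a%:Z - 1) + 1 by lia.
    rewrite mulrA -(nak_comm H) addrK -mulrA -exprS; congr (_ • (_ * x ^+ _)); lia.
  have -> : h' n • x = \sum_(0 <= a < l) G a.+1.
    rewrite h'E ract_suml; apply: eq_big_nat => a /andP[_ al].
    rewrite /F /G ractZl -ractA -exprSr; congr (eta (_ • (e _ * x ^+ _)) *: _); lia.
  (* The two sums differ by boundary terms only: [G 0] dies by the hypothesis on [M'], [G l] by
     [u • x ^+ l = 0]. *)
  have E0 : \sum_(0 <= a < l) G a + G l = G 0%N + \sum_(0 <= a < l) G a.+1.
    by rewrite -big_nat_recl // big_nat_recr.
  have G0 : G 0%N = 0 by rewrite /G addr0 subn0 kil hom0 scale0r.
  have Gl : G l = 0 by rewrite /G (igen_eq0 gu (leqnn l)) scaler0.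
  by move: E0; rewrite G0 Gl addr0 add0r.
apply/lfunP => m; rewrite comp_lfunE h'E.
have [al alE] := igen_expand H (h m) gu.
rewrite {1}alE; apply: eq_big_nat => a /andP[_ la]; congr (_ *: _).
rewrite /F -hg etaE hh alE ract_suml hom_sum.
rewrite (bigD1_seq a) ?mem_index_iota ?iota_uniq //= big1_seq.
  rewrite ractZl homZ ractA (igen_act_e _ _ gu) eqxx -ractA -exprD xiE subnKC; last lia.
  by rewrite eqxx addr0; exact: mulr1.
move=> b /andP[ba _]; rewrite ractZl homZ ractA (igen_act_e _ _ gu).
case: ifP => _; last by rewrite ract0l hom0 scaler0.
rewrite -ractA -exprD xiE; case: eqP => [bE|_]; last by rewrite scaler0.
have ab : b = a by lia.
by rewrite ab eqxx in ba.
Qed.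

Lemma isiv_injective M i l : isiv M i l -> f (i - 1) < i + l%:Z -> injective_mod M.
Proof.
move=> [u g] il M1 M2 k h km hh; apply: (igen_extend g) => // n.
have -> : e (i - 1) * x ^+ l = 0 by apply/eqP; rewrite (nak_pow H); lia.
by rewrite ract0r.
Qed.

Lemma igen_lead M i l (u : M) m : igen i l u -> m != 0 ->
  exists b al, [/\ (b < l)%N, al b != 0 & m = \sum_(b <= c < l) al c *: (u • x ^+ c)].
Proof.
move=> g m0; have [al mE] := igen_expand H m g.
have ex : exists b, (b < l)%N && (al b != 0).
  apply/not_existsP => h; case/negP: m0; rewrite mE big_nat big1 // => b /andP[_ bl].
  have := h b; rewrite bl /= => /negP; rewrite negbK => /eqP ->; exact: scale0r.
case: (ex_minnP ex) => b /andP[bl ab] bmin; exists b, al; split=> //.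
rewrite mE (big_cat_nat (n := b)) ?(ltnW bl) //= big_nat big1 ?add0r // => c /andP[_ cb].
have : ~~ ((c < l)%N && (al c != 0)) by apply: contraL cb => /bmin; rewrite -leqNgt.
by rewrite (ltn_trans cb bl) /= negbK => /eqP ->; rewrite scale0r.
Qed.

Lemma igen_low M i l (u : M) (U : {vspace M}) m : igen i l u -> submod U ->
  m \in U -> m != 0 ->
  exists b, [/\ (b < l)%N, u • x ^+ b \in U & exists c, m = u • x ^+ b • c].
Proof.
move=> g sU mU m0; have [b [al [bl ab mE]]] := igen_lead g m0.
exists b; split=> //.
  (* Triangular elimination from the socle upwards: a multiple of [m] has leading term
     [u • x ^+ (l - n)], and its later terms are already in [U]. *)
  have key n : (n <= l - b)%N -> u • x ^+ (l - n) \in U.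
    elim/ltn_ind: n => n IH nl.
    have [->|n0] := posnP n; first by rewrite subn0 (igen_eq0 g (leqnn l)) mem0v.
    have := sU _ (x ^+ (l - n - b)) mU.
    rewrite mE ract_suml big_ltn // ractZl -ractA -exprD.
    have -> : (b + (l - n - b) = l - n)%N by lia.
    set S := \sum_(_ <= _ < _ | _) _ => yS.
    suff SU : S \in U.
      have := memvB yS SU; rewrite addrK => /(memvZ (al b)^-1).
      by rewrite scalerA mulVf // scale1r.
    rewrite /S.
    rewrite big_seq; apply: rpred_sum => c; rewrite mem_index_iota => /andP[bc cl].
    rewrite ractZl -ractA -exprD rpredZ //.
    have [lc|cl'] := leqP l (c + (l - n - b)); first by rewrite (igen_eq0 g lc) mem0v.
    have -> : (c + (l - n - b) = l - (l - (c + (l - n - b))))%N by lia.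
    by apply: IH; lia.
  by have := key (l - b)%N (leqnn _); rewrite subKn // ltnW.
exists (\sum_(b <= c < l) al c *: x ^+ (c - b)).
rewrite mE ract_sumr; apply: eq_big_nat => c /andP[bc _].
by rewrite ractZr -ractA -exprD subnKC.
Qed.

Lemma igen_socle_mem M i l (u : M) (U : {vspace M}) : igen i l u -> submod U ->
  U <> 0%VS -> u • x ^+ l.-1 \in U.
Proof.
move=> g sU /vspace_nonzero [m mU m0].
have [b [bl ub _]] := igen_low g sU mU m0.
have -> : l.-1 = (b + (l.-1 - b))%N by lia.
by rewrite exprD ractA; apply: sU.
Qed.

Lemma igen_mono M M' i l (u : M) (h : 'Hom(M, M')) : igen i l u -> mhom h ->
  h (u • x ^+ l.-1) != 0 -> mmono h.
Proof.
move=> g hh hu; split=> //; apply: contrapT => kh; case/negP: hu.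
rewrite -memv_ker; apply: (igen_socle_mem g) => // v a.
by rewrite !memv_ker hh => /eqP ->; rewrite ract0l.
Qed.

Lemma igen_submod M i l (u : M) (U : {vspace M}) : igen i l u -> submod U ->
  exists a, (a <= l)%N /\ forall m, m \in U <-> exists c, m = u • x ^+ a • c.
Proof.
move=> g sU.
have ex : exists a, u • x ^+ a \in U by exists l; rewrite (igen_eq0 g (leqnn l)) mem0v.
case: (ex_minnP ex) => a ua amin; exists a; split.
  by apply: amin; rewrite (igen_eq0 g (leqnn l)) mem0v.
move=> m; split=> [mU|[c ->]]; last exact: sU.
have [->|m0] := eqVneq m 0; first by exists 0; rewrite ract0r.
have [b [bl /amin ab [c ->]]] := igen_low g sU mU m0.
by exists (x ^+ (b - a) * c); rewrite ractA -[u • x ^+ a • x ^+ _]ractA -exprD subnKC.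
Qed.

Lemma igen_mem M i l (u : M) a b : igen i l u -> (a <= l)%N ->
  (exists c, u • x ^+ b = u • x ^+ a • c) <-> (a <= b)%N.
Proof.
move=> g al; split=> [[c]|ab]; last first.
  by exists (x ^+ (b - a)); rewrite -ractA -exprD subnKC.
move=> E; rewrite leqNgt; apply/negP => ba.
have /(congr1 (fun y => y • x ^+ (l.-1 - b))) := E.
have [c' cE] := nak_normal H c (l.-1 - b).
have -> : u • x ^+ a • c • x ^+ (l.-1 - b) = 0.
  rewrite -!ractA cE mulrA -exprD ractA.
  have -> : u • x ^+ (a + (l.-1 - b)) = 0 by apply: igen_eq0 g _; lia.
  by rewrite ract0l.
by rewrite -ractA -exprD; apply/eqP; apply: igen_neq0 g _; lia.
Qed.

(** The module is the radical of the interval of length [l + 1] starting at [i - 1]. A retraction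
    would write the generator [u] as an element of [M x], and then [u • x ^+ l.-1] would be zero. *)
Lemma isiv_not_injective M i l : isiv M i l -> (0 < l)%N -> i + l%:Z <= f (i - 1) ->
  ~ injective_mod M.
Proof.
move=> [u g] l0 il Mi; have [ue ux us] := g.
have [W [w gw]] : exists W, isiv W (i - 1) l.+1 by apply: (isiv_exists H); lia.
have [we wx ws] := gw.
have wxe : w • x • e i = w • x.
  by have := igen_act_e 1 i gw; rewrite expr1 subrK eqxx.
have wxl : w • x • x ^+ l = 0 by rewrite -ractA -exprS (igen_eq0 gw).
have [h hh hu] := igen_hom H g wxe wxl.
have hm : mmono h.
  apply: (igen_mono g hh); rewrite hh hu -ractA -exprS; apply: igen_neq0 gw _; lia.
have [r hr rh] := Mi _ _ h \1%VF hm (@mhom_id _ _ M).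
have [a ra] := us (r w).
have uE : u = u • a • x.
  by rewrite -ra -hr -hu -[r (h u)]comp_lfunE rh id_lfunE.
have [a' aE] := nak_normal H a l.
have : u • x ^+ l.-1 = 0.
  rewrite uE -!ractA -exprS prednK // aE ractA (igen_eq0 g) ?ract0l //.
by apply/eqP; apply: igen_neq0 g _; lia.
Qed.

Lemma isiv_projective M i l : isiv M i l -> i + l%:Z = f i -> projective M.
Proof.
move=> [u g] il M1 M2 k h /mepiP[hk ksur] hh.
have [ue ux us] := g.
have [w wE] := ksur (h u).
have we : w • e i • e i = w • e i by rewrite -ractA (nak_idem H).
have wl : w • e i • x ^+ l = 0.
  have -> : w • e i • x ^+ l = w • (e i * x ^+ l) by rewrite ractA.
  by have /eqP -> : e i * x ^+ l == 0; [rewrite (nak_pow H) il|rewrite ract0r].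
have [h' hh' h'u] := igen_hom H g we wl.
exists h' => //; apply/lfunP => m; have [a ->] := us m.
by rewrite comp_lfunE hh' hk h'u hk -wE -hh ue hh.
Qed.

(** The surjection from [e i A] onto [M] splits, and the section has leading coefficient 1 at [u],
    so it loses no power of [x]. The subspace [V] is zero for a cyclic projective, and the kernel of
    a cover or of a presentation map when a generator is only known modulo that kernel. *)
Lemma projective_cyclic M i (u : M) (V : {vspace M}) : projective M -> u • e i = u ->
  superfluous V -> (forall m, exists a v, v \in V /\ m = u • a + v) -> u != 0 ->
  exists2 l, i + l%:Z = f i & igen i l u.
Proof.
move=> Mp ue Vs uV u0.
have [L LE] : exists L : 'Hom(A, M), L =1 ract u.
  by apply: lin_hom => c a b; rewrite ractDr ractZr.
have us m : exists a, m = u • a.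
  have sL : submod (limg L).
    by move=> v a /limgP[b ->]; apply/limgP; exists (b * a); rewrite !LE ractA.
  have /(Vs _ sL) Lf : (V + limg L)%VS = fullv.
    apply: vspace_full => v; have [a [v' [vV ->]]] := uV v.
    by rewrite addrC memv_add //; apply/limgP; exists a; rewrite LE.
  have : m \in limg L by rewrite Lf memvf.
  by move=> /limgP[a ->]; exists a.
pose c := absz (f i - i)%R; have fi := nak_gt H i.
have ic : i + c%:Z = f i by lia.
have [P [w gw]] : exists P, isiv P i c by apply: (isiv_exists H); lia.
have uc : u • x ^+ c = 0.
  rewrite -ue -ractA; have /eqP -> : e i * x ^+ c == 0; last by rewrite ract0r.
  by rewrite (nak_pow H) ic.
exists c => //.
have [q hq qw] := igen_hom H gw ue uc.
have qe : mepi q.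
  by apply/mepiP; split=> // m; have [a ->] := us m; exists (w • a); rewrite hq qw.
have [s hs qs] := Mp _ _ q \1%VF qe (@mhom_id _ _ M).
have {}qs m : q (s m) = m by rewrite -comp_lfunE qs id_lfunE.
have [we wx ws] := gw.
split=> // a; apply/eqP/idP => [ua|ca]; last first.
  by rewrite -(subnKC ca) exprD ractA uc ract0l.
rewrite leqNgt; apply/negP => ac.
have [b sb] := ws (s u).
have [al alE] := nak_expand H b we.
have B := nak_nil H; case: B => B xB.
have sE := alE B; rewrite xB ract0r in sE; have {}sE := sE erefl.
have B0 : (0 < B)%N.
  by case: (B) xB => // x0; have := igen_neq0 gw (leq_ltn_trans (leq0n a) ac); rewrite x0 ract0r eqxx.
have uE : u = \sum_(0 <= n < B) al n *: (u • x ^+ n).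
  rewrite -{1}[u]qs sb sE hom_sum; apply: eq_bigr => n _.
  by rewrite homZ hq qw.
(* Applying [q] to the expansion of [s u] returns [u]; compare the coefficients of [u] itself. *)
have al0 : al 0%N = 1.
  have : \sum_(0 <= n < B) (al n - (n == 0%N)%:R) *: (u • x ^+ n) = 0.
    rewrite (eq_bigr (fun n => al n *: (u • x ^+ n) - (n == 0%N)%:R *: (u • x ^+ n))).
      rewrite sumrB -uE big_ltn // big_nat big1 ?addr0.
        by rewrite expr0 ract1 eqxx scale1r subrr.
      by move=> n /andP[n0 _]; case: n n0 => // n _; rewrite scale0r.
    by move=> n _; rewrite scalerBl.
  move=> /(nak_indep H)/(_ 0%N B0); rewrite expr0 ract1 => /(_ u0)/eqP.
  by rewrite subr_eq0 => /eqP.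
have : s u • x ^+ a = 0 by rewrite -hs ua hom0.
rewrite sb sE ract_suml.
rewrite (eq_bigr (fun n => al n *: (w • x ^+ a • x ^+ n))); last first.
  by move=> n _; rewrite ractZl -!ractA -!exprD addnC.
move=> /(nak_indep H)/(_ 0%N B0); rewrite al0 expr0 ract1 (igen_neq0 gw ac).
by move=> /(_ isT)/eqP; rewrite oner_eq0.
Qed.

Lemma superfluous0 M : superfluous (0%VS : {vspace M}).
Proof. by move=> V _; rewrite add0v. Qed.

Lemma isiv_projective_len M i l : isiv M i l -> (0 < l)%N -> projective M -> i + l%:Z = f i.
Proof.
move=> [u g] l0 Mp; have [ue ux us] := g.
have u0 : u != 0 by have := igen_neq0 g l0; rewrite expr0 ract1.
have [|l' l'E [_ ux' _]] := projective_cyclic Mp ue (@superfluous0 M) _ u0.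
  by move=> m; have [a ->] := us m; exists a, 0; rewrite mem0v addr0.
have := ux' l; rewrite ux leqnn => ll; have := ux l'; rewrite ux' leqnn => l'l.
by have -> : l = l' by lia.
Qed.

(** Take [l] least such that [x ^+ l] kills [M], and [u] with [u • x ^+ l.-1] nonzero. The identity
    of [u A] extends to [M] by [igen_extend], whose hypothesis is met because [x ^+ l] kills
    everything. *)
Lemma interval_retract M : (exists m : M, m != 0) ->
  exists (S : fmod A) i l (s : 'Hom(S, M)) (r : 'Hom(M, S)),
    [/\ mhom s, mhom r, forall v, r (s v) = v, isiv S i l & (0 < l)%N].
Proof.
case=> m0 m0P.
have ex : exists l, `[< forall m : M, m • x ^+ l = 0 >].
  by have [B xB] := nak_nil H; exists B; apply/asboolP => m; rewrite xB ract0r.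
case: (ex_minnP ex) => l /asboolP kil lmin.
have l0 : (0 < l)%N.
  by case: (l) kil => // /(_ m0); rewrite expr0 ract1 => E; rewrite E eqxx in m0P.
have [m /eqP mP] : exists m : M, m • x ^+ l.-1 <> 0.
  apply/not_existsP => h.
  have : (l <= l.-1)%N by apply: lmin; apply/asboolP => m; apply: contrapT; apply: h.
  by lia.
have [i iP] : exists i : 'I_N, m • e i%:Z • x ^+ l.-1 != 0.
  apply/not_existsP => h; case/negP: mP.
  rewrite -[m]ract1 -(nak_sum H) ract_sumr ract_suml big_mkord big1 // => i _.
  by apply/eqP/negPn/negP; apply: h.
pose u := m • e i%:Z.
have ue : u • e i%:Z = u by rewrite -ractA (nak_idem H).
have [L LE] : exists L : 'Hom(A, M), L =1 ract u.
  by apply: lin_hom => c a b; rewrite ractDr ractZr.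
have sL : submod (limg L).
  by move=> v a /limgP[b ->]; apply/limgP; exists (b * a); rewrite !LE ractA.
have [S [s [sm sl]]] := sub_exists sL; have [hs sinj] := (mmonoP s).1 sm.
have [v vE] : exists v, u = s v.
  by apply/limgP; rewrite sl; apply/limgP; exists 1; rewrite LE ract1.
have inj y z : s y = s z -> y = z.
  by move=> E; apply/eqP; rewrite -subr_eq0; apply/eqP/sinj; rewrite homB E subrr.
have gv : igen i%:Z l v.
  split; first by apply: inj; rewrite hs -vE.
    move=> a; have -> : (v • x ^+ a == 0) = (u • x ^+ a == 0).
      by rewrite vE -hs; apply/eqP/eqP => [->|/sinj //]; rewrite hom0.
    apply/idP/idP => [ua|la]; last by rewrite -(subnKC la) exprD ractA kil ract0l.
    rewrite leqNgt; apply/negP => al; case/negP: iP.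
    have -> : l.-1 = (a + (l.-1 - a))%N by lia.
    by rewrite -/u exprD ractA (eqP ua) ract0l.
  move=> y; have : s y \in limg L by rewrite -sl; apply/limgP; exists y.
  by move=> /limgP[a aE]; exists a; apply: inj; rewrite hs -vE aE LE.
have [|r hr rs] := igen_extend gv sm (@mhom_id _ _ S).
  by move=> n; rewrite ractA kil.
exists S, i%:Z, l, s, r; split=> //; last by exists v.
by move=> y; rewrite -comp_lfunE rs id_lfunE.
Qed.

(** This plays the part of a decomposition into indecomposables: splitting an interval off a nonzero
    module lowers the dimension. *)
Lemma fmod_ind (Q : fmod A -> Prop) :
  (forall M M', miso M M' -> Q M -> Q M') ->
  (forall M M', Q M -> Q M' -> Q (mprod M M')) ->
  (forall M i l, isiv M i l -> Q M) -> forall M, Q M.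
Proof.
move=> Qi Qp Qv M; move: {2}(\dim {:M}) (leqnn (\dim {:M})) => n.
elim: n M => [|n IH] M Mn.
  (* The zero module is the interval of length 0. *)
  apply: (Qv M 0 0%N); exists 0.
  have M0 (m : M) : m = 0.
    have : (fullv : {vspace M}) == 0%VS by rewrite -dimv_eq0 -leqn0.
    by move=> /eqP E; apply/eqP; rewrite -memv0 -E memvf.
  split; first by rewrite ract0l.
    by move=> a; rewrite ract0l eqxx.
  by move=> m; exists 0; rewrite ract0l; exact: M0.
have [mP|m0] := pselect (exists m : M, m != 0); last first.
  apply: IH; have -> : (fullv : {vspace M}) = 0%VS; last by rewrite dimv0.
  apply: vspace_zero => v _; apply/eqP/negPn/negP => v0; apply: m0; by exists v.
have [S [i [l [s [r [hs hr rs ivS l0]]]]]] := interval_retract mP.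
have [R [isoR dimR]] := split_iso hs hr rs.
apply: (Qi _ _ (miso_sym isoR)); apply: Qp; first exact: Qv ivS.
apply: IH; rewrite dimR.
have kr : lker r != fullv.
  apply/eqP => kr; have [u g] := ivS.
  have := igen_neq0 g l0; rewrite expr0 ract1 => /negP; apply.
  by rewrite -[u]rs -memv_ker kr memvf.
have := dimv_leqif_eq (subvf (lker r)); rewrite /leqif (negbTE kr) => -[le ne].
by move: Mn le ne; case: ltngtP => //; lia.
Qed.

Lemma isiv_indecomposable M i l : isiv M i l -> (0 < l)%N -> indecomposable M.
Proof.
move=> [u g] l0; split.
  move=> M0; have := igen_neq0 g l0; rewrite -memv0 -M0 memvf //.
move=> U V sU sV _ UV.
have [->|/eqP nU] := eqVneq U 0%VS; first by left.
have [->|/eqP nV] := eqVneq V 0%VS; first by right.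
have : u • x ^+ l.-1 \in (U :&: V)%VS.
  by rewrite memv_cap (igen_socle_mem g sU nU) (igen_socle_mem g sV nV).
rewrite UV memv0 (negbTE (igen_neq0 g _)) //; lia.
Qed.

Lemma indecomposable_isiv M : indecomposable M -> exists i l, isiv M i l /\ (0 < l)%N.
Proof.
move=> [/vspace_nonzero [m _ m0] ind].
have [|S [i [l [s [r [hs hr rs ivS l0]]]]]] := @interval_retract M; first by exists m.
exists i, l; split=> //; have [u g] := ivS; exists (s u).
have sinj v : s v = 0 -> v = 0 by move=> E; rewrite -[v]rs E hom0.
apply: (igen_transport g hs sinj) => y.
have [||||E|E] := ind (limg s) (lker r).
- by move=> v a /limgP[w ->]; apply/limgP; exists (w • a); rewrite hs.
- by move=> v a; rewrite !memv_ker hr => /eqP ->; rewrite ract0l.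
- apply: vspace_full => v; have -> : v = s (r v) + (v - s (r v)) by rewrite addrC subrK.
  rewrite memv_add //; first by apply/limgP; exists (r v).
  by rewrite memv_ker homB rs subrr.
- apply: vspace_zero => v; rewrite memv_cap memv_ker => /andP[/limgP[w ->]].
  by rewrite rs => /eqP ->; rewrite hom0.
- have : s u \in limg s by apply/limgP; exists u.
  rewrite E memv0 => /eqP /sinj u0.
  by have := igen_neq0 g l0; rewrite u0 ract0l eqxx.
- exists (r y); apply/eqP; rewrite -subr_eq0 -memv0 -E memv_ker homB rs subrr //.
Qed.

(** [M] is the submodule [w • x ^+ d A] of [E], essential because all nonzero submodules of [E]
    share its socle. *)
Lemma interval_hull M E C i0 (d l : nat) : isiv M (i0 + d%:Z) l -> (0 < l)%N ->
  isiv E i0 (d + l) -> isiv C i0 d -> f (i0 - 1) < i0 + (d + l)%N%:Z ->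
  exists (i : 'Hom(M, E)) (p : 'Hom(E, C)), hull i p.
Proof.
move=> [u gu] l0 [w gw] [z gz] fi.
have [ue ux us] := gu; have [we wx ws] := gw; have [ze zx zs] := gz.
have wde : w • x ^+ d • e (i0 + d%:Z) = w • x ^+ d by rewrite (igen_act_e _ _ gw) eqxx.
have wdl : w • x ^+ d • x ^+ l = 0 by rewrite -ractA -exprD (igen_eq0 gw).
have [i hi iu] := igen_hom H gu wde wdl.
have zdl : z • x ^+ (d + l) = 0 by rewrite (igen_eq0 gz) // leq_addr.
have [p hp pw] := igen_hom H gw ze zdl.
have lim m : m \in limg i <-> exists a, m = w • x ^+ d • a.
  split=> [/limgP[v ->]|[a ->]]; last by apply/limgP; exists (u • a); rewrite hi iu.
  by have [a ->] := us v; exists a; rewrite hi iu.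
have slim : submod (limg i).
  by move=> v a /lim[b ->]; apply/lim; exists (b * a); rewrite ractA.
have sker : submod (lker p).
  by move=> v a; rewrite !memv_ker hp => /eqP ->; rewrite ract0l.
exists i, p; split.
- by apply: (igen_mono gu hi); rewrite hi iu -ractA -exprD; apply: igen_neq0 gw _; lia.
- by apply/mepiP; split=> // y; have [a ->] := zs y; exists (w • a); rewrite hp pw.
- have [a [al aE]] := igen_submod gw sker.
  have ad : a = d.
    have E1 b : (a <= b)%N = (d <= b)%N.
      rewrite -zx -pw -hp -memv_ker; apply/idP/idP => [ab|].
        by apply/aE/(igen_mem b gw al).
      by move=> /aE/(igen_mem b gw al).
    by have := E1 a; have := E1 d; rewrite !leqnn; lia.
  apply/vspaceP => m; apply/idP/idP => [/lim h|/aE h].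
    by apply/aE; rewrite ad.
  by apply/lim; rewrite -ad.
- apply: (isiv_injective (i := i0) (l := d + l)) => //; by exists w.
move=> V sV V0; apply: contrapT => nV.
have := igen_socle_mem gw sV nV => wV.
have nL : limg i <> 0%VS.
  move=> L0; have : i u \in limg i by apply/limgP; exists u.
  rewrite L0 iu memv0 (negbTE (igen_neq0 gw _)) //; lia.
have : w • x ^+ (d + l).-1 \in (limg i :&: V)%VS.
  by rewrite memv_cap wV (igen_socle_mem gw slim nL).
rewrite V0 memv0 (negbTE (igen_neq0 gw _)) //; lia.
Qed.

Lemma zero_hull M i : isiv M i 0 -> hull (\1%VF : 'Hom(M, M)) (\1%VF : 'Hom(M, M)).
Proof.
move=> [u [ue ux us]].
have u0 : u = 0 by apply/eqP; have := ux 0%N; rewrite expr0 ract1 leqnn.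
have M0 (m : M) : m = 0 by have [a ->] := us m; rewrite u0 ract0l.
split.
- apply/mmonoP; split=> [|m _]; [exact: mhom_id|exact: M0].
- by apply/mepiP; split=> [|m]; [exact: mhom_id|exists m; rewrite id_lfunE].
- apply/vspaceP => m; rewrite [m]M0 !mem0v //.
- move=> M1 M2 g h gm hh; exists 0; first exact: mhom0.
  by apply/lfunP => m; rewrite [LHS]M0 [RHS]M0.
- by move=> V _ _; apply: vspace_zero => v _; exact: M0.
Qed.

End IntervalTheory.

(** * Injective resolutions, dominant dimension and defect *)

Lemma enat_le_ext (y z : enat) :
  (forall t, enat_le (Some t) y <-> enat_le (Some t) z) -> y = z.
Proof.
case: y => [m|]; case: z => [n|] //= h.
- by congr Some; have [] := h m; have [] := h n; rewrite /= !leqnn; lia.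
- by have [_ /(_ isT)] := h m.+1; rewrite ltnn.
- by have [/(_ isT)] := h n.+1; rewrite ltnn.
Qed.

Section Resolutions.
Variables (K : fieldType) (A : falgType K).
Implicit Types (M E C : fmod A).

Definition proj_injective_steps M (t : nat) : Prop :=
  exists (I : nat -> fmod A) (eta : 'Hom(M, I 0%N)) d,
    @min_inj_resolution K A M I eta d /\ forall j, (j < t)%N -> projective (I j).
Local Notation steps := proj_injective_steps.

(** The elementwise criterion is the form that passes to direct sums. *)
Lemma essentialP M (U : {vspace M}) :
  essential U <-> forall v, v != 0 -> exists a, v • a != 0 /\ v • a \in U.
Proof.
split=> [Ue v v0|h V sV UV]; last first.
  apply: contrapT => /vspace_nonzero [v vV /h [a [va0 vaU]]].
  case/negP: va0; rewrite -memv0 -UV memv_cap vaU; exact: sV.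
have [L LE] : exists L : 'Hom(A, M), L =1 ract v.
  by apply: lin_hom => c a b; rewrite ractDr ractZr.
have sL : submod (limg L).
  by move=> w a /limgP[b ->]; apply/limgP; exists (b * a); rewrite !LE ractA.
have [w] : exists2 w, w \in (U :&: limg L)%VS & w != 0.
  apply: vspace_nonzero => /(Ue _ sL) L0; case/negP: v0; rewrite -memv0 -L0.
  by apply/limgP; exists 1; rewrite LE ract1.
rewrite memv_cap => /andP[wU /limgP[a wE]] w0; exists a.
by rewrite -LE -wE.
Qed.

(** The extension [h] of [eta] is injective since [i] is essential, hence split by some [k]; and [k]
    is injective since [eta] is essential. *)
Lemma hull_uniq M E C (I0 : fmod A) (i : 'Hom(M, E)) (p : 'Hom(E, C)) (eta : 'Hom(M, I0)) :
  hull i p -> mmono eta -> injective_mod I0 -> essential (limg eta) ->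
  exists (h : 'Hom(E, I0)) (k : 'Hom(I0, E)), [/\ mhom h, mhom k,
    forall v, k (h v) = v, forall v, h (k v) = v & forall m, h (i m) = eta m].
Proof.
move=> [im _ _ Ei ie] em I0i ee.
have [hi iinj] := (mmonoP i).1 im; have [he einj] := (mmonoP eta).1 em.
have [h hh hE] := I0i _ _ i eta im he.
have {}hE m : h (i m) = eta m by rewrite -comp_lfunE hE.
have hm : mmono h.
  split=> //; apply: ie => [v a|]; first by rewrite !memv_ker hh => /eqP ->; rewrite ract0l.
  apply: vspace_zero => v; rewrite memv_cap memv_ker => /andP[/limgP[m ->]].
  by rewrite hE => /eqP /einj ->; rewrite hom0.
have [k hk kE] := Ei _ _ h \1%VF hm (@mhom_id _ _ E).
have {}kE v : k (h v) = v by rewrite -comp_lfunE kE id_lfunE.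
have [_ kinj] : mmono k.
  split=> //; apply: ee => [v a|]; first by rewrite !memv_ker hk => /eqP ->; rewrite ract0l.
  apply: vspace_zero => v; rewrite memv_cap memv_ker => /andP[/limgP[m ->]].
  by rewrite -hE kE => /eqP /iinj ->; rewrite !hom0.
exists h, k; split=> // v; apply/eqP; rewrite -subr_eq0 -memv0 -kinj memv_ker.
by rewrite homB kE subrr.
Qed.

Lemma resolution_cons M E C (I : nat -> fmod A) (i : 'Hom(M, E)) (p : 'Hom(E, C))
    (eta : 'Hom(C, I 0%N)) d :
  hull i p -> @min_inj_resolution K A C I eta d ->
  exists (eta' : 'Hom(M, E)) d', @min_inj_resolution K A M
    (fun j => match j with 0%N => E | j'.+1 => I j' end) eta' d'.
Proof.
move=> [im /mepiP[hp psur] ip Ei ie] [Ii [/mmonoP[he einj] hd] [le ld] [ee ed]].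
pose I' j : fmod A := match j with 0%N => E | j'.+1 => I j' end.
exists i.
exists (fun j => match j return 'Hom(I' j, I' j.+1) with
   | 0%N => (eta \o p)%VF | j'.+1 => d j' end).
have lep : limg (eta \o p)%VF = limg eta.
  apply/vspaceP => v; apply/limgP/limgP => [[w ->]|[w ->]]; first by exists (p w); rewrite comp_lfunE.
  by have [u ->] := psur w; exists u; rewrite comp_lfunE.
split.
- by case.
- by split=> //; case=> [|j] //; exact: mhom_comp.
- split.
    apply/vspaceP => v; rewrite ip !memv_ker comp_lfunE.
    by apply/eqP/eqP => [->|/einj //]; rewrite hom0.
  by case=> [|j] //; rewrite lep.
- by split=> //; case=> [|j] //; rewrite lep.
Qed.

(** A given minimal resolution starts with its own hull of [M]; the comparison with [E] over [M]
    turns its tail into a resolution of the chosen cosyzygy. *)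
Lemma resolution_uncons M E C (I : nat -> fmod A) (i : 'Hom(M, E)) (p : 'Hom(E, C))
    (eta : 'Hom(M, I 0%N)) d :
  hull i p -> @min_inj_resolution K A M I eta d ->
  retract E (I 0%N) /\ exists eta' : 'Hom(C, I 1%N),
    @min_inj_resolution K A C (fun j => I j.+1) eta' (fun j => d j.+1).
Proof.
move=> hip [Ii [em hd] [le ld] [ee ed]].
have [h [k [hh hk kh hkE hE]]] := hull_uniq hip em (Ii 0%N) ee.
split; first by exists h, k.
have [im pe ip Ei ie] := hip; have [hp psur] := (mepiP p).1 pe.
have pker v : (p v == 0) = (v \in limg i) by rewrite ip memv_ker.
have [|eta' he' eE] := factor_epi pe (mhom_comp (hd 0%N) hh).
  move=> v /eqP; rewrite pker => /limgP[m ->]; rewrite comp_lfunE hE.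
  by apply/eqP; rewrite -memv_ker -le; apply/limgP; exists m.
have lim' : limg eta' = limg (d 0%N).
  apply/vspaceP => v; apply/limgP/limgP => [[c ->]|[w ->]].
    by have [u ->] := psur c; exists (h u); rewrite eE comp_lfunE.
  by exists (p (k w)); rewrite eE comp_lfunE hkE.
exists eta'; split.
- by move=> j; apply: Ii.
- split=> //; apply/mmonoP; split=> // c; have [u ->] := psur c.
  rewrite eE comp_lfunE => /eqP; rewrite -memv_ker -le => /limgP[m].
  rewrite -hE => /(congr1 k); rewrite !kh => ->.
  by apply/eqP; rewrite pker; apply/limgP; exists m.
- by rewrite lim'.
- by rewrite lim'.
Qed.

Lemma steps_hull M E C (i : 'Hom(M, E)) (p : 'Hom(E, C)) t : hull i p ->
  steps M t.+1 <-> projective E /\ steps C t.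
Proof.
move=> hip; split=> [[I [eta [d [res prj]]]]|[Ep [I [eta [d [res prj]]]]]].
  have [rE [eta' res']] := resolution_uncons hip res; split.
    by apply: retract_projective rE _; exact: prj.
  by exists (fun j => I j.+1), eta', (fun j => d j.+1); split=> // j jt; exact: prj.
have [eta' [d' res']] := resolution_cons hip res.
by do 3 eexists; split; first exact: res'; case=> [|j] // jt; exact: prj.
Qed.

Lemma steps_le M t t' : (t' <= t)%N -> steps M t -> steps M t'.
Proof.
move=> tt [I [eta [d [res prj]]]]; exists I, eta, d; split=> // j jt.
by apply: prj; exact: leq_trans jt tt.
Qed.

(** The existential is packed into a type so that hulls can be chosen once for all modules and
    iterated. *)
Record hull_data M := HullData {
  hd_E : fmod A; hd_C : fmod A; hd_i : 'Hom(M, hd_E); hd_p : 'Hom(hd_E, hd_C);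
  hd_hull : hull hd_i hd_p }.

Lemma steps0 : (forall M, exists (E C : fmod A) (i : 'Hom(M, E)) (p : 'Hom(E, C)), hull i p) ->
  forall M, steps M 0.
Proof.
move=> hex M.
have D M' : hull_data M'.
  have /cid [E /cid [C /cid [i /cid [p hip]]]] := hex M'.
  exact: HullData hip.
pose Mk := fix Mk k := if k is k'.+1 then hd_C (D (Mk k')) else M.
exists (fun k => hd_E (D (Mk k))), (hd_i (D M)),
  (fun k => (hd_i (D (Mk k.+1)) \o hd_p (D (Mk k)))%VF).
have key k : limg (hd_i (D (Mk k.+1)) \o hd_p (D (Mk k)))%VF = limg (hd_i (D (Mk k.+1))).
  have [_ /mepiP[_ psur] _ _ _] := hd_hull (D (Mk k)).
  apply/vspaceP => v; apply/limgP/limgP => [[w ->]|[w ->]].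
    by exists (hd_p (D (Mk k)) w); rewrite comp_lfunE.
  by have [u ->] := psur w; exists u; rewrite comp_lfunE.
have kerk k : lker (hd_i (D (Mk k.+1)) \o hd_p (D (Mk k)))%VF = limg (hd_i (D (Mk k))).
  have [_ _ -> _ _] := hd_hull (D (Mk k)).
  have [/mmonoP[_ iinj] _ _ _ _] := hd_hull (D (Mk k.+1)).
  apply/vspaceP => v; rewrite !memv_ker comp_lfunE.
  by apply/eqP/eqP => [/iinj //|->]; rewrite hom0.
split=> //; split.
- by move=> j; case: (hd_hull (D (Mk j))).
- split; first by case: (hd_hull (D M)).
  move=> j; have [[hi _] _ _ _ _] := hd_hull (D (Mk j.+1)).
  by have [_ [hp _] _ _ _] := hd_hull (D (Mk j)); exact: mhom_comp.
- by split=> [|j]; rewrite kerk // key.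
- split=> [|j]; first by case: (hd_hull (D M)).
  by rewrite key; case: (hd_hull (D (Mk j.+1))).
Qed.

Lemma hull_iso (M M' E C : fmod A) (i : 'Hom(M, E)) (p : 'Hom(E, C)) : miso M M' -> hull i p ->
  exists i' : 'Hom(M', E), hull i' p.
Proof.
move=> /misoP[s [r [hs hr rs sr]]] [/mmonoP[hi iinj] pe ip Ei ie].
exists (i \o r)%VF.
have lE : limg (i \o r)%VF = limg i.
  apply/vspaceP => v; apply/limgP/limgP => [[w ->]|[w ->]].
    by exists (r w); rewrite comp_lfunE.
  by exists (s w); rewrite comp_lfunE rs.
split=> //; rewrite ?lE //; apply/mmonoP; split; first exact: mhom_comp.
by move=> v; rewrite comp_lfunE => /iinj rv; rewrite -[v]sr rv hom0.
Qed.

Lemma hull_mprod M E C (i : 'Hom(M, E)) (p : 'Hom(E, C))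
    (M' E' C' : fmod A) (i' : 'Hom(M', E')) (p' : 'Hom(E', C')) : hull i p -> hull i' p' ->
  exists (j : 'Hom(mprod M M', mprod E E')) (q : 'Hom(mprod E E', mprod C C')), hull j q.
Proof.
move=> [/mmonoP[hi iinj] /mepiP[hp psur] ip Ei ie] [/mmonoP[hi' iinj'] /mepiP[hp' psur'] ip' Ei' ie'].
have [a1 [a2 [b1 [b2 [[ha1 ha2 hb1 hb2] [ba11 ba22 ba21 ba12] zM]]]]] := mprod_maps M M'.
have [c1 [c2 [d1 [d2 [[hc1 hc2 hd1 hd2] [dc11 dc22 dc21 dc12] zE]]]]] := mprod_maps E E'.
have [s1 [s2 [r1 [r2 [[hs1 hs2 hr1 hr2] [rs11 rs22 rs21 rs12] zC]]]]] := mprod_maps C C'.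
exists ((c1 \o i \o b1) + (c2 \o i' \o b2))%VF, ((s1 \o p \o d1) + (s2 \o p' \o d2))%VF.
have jE z : ((c1 \o i \o b1) + (c2 \o i' \o b2))%VF z = c1 (i (b1 z)) + c2 (i' (b2 z)).
  by rewrite add_lfunE !comp_lfunE.
have qE z : ((s1 \o p \o d1) + (s2 \o p' \o d2))%VF z = s1 (p (d1 z)) + s2 (p' (d2 z)).
  by rewrite add_lfunE !comp_lfunE.
have limE z : z \in limg ((c1 \o i \o b1) + (c2 \o i' \o b2))%VF <->
    d1 z \in limg i /\ d2 z \in limg i'.
  split=> [/limgP[w ->]|[/limgP[v vE] /limgP[w wE]]].
    rewrite jE !homD dc11 dc12 dc21 dc22 addr0 add0r.
    by split; apply/limgP; [exists (b1 w)|exists (b2 w)].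
  apply/limgP; exists (a1 v + a2 w); rewrite jE !homD ba11 ba12 ba21 ba22 !hom0 addr0 add0r.
  by rewrite -vE -wE -zE.
split.
- apply/mmonoP; split=> [v a|v]; first by rewrite !jE hb1 hb2 hi hi' hc1 hc2 ractDl.
  rewrite jE => v0; rewrite [v]zM.
  have -> : b1 v = 0.
    by apply: iinj; have := congr1 d1 v0; rewrite homD dc11 dc12 addr0 hom0.
  have -> : b2 v = 0.
    by apply: iinj'; have := congr1 d2 v0; rewrite homD dc21 dc22 add0r hom0.
  by rewrite !hom0 addr0.
- apply/mepiP; split=> [v a|v]; first by rewrite !qE hd1 hd2 hp hp' hs1 hs2 ractDl.
  have [w wE] := psur (r1 v); have [w' wE'] := psur' (r2 v).
  exists (c1 w + c2 w'); rewrite qE !homD dc11 dc12 dc21 dc22 !hom0 addr0 add0r.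
  by rewrite -wE -wE' -zC.
- apply/vspaceP => z; rewrite memv_ker qE; apply/idP/eqP.
    move=> /limE[]; rewrite ip ip' !memv_ker => /eqP -> /eqP ->.
    by rewrite !hom0 addr0.
  move=> z0; apply/limE; rewrite ip ip' !memv_ker; split; apply/eqP.
    by have := congr1 r1 z0; rewrite homD rs11 rs12 addr0 hom0.
  by have := congr1 r2 z0; rewrite homD rs21 rs22 add0r hom0.
- exact: mprod_injective.
apply/essentialP => z z0.
(* The coordinates are treated one after the other: a second multiplier for [d2] keeps the first
   coordinate inside [limg i]. *)
have [a [za0 za]] : exists a, z • a != 0 /\ d1 (z • a) \in limg i.
  have [d1z|d1z] := eqVneq (d1 z) 0.
    by exists 1; rewrite ract1 d1z mem0v.
  have [a [a0 ai]] := (essentialP _).1 ie _ d1z; exists a; rewrite hd1; split=> //.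
  by apply: contra a0; rewrite -hd1 => /eqP ->; rewrite hom0.
have [d2z|d2z] := eqVneq (d2 (z • a)) 0.
  by exists a; split=> //; apply/limE; split=> //; rewrite d2z mem0v.
have [b [b0 bi]] := (essentialP _).1 ie' _ d2z; exists (a * b); rewrite ractA; split.
  by apply: contra b0; rewrite -hd2 => /eqP ->; rewrite hom0.
apply/limE; split; last by rewrite hd2.
rewrite hd1; move: za => /limgP[m ->]; apply/limgP; exists (m • b); by rewrite hi.
Qed.

Lemma steps_iso M M' t :
  (forall M, exists (E C : fmod A) (i : 'Hom(M, E)) (p : 'Hom(E, C)), hull i p) ->
  miso M M' -> steps M t -> steps M' t.
Proof.
move=> hex iMM; case: t => [_|t]; first exact: steps0.
have [E [C [i [p hip]]]] := hex M; have [i' hip'] := hull_iso iMM hip.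
by move=> /(steps_hull _ hip) h; apply/(steps_hull _ hip').
Qed.

Lemma steps_mprod M M' t :
  (forall M, exists (E C : fmod A) (i : 'Hom(M, E)) (p : 'Hom(E, C)), hull i p) ->
  steps M t -> steps M' t -> steps (mprod M M') t.
Proof.
move=> hex; elim: t M M' => [|t IH] M M'; first by move=> _ _; exact: steps0.
have [E [C [i [p hip]]]] := hex M; have [E' [C' [i' [p' hip']]]] := hex M'.
have [j [q hjq]] := hull_mprod hip hip'.
move=> /(steps_hull _ hip)[Ep Ct] /(steps_hull _ hip')[Ep' Ct'].
by apply/(steps_hull _ hjq); split; [exact: mprod_projective|exact: IH].
Qed.

(** The admissible [t] are downward closed and include 0, so the supremum is at least [t] exactly
    when [t] is admissible. *)
Lemma domdim_mod_ge M t :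
  (forall M, exists (E C : fmod A) (i : 'Hom(M, E)) (p : 'Hom(E, C)), hull i p) ->
  enat_le (Some t) (domdim_mod M) <-> steps M t.
Proof.
move=> hex; rewrite /domdim_mod.
set S := (X in enat_sup X); have [ub lub] := enat_supP S.
split=> [tS|[I [eta [d [res prj]]]]]; last by apply: ub; exists t, I, eta, d.
apply: contrapT => nt.
case: t tS nt => [_|t tS nt]; first by case; exact: steps0.
have : enat_le (enat_sup S) (Some t).
  apply: lub => s [t' [I [eta [d [-> res prj]]]]] /=.
  rewrite leqNgt; apply/negP => tt'; apply: nt; apply: steps_le tt' _.
  by exists I, eta, d.
by case: (enat_sup S) tS => //= n; lia.
Qed.

End Resolutions.

(** * Dominant dimension and defect in terms of [f] *)

Section Invariants.
Variables (K : fieldType) (A : falgType K).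
Variables (N : nat) (e : int -> A) (x : A) (f : int -> int).
Hypothesis H : nakayama_basis N e x f.
Implicit Types (M E P : fmod A).
Local Notation igen := (igen e x).
Local Notation isiv := (isiv e x).
Local Notation steps := (@proj_injective_steps K A).

Definition fiber_min (h : int -> int) (j : int) : int :=
  xget 0 [set i | (h (i - 1) < j) && (j <= h i)]%classic.

(* For [i < j], [long_enough h t i j] says that the first [t] terms of the minimal
   injective resolution of the uniserial module with composition factors
   [i, ..., j - 1] are projective. *)
Fixpoint long_enough (h : int -> int) (t : nat) (i j : int) : Prop :=
  if t is t'.+1 then
    i = j \/ (exists k, h k = j) /\ long_enough h t' (fiber_min h j) i
  else True.

Lemma fiber_minP j : f (fiber_min f j - 1) < j <= f (fiber_min f j).
Proof.
suff : exists i, (f (i - 1) < j) && (j <= f i) by move/(@xgetPex _ 0).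
have [a fa] : exists a, f a < j.
  (* Translating 0 back by that many periods lowers [f] by the same amount, hence below [j]. *)
  exists (0 - (absz (j - f 0)%R).+1%:Z * N%:Z).
  have := nak_fperZ H 0 (- (absz (j - f 0)%R).+1%:Z); rewrite mulNr => ->.
  have N0 := nak_gt0 H; move: (f 0) => z; nia.
have ex : exists n : nat, j <= f (a + n%:Z).
  by exists (absz (j - a)%R); have := nak_gt H (a + (absz (j - a)%R)%:Z); lia.
case: (ex_minnP ex) => n jn nmin; exists (a + n%:Z); rewrite jn andbT.
case: n jn nmin => [|n] jn nmin; first by move: jn; rewrite addr0; lia.
rewrite ltNge; apply/negP => h.
have : (n < n)%N by apply: nmin; have -> : a + n%:Z = a + n.+1%:Z - 1 by lia.
by rewrite ltnn.
Qed.

Lemma fiber_min_uniq i j : f (i - 1) < j <= f i -> fiber_min f j = i.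
Proof.
move=> /andP[h1 h2]; have /andP[h3 h4] := fiber_minP j.
apply/eqP; rewrite eq_le; apply/andP; split; rewrite leNgt; apply/negP => h.
  have := @nak_mono _ _ _ _ _ _ H i (fiber_min f j - 1); lia.
have := @nak_mono _ _ _ _ _ _ H (fiber_min f j) (i - 1); lia.
Qed.

Lemma fiber_min_im j : (exists k, f k = j) <-> f (fiber_min f j) = j.
Proof.
split=> [[k kE]|h]; last by exists (fiber_min f j).
have /andP[h3 h4] := fiber_minP j.
have kg : fiber_min f j <= k.
  rewrite leNgt; apply/negP => h; have := @nak_mono _ _ _ _ _ _ H k (fiber_min f j - 1); lia.
have := nak_mono H kg; lia.
Qed.

Lemma isiv0_eq0 M i : isiv M i 0 -> forall m : M, m = 0.
Proof.
move=> [u [ue ux us]] m.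
have u0 : u = 0 by apply/eqP; have := ux 0%N; rewrite expr0 ract1 leqnn.
by have [a ->] := us m; rewrite u0 ract0l.
Qed.

Lemma zero_projective M : (forall m : M, m = 0) -> projective M.
Proof.
move=> M0 M1 M2 g h ge hh; exists 0; first exact: mhom0.
by apply/lfunP => m; rewrite [m]M0 !hom0.
Qed.

Lemma isiv_hull M i l : isiv M i l -> (0 < l)%N -> exists (d : nat) E C,
  [/\ i = fiber_min f (i + l%:Z) + d%:Z,
      isiv E (fiber_min f (i + l%:Z)) (d + l), isiv C (fiber_min f (i + l%:Z)) d
    & exists (j : 'Hom(M, E)) (p : 'Hom(E, C)), hull j p].
Proof.
move=> iv l0; have il := isiv_le H iv.
have /andP[h3 h4] := fiber_minP (i + l%:Z).
set g := fiber_min f _ in h3 h4 *.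
have gi : g <= i.
  by rewrite leNgt; apply/negP => h; have := @nak_mono _ _ _ _ _ _ H i (g - 1); lia.
have dE : i = g + (absz (i - g)%R)%:Z by lia.
exists (absz (i - g)%R).
have [E ivE] : exists E, isiv E g (absz (i - g)%R + l) by apply: (isiv_exists H); lia.
have [C ivC] : exists C, isiv C g (absz (i - g)%R) by apply: (isiv_exists H); lia.
exists E, C; split=> //; apply: (interval_hull H _ l0 ivE ivC); last lia.
by rewrite -dE.
Qed.

Lemma hull_exists M : exists (E C : fmod A) (i : 'Hom(M, E)) (p : 'Hom(E, C)), hull i p.
Proof.
move: M; apply: (fmod_ind H) => [M M' iso [E [C [i [p h]]]]|
   M M' [E [C [i [p h]]]] [E' [C' [i' [p' h']]]]|M i l iv].
- by have [i' h'] := hull_iso iso h; exists E, C, i', p.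
- by have [j [q hh]] := hull_mprod h h'; exists (mprod E E'), (mprod C C'), j, q.
case: l iv => [|l] iv; first by exists M, M, \1%VF, \1%VF; exact: zero_hull iv.
have [d [E [C [_ _ _ [j [p h]]]]]] := isiv_hull iv isT.
by exists E, C, j, p.
Qed.

Lemma isiv_steps t M i l : isiv M i l -> steps M t <-> long_enough f t i (i + l%:Z).
Proof.
elim: t M i l => [|t IH] M i l iv; first by split=> // _; exact: steps0 hull_exists _.
case: l iv => [|l] iv.
  have hz := zero_hull iv; split=> _; first by left; rewrite addr0.
  apply/(steps_hull _ hz); split; first exact: zero_projective (isiv0_eq0 iv).
  by apply/IH; first exact: iv; case: (t) => //= t'; left; rewrite addr0.
have [d [E [C [dE ivE ivC [j [p h]]]]]] := isiv_hull iv isT.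
apply: iff_trans (steps_hull _ h) _; rewrite (IH _ _ _ ivC) -dE /=.
set g := fiber_min f _ in dE ivE ivC *.
have gE : g + (d + l.+1)%N%:Z = i + l.+1%:Z by lia.
split=> [[Ep le]|[il|[/fiber_min_im fg le]]]; last 2 first.
- lia.
- by split=> //; apply: (isiv_projective H ivE); rewrite gE fg.
right; split=> //; exists g; rewrite -gE; apply/esym.
by apply: (isiv_projective_len H ivE) => //; rewrite addnS.
Qed.

Lemma proj_isiv_injective M i l : isiv M i l -> i + l%:Z = f i -> (0 < l)%N ->
  injective_mod M <-> f (i - 1) < f i.
Proof.
move=> iv il l0; split=> [Mi|lt]; last by apply: (isiv_injective H iv); rewrite il.
rewrite ltNge; apply/negP => ge; apply: (isiv_not_injective H iv l0) Mi.
by rewrite il.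
Qed.

Lemma long_enough_injective t i : f (i - 1) < f i -> long_enough f t i (f i).
Proof.
case: t => //= t lt; right; split; first by exists i.
rewrite (@fiber_min_uniq i) ?lt ?lexx //.
by case: t => //= t; left.
Qed.

Lemma domdim_ge t : enat_le (Some t) (domdim A) <->
  forall i, f (i - 1) = f i -> long_enough f t i (f i).
Proof.
rewrite /domdim; set S := (X in enat_inf X); have [lb glb] := enat_infP S.
have trans y z w : enat_le y z -> enat_le z w -> enat_le y w.
  by case: y => [y|]; case: z => [z|]; case: w => [w|] //=; exact: leq_trans.
split=> [tS i fi|h].
  have fgt := nak_gt H i.
  have [P iv] : exists P, isiv P i (absz (f i - i)%R) by apply: (isiv_exists H); lia.
  have il : i + (absz (f i - i)%R)%:Z = f i by lia.
  rewrite -il; apply/(isiv_steps t iv)/(domdim_mod_ge _ _ hull_exists).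
  apply: trans tS _; apply: lb; exists P; split=> //.
    exact: (isiv_projective H iv).
  by move=> /(proj_isiv_injective iv il)-/(_ ltac:(lia)); rewrite fi ltxx.
apply: glb => s [P [Pp _ ->]]; apply/(domdim_mod_ge _ _ hull_exists).
(* Non-injectivity is dropped before the induction, since it does not pass to summands; an injective
   projective interval satisfies the condition for every [t]. *)
move: Pp; move: P; apply: (fmod_ind H) => [M M' iso IH Mp|M M' IH IH' Mp|M i l iv Mp].
- apply: (steps_iso hull_exists iso); apply: IH.
  exact: retract_projective (miso_retract iso) Mp.
- apply: (steps_mprod hull_exists).
    by apply: IH; exact: retract_projective (retract_mprodl _ _) Mp.
  by apply: IH'; exact: retract_projective (retract_mprodr _ _) Mp.
apply/(isiv_steps t iv); case: (posnP l) => [->|l0].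
  by case: (t) => //= t'; left; rewrite addr0.
rewrite (isiv_projective_len H iv l0 Mp).
have : f (i - 1) <= f i by apply: (nak_mono H); lia.
rewrite le_eqVlt => /orP[/eqP /h //|]; exact: long_enough_injective.
Qed.

Lemma quotient_igen (M Q : fmod A) i l (u : M) (q : 'Hom(M, Q)) a : igen i l u -> mepi q ->
  (a <= l)%N -> (forall m, m \in lker q <-> exists c, m = u • x ^+ a • c) -> igen i a (q u).
Proof.
move=> g /mepiP[hq qsur] al kq; have [ue ux us] := g; split.
- by rewrite -hq ue.
- move=> b; rewrite -hq -memv_ker; apply/idP/idP => [/kq /(igen_mem H b g al) //|ab].
  by apply/kq/(igen_mem H b g al).
by move=> m; have [v ->] := qsur m; have [c ->] := us v; exists c; rewrite hq.
Qed.

(** The proper injective quotients are the intervals from [i] to an endpoint strictly between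
    [f (i - 1)] and [f i]. If these two values agree there is none, as the truncated predecessor of
    0 says. *)
Lemma def_proj_isiv P i l : isiv P i l -> i + l%:Z = f i ->
  def_proj P = (absz (f i - f (i - 1))%R).-1.
Proof.
move=> [u g] il; have fi := nak_gt H (i - 1).
have fm : f (i - 1) <= f i by apply: (nak_mono H); lia.
have /choice [V VP] : forall a, exists V : {vspace P},
    forall m, m \in V <-> exists c, m = u • x ^+ a • c.
  move=> a; have [L LE] : exists L : 'Hom(A, P), L =1 ract (u • x ^+ a).
    by apply: lin_hom => c b b'; rewrite ractDr ractZr.
  exists (limg L) => m; split=> [/limgP[c ->]|[c ->]]; first by exists c; rewrite LE.
  by apply/limgP; exists c; rewrite LE.
have sV a : submod (V a) by move=> v b /VP[c ->]; apply/VP; exists (c * b); rewrite ractA.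
have memV a b : (a <= l)%N -> (u • x ^+ b \in V a) = (a <= b)%N.
  by move=> al; apply/idP/idP => [/VP/(igen_mem H b g al)|/(igen_mem H b g al)/VP].
have Vinj a b : (a <= l)%N -> (b <= l)%N -> V a = V b -> a = b.
  move=> al bl E; have := memV a a al; have := memV b b bl.
  by rewrite {1}E -{1}E !memV // !leqnn; lia.
pose s := [seq V a | a <- iota (absz (f (i - 1) - i)%R).+1 (absz (f i - f (i - 1))%R).-1].
have us : uniq s.
  rewrite map_inj_in_uniq ?iota_uniq // => a b; rewrite !mem_iota => ha hb.
  by apply: Vinj; lia.
have -> : def_proj P = size s.
  rewrite /def_proj; have -> : [set U | proper_injective_quotient (P := P) U]%classic =
      [set` [fset U in s]%fset]%classic.
    apply/seteqP; split=> U /=; rewrite !inE; [move=> [U0 UT [Q [q [qe kq Qi]]]]|move=> /mapP[a]].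
      have sU : submod U.
        have [hq _] := (mepiP q).1 qe.
        by move=> v a; rewrite -kq !memv_ker hq => /eqP ->; rewrite ract0l.
      have [a [al aE]] := igen_submod H g sU.
      have -> : U = V a.
        by apply/vspaceP => m; apply/idP/idP => [/aE/VP|/VP/aE].
      have a0 : (0 < a)%N.
        rewrite lt0n; apply/eqP => E; apply: UT; apply: vspace_full => m.
        by apply/aE; rewrite E expr0 ract1; case: g.
      have al' : (a < l)%N.
        rewrite ltn_neqAle al andbT; apply/eqP => E; apply: U0; apply: vspace_zero => m.
        by move=> /aE; rewrite E (igen_eq0 g (leqnn l)) => -[c ->]; rewrite ract0l.
      have gq : igen i a (q u).
        by apply: (quotient_igen g qe al) => m; rewrite kq.
      apply: map_f; rewrite mem_iota.
      have : f (i - 1) < i + a%:Z.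
        rewrite ltNge; apply/negP => h; apply: (isiv_not_injective H _ a0 h) Qi.
        by exists (q u).
      by lia.
    rewrite mem_iota => ha ->.
    have [a0 al] : (0 < a)%N /\ (a < l)%N by lia.
    have [Q [q [qe kq]]] := quo_exists (sV a).
    have gq : igen i a (q u).
      by apply: (quotient_igen g qe (ltnW al)) => m; rewrite kq.
    split.
    - move=> V0; have := memV a a (ltnW al); rewrite V0 memv0 leqnn.
      by rewrite (negbTE (igen_neq0 g al)).
    - move=> VT; have := memV a 0%N (ltnW al); rewrite VT memvf; lia.
    - exists Q, q; split=> //; apply: (isiv_injective H (i := i) (l := a)); last lia.
      by exists (q u).
  by rewrite set_fsetK card_fseq undup_id.
by rewrite size_map size_iota.
Qed.

(** If the tops differed, [u] would lie in [M x], and [u • x ^+ l.-1] would vanish because [x ^+ l]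
    kills [M]. *)
Lemma isiv_top M i j l l' : isiv M i l -> isiv M j l' -> (0 < l)%N -> (i = j %[mod N%:Z])%Z.
Proof.
move=> [u g] [v g'] l0; apply/eqP; apply/negPn/negP => ij.
have [ue ux us] := g; have [ve vx vs] := g'.
have [al uE] := igen_expand H u g'.
have vl : v • x ^+ l = 0.
  have [a ->] := us v; have [a' aE] := nak_normal H a l.
  by rewrite -ractA aE ractA (igen_eq0 g (leqnn l)) ract0l.
have := igen_neq0 g (_ : (l.-1 < l)%N); rewrite prednK // leqnn => /(_ isT)/negP; apply.
rewrite -ue uE ract_suml ract_suml big_nat big1 // => b _.
rewrite ractZl (igen_act_e H _ _ g').
case: ifP => [bi|_]; last by rewrite scaler0 ract0l.
have b0 : (0 < b)%N.
  by rewrite lt0n; apply/eqP => b0; move: bi; rewrite b0 addr0 eq_sym (negbTE ij).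
rewrite ractZl -ractA -exprD.
have -> : (b + l.-1 = l + b.-1)%N by lia.
by rewrite exprD ractA vl ract0l scaler0.
Qed.

Lemma isiv_modn M i l : isiv M i l -> exists k : 'I_N, isiv M k%:Z l.
Proof.
move=> iv; have N0 := nak_gt0 H.
have kN : (absz (i %% N%:Z)%Z < N)%N by lia.
have E : (absz (i %% N%:Z)%Z)%:Z = (i %% N%:Z)%Z by lia.
exists (Ordinal kN); apply: (isiv_mod H _ iv).
by change ((i %% N%:Z)%Z = ((absz (i %% N%:Z)%Z)%:Z %% N%:Z)%Z); rewrite E modz_mod.
Qed.

Lemma indec_proj_isiv M : indec_proj M <->
  exists k : 'I_N, isiv M k%:Z (absz (f k%:Z - k%:Z)%R).
Proof.
split=> [[Mp /(indecomposable_isiv H) [i [l [iv l0]]]]|[k iv]].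
  have [k kv] := isiv_modn iv; exists k.
  have kl := isiv_projective_len H kv l0 Mp.
  by have -> : absz (f k%:Z - k%:Z)%R = l by lia.
have fk := nak_gt H k%:Z; split; first by apply: (isiv_projective H iv); lia.
by apply: (isiv_indecomposable H iv); lia.
Qed.

Lemma is_defectE d : is_defect A d <->
  d = (\sum_(i < N) (absz (f i%:Z - f (i%:Z - 1))%R).-1)%N.
Proof.
have len (k : 'I_N) : k%:Z + (absz (f k%:Z - k%:Z)%R)%:Z = f k%:Z.
  by have := nak_gt H k%:Z; lia.
have len0 (k : 'I_N) : (0 < absz (f k%:Z - k%:Z)%R)%N by have := nak_gt H k%:Z; lia.
have topk (k k' : 'I_N) : (k%:Z = k'%:Z %[mod N%:Z])%Z -> k = k'.
  by move=> E; apply: val_inj; have := ltn_ord k; have := ltn_ord k'; move: E => /=;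
    rewrite !modz_nat => -[]; rewrite !modn_small.
split=> [[n [P [[Pp Pinj Psur] ->]]]|->].
  have /choice [tau tauP] : forall i, exists k : 'I_N, isiv (P i) k%:Z (absz (f k%:Z - k%:Z)%R).
    by move=> i; apply/indec_proj_isiv.
  have tinj : injective tau.
    move=> i j E; apply: Pinj; have := tauP i; rewrite E => h.
    exact: (isiv_miso H h (tauP j)).
  have /choice [g gP] : forall k, exists i, tau i = k.
    move=> k; have [M iv] : exists M, isiv M k%:Z (absz (f k%:Z - k%:Z)%R).
      by apply: (isiv_exists H); rewrite len.
    have [|i iM] := Psur M; first by apply/indec_proj_isiv; exists k.
    exists i; apply: topk; apply/esym.
    exact: isiv_top (isiv_iso iM iv) (tauP i) (len0 k).
  have tbij : bijective tau by exists g => // i; apply: tinj; rewrite gP.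
  rewrite (reindex tau) /=; last exact: onW_bij.
  by apply: eq_bigr => i _; apply: def_proj_isiv (tauP i) (len _).
have /choice [P Pv] : forall k : 'I_N, exists M, isiv M k%:Z (absz (f k%:Z - k%:Z)%R).
  by move=> k; apply: (isiv_exists H); rewrite len.
exists N, P; split; first split.
- by move=> i; apply/indec_proj_isiv; exists i.
- move=> i j iso; apply: topk.
  exact: isiv_top (isiv_iso iso (Pv i)) (Pv j) (len0 i).
- by move=> M /indec_proj_isiv [k iv]; exists k; exact: (isiv_miso H iv (Pv k)).
by apply: eq_bigr => i _; rewrite (def_proj_isiv (Pv i) (len _)).
Qed.

Lemma defectE : defect A = (\sum_(i < N) (absz (f i%:Z - f (i%:Z - 1))%R).-1)%N.
Proof.
by apply/is_defectE; apply: (@xgetPex _ 0%N (is_defect A)); eexists; apply/is_defectE.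
Qed.

End Invariants.

(** * Comparison of the defects and dominant dimensions *)

(* Each fibre of [F] contributes [1 + #(fibre in the image) <= #fibre + (the image
   of the image meets it)]. *)
Lemma iterated_image_leqif (T : finType) (F : T -> T) :
  (#|F @: T| + #|F @: T| <= #|T| + #|F @: (F @: T)|
    ?= iff [forall i, forall i', (F i == F i') && (i != i') ==> (i \in F @: T)])%N.
Proof.
set I1 := F @: T; set I2 := F @: I1.
pose c y := #|[pred i | F i == y]|; pose b y := #|[pred i in I1 | F i == y]|.
have I2E y : (y \in I2) = (0 < b y)%N.
  apply/imsetP/card_gt0P => [[i iI ->]|[i]]; first by exists i; rewrite inE iI eqxx.
  by rewrite inE => /andP[iI /eqP <-]; exists i.
have cT : #|T| = (\sum_(y in I1) c y)%N.
  rewrite -sum1_card (partition_big F (mem I1)) /=; last by move=> i _; exact: imset_f.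
  by apply: eq_bigr => y _; rewrite sum1_card.
have cI1 : #|I1| = (\sum_(y in I1) b y)%N.
  rewrite -sum1_card (partition_big F (mem I1)) /=; last by move=> i _; exact: imset_f.
  by apply: eq_bigr => y _; rewrite sum1_card; apply: eq_card => i; rewrite !inE.
have cI2 : #|I2| = (\sum_(y in I1) (0 < b y))%N.
  rewrite -sum1_card [RHS]big_mkcond [LHS]big_mkcond /=; apply: eq_bigr => y _.
  rewrite I2E; case: ifP; case: ifP => //; case: ltnP => // b0 yI _.
  by move: b0; rewrite -I2E => /imsetP[i _ yE]; move: yI; rewrite yE imset_f.
have bc y : (b y <= c y)%N by apply: subset_leq_card; apply/fintype.subsetP => i; rewrite !inE => /andP[].
have c1 y : y \in I1 -> (0 < c y)%N.
  by move=> /imsetP[i _ ->]; apply/card_gt0P; exists i; rewrite inE.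
rewrite {1}cI1 -sum1_card cT cI2 -!big_split /=.
have -> : [forall i, forall i', (F i == F i') && (i != i') ==> (i \in I1)] =
    [forall (y | y \in I1), (b y + 1 == c y + (0 < b y))%N].
  apply/idP/idP => [good|eqn].
    apply/forallP => y; apply/implyP => yI; have := c1 _ yI; have := bc y.
    (* A fibre with one element gives equality whether or not it lies in the image; a larger one
       gives equality only if [b y = c y]. *)
    have [ltc|] := ltnP 1 (c y); last by case: (b y) => [|n]; case: (c y) => [|[|k]] //=; lia.
    suff -> : b y = c y by move=> _ c0; rewrite c0.
    apply: eq_card => i; rewrite !inE; case: eqP => [Fi|_]; rewrite ?andbF // andbT.
    have [i'] : exists i', (i' \in [pred i | F i == y]) && (i' != i).
      apply/existsP; rewrite -[X in is_true X]negbK negb_exists; apply/negP => /forallP h.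
      have : (c y <= #|pred1 i|)%N.
        apply: subset_leq_card; apply/fintype.subsetP => i' i'F; have := h i'.
        by rewrite i'F /= negbK.
      by rewrite card1; lia.
    rewrite inE => /andP[/eqP Fi' i'i].
    have /forallP/(_ i)/forallP/(_ i')/implyP := good; apply.
    by rewrite Fi Fi' eqxx eq_sym.
  apply/forallP => i; apply/forallP => i'; apply/implyP => /andP[/eqP FF ii'].
  have yI : F i \in I1 by exact: imset_f.
  have /forallP/(_ (F i))/implyP/(_ yI)/eqP E := eqn.
  have c2 : (1 < c (F i))%N.
    rewrite (leq_trans _ (_ : #|[pred k | k \in [:: i; i']]| <= _)%N) //.
      by rewrite (card_uniqP _) //= inE ii'.
    by apply: subset_leq_card; apply/fintype.subsetP => k; rewrite !inE => /orP[/eqP ->|/eqP ->]; rewrite ?FF.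
  have {}E : b (F i) = c (F i) by case: (b _) E => [|n]; lia.
  have : [pred k | F k == F i] \subset [pred k in I1 | F k == F i].
    have := subset_leqif_card (_ : [pred k in I1 | F k == F i] \subset [pred k | F k == F i]).
    case; first by apply/fintype.subsetP => k; rewrite !inE => /andP[].
    by move=> _ <-; rewrite -/(b _) -/(c _) E.
  by move=> /fintype.subsetP/(_ i); rewrite !inE eqxx => /(_ isT)/andP[].
apply: leqif_sum => y yI; split; last by [].
have := c1 _ yI; have := bc y; case: (b y) => [|n]; lia.
Qed.

Section Comparison.
Variables (K : fieldType) (A : falgType K).
Variables (N : nat) (e : int -> A) (x : A) (f : int -> int).
Hypothesis H : nakayama_basis N e x f.

Lemma residue_exists : exists r : int -> 'I_N, forall i, (r i)%:Z = (i %% N%:Z)%Z.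
Proof.
suff /choice [r rP] : forall i : int, exists k : 'I_N, k%:Z = (i %% N%:Z)%Z by exists r.
move=> i; have N0 := nak_gt0 H.
have kN : (absz (i %% N%:Z)%Z < N)%N by lia.
by exists (Ordinal kN) => /=; lia.
Qed.

Variable r : int -> 'I_N.
Hypothesis rE : forall i, (r i)%:Z = (i %% N%:Z)%Z.

Lemma residue_shift i : exists q : int, (r i)%:Z = i + q * N%:Z.
Proof.
exists (- (i %/ N%:Z)%Z); rewrite rE [X in _ = X + _](divz_eq i N%:Z).
by rewrite mulNr addrAC subrr add0r.
Qed.

Lemma residue_eqP i j : r i = r j <-> exists q : int, j = i + q * N%:Z.
Proof.
split=> [E|[q ->]].
  have [q qE] := residue_shift i; have [q' qE'] := residue_shift j.
  exists (q - q'); rewrite mulrBl.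
  have : i + q * N%:Z = j + q' * N%:Z by rewrite -qE -qE' E.
  by move: (q * _) (q' * _) => a b; lia.
by apply: val_inj; apply/eqP; rewrite -eqz_nat !rE addrC modzMDl.
Qed.

Lemma residue_ord (k : 'I_N) : r k%:Z = k.
Proof. by apply: val_inj; apply/eqP; rewrite -eqz_nat rE modz_nat modn_small. Qed.

Lemma sum_increments : (\sum_(i < N) absz (f i%:Z - f (i%:Z - 1))%R = N)%N.
Proof.
have key n : ((\sum_(i < n) absz (f i%:Z - f (i%:Z - 1))%R)%N%:Z = f (n%:Z - 1) - f (- 1)).
  elim: n => [|n IH]; first by rewrite big_ord0 add0r subrr.
  rewrite big_ord_recr /= PoszD IH.
  have := @nak_mono _ _ _ _ _ _ H (n%:Z - 1) n%:Z; have -> : n.+1%:Z - 1 = n%:Z by lia.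
  by lia.
have := nak_fper H (- 1); have -> : - 1 + N%:Z = N%:Z - 1 by lia.
by have := key N; lia.
Qed.

(** A vertex [i] with [f (i - 1) < f i] contributes [f i - f (i - 1) - 1] to the defect and 1 to the
    image, being the least vertex with its value; the others contribute nothing. Over one period the
    increments add up to [N]. *)
Lemma defect_image :
  (defect A + #|(fun i : 'I_N => r (f i%:Z)) @: 'I_N| = N)%N.
Proof.
rewrite (defectE H).
pose S := [set i : 'I_N | f (i%:Z - 1) < f i%:Z].
have -> : (fun i : 'I_N => r (f i%:Z)) @: 'I_N = [set r (f i%:Z) | i : 'I_N in S].
  apply/setP => y; apply/imsetP/imsetP => -[i iS ->]; last by exists i.
  set j := fiber_min f (f i%:Z).
  have fj : f j = f i%:Z by apply/(fiber_min_im H); exists i%:Z.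
  have /andP[fj1 _] := fiber_minP H (f i%:Z); rewrite -/j in fj1.
  have [q qE] := residue_shift j.
  exists (r j).
    by rewrite inE qE addrAC !(nak_fperZ H) fj ltrD2r.
  rewrite qE (nak_fperZ H) fj; apply/esym/residue_eqP; exists (- q).
  by rewrite mulNr addrK.
rewrite card_in_imset; last first.
  move=> i i'; rewrite !inE => iS iS' /residue_eqP [q qE].
  have E1 : fiber_min f (f i'%:Z) = i'%:Z by apply: (fiber_min_uniq H); rewrite iS' lexx.
  have E2 : fiber_min f (f i'%:Z) = i%:Z + q * N%:Z.
    by apply: (fiber_min_uniq H); rewrite addrAC !(nak_fperZ H) qE ltrD2r iS lexx.
  have : r i%:Z = r i'%:Z by apply/residue_eqP; exists q; rewrite -E2.
  by rewrite !residue_ord.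
rewrite -[RHS]sum_increments -sum1_card [X in (_ + X)%N]big_mkcond -big_split /=.
apply: eq_bigr => i _; rewrite inE.
have : f (i%:Z - 1) <= f i%:Z by apply: (nak_mono H); lia.
by move: (f _) (f _) => a b; case: (ltrP b a); lia.
Qed.

End Comparison.

(** * Comparison of [f] with its restriction [f'] to its image, enumerated by [sigma] *)

Section SubComparison.
Variables (K : fieldType) (A B : falgType K).
Variables (N : nat) (e : int -> A) (x : A) (f : int -> int).
Hypothesis H : nakayama_basis N e x f.
Variables (m : nat) (e' : int -> B) (x' : B) (f' : int -> int).
Hypothesis H' : nakayama_basis m e' x' f'.
Variable sigma : int -> int.
Hypothesis sigma_lt : forall k l, (sigma k < sigma l) = (k < l).
Hypothesis sigma_im : forall j, (exists i, f i = j) <-> (exists k, sigma k = j).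
Hypothesis sigma_per : forall k q, sigma (k + q * m%:Z) = sigma k + q * N%:Z.
Hypothesis sigma_f : forall k, f (sigma k) = sigma (f' k).

Lemma sigma_inj k l : sigma k = sigma l -> k = l.
Proof. by move=> E; have := sigma_lt k l; have := sigma_lt l k; rewrite E ltxx; lia. Qed.

Definition fibers_in_image : Prop :=
  forall i i', f i = f i' -> i <> i' -> exists k, f k = i.

Variable r : int -> 'I_N.
Hypothesis rE : forall i, (r i)%:Z = (i %% N%:Z)%Z.
Let F (i : 'I_N) : 'I_N := r (f i%:Z).

Lemma F_residue i : F (r i) = r (f i).
Proof.
have [q qE] := residue_shift rE i; rewrite /F qE (nak_fperZ H).
by apply/esym/(residue_eqP rE); exists q.
Qed.

(** Reduction modulo [N] merges no two members of a fibre: [f] commutes with translation by [N], so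
    congruent integers with equal values are equal. *)
Lemma fibers_in_imageP :
  [forall i, forall i', (F i == F i') && (i != i') ==> (i \in F @: 'I_N)] <-> fibers_in_image.
Proof.
have imP i : r i \in F @: 'I_N <-> exists k, f k = i.
  split=> [/imsetP[j _ /(residue_eqP rE) [q qE]]|[k <-]].
    by exists (j%:Z - q * N%:Z); rewrite -mulNr (nak_fperZ H) qE mulNr addrK.
  by rewrite -F_residue imset_f.
split=> [/forallP good i i' fE ii'|good].
  apply/imP; have /forallP/(_ (r i'))/implyP := good (r i); apply.
  rewrite !F_residue fE eqxx /=; apply/eqP => /(residue_eqP rE) [q i'E]; apply: ii'.
  have N0 := nak_gt0 H; move: fE; rewrite i'E (nak_fperZ H).
  by move=> /eqP; rewrite -subr_eq0 opprD addrA subrr add0r oppr_eq0 mulf_eq0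
    => /orP[/eqP ->|]; [rewrite mul0r addr0|lia].
apply/forallP => i; apply/forallP => i'; apply/implyP => /andP[/eqP /(residue_eqP rE) [q qE] ii'].
have := imP i%:Z; rewrite (residue_ord rE) => ->.
apply: (good _ (i'%:Z - q * N%:Z)); first by rewrite -mulNr (nak_fperZ H) qE mulNr addrK.
move=> iE; case/negP: ii'; rewrite -(residue_ord rE i) -(residue_ord rE i'); apply/eqP.
by apply/(residue_eqP rE); exists q; rewrite iE subrK.
Qed.

(** Modulo the periods, the image has [m] elements; the defects are [N - m] and [m] minus the size
    of the second image, so the claim is the counting inequality for [F]. *)
Lemma defect_leqif : (defect B <= defect A ?= iff
  [forall i, forall i', (F i == F i') && (i != i') ==> (i \in F @: 'I_N)])%N.
Proof.
have [r' rE'] := residue_exists H'.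
have dA := defect_image H rE; have dB := defect_image H' rE'.
pose s (k : 'I_m) : 'I_N := r (sigma k%:Z).
have s_inj : injective s.
  move=> k l /(residue_eqP rE) [q]; rewrite -sigma_per => /sigma_inj lE.
  have kl := ltn_ord k; have ll := ltn_ord l.
  have q0 : q = 0 by nia.
  by apply: val_inj => /=; move: lE; rewrite q0 mul0r addr0 => -[].
have sr k : s (r' k) = r (sigma k).
  rewrite /s rE'; apply/(residue_eqP rE); exists (k %/ m%:Z)%Z.
  by rewrite -sigma_per addrC -divz_eq.
have I1E : F @: 'I_N = s @: 'I_m.
  apply/setP => y; apply/imsetP/imsetP => [[i _ ->]|[k _ ->]].
    have [k kE] : exists k, sigma k = f i%:Z by apply/sigma_im; exists i%:Z.
    by exists (r' k) => //; rewrite sr kE.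
  have [i iE] : exists i, f i = sigma k%:Z by apply/sigma_im; exists k%:Z.
  by exists (r i) => //; rewrite F_residue iE.
have I2E : F @: (F @: 'I_N) = s @: ((fun i : 'I_m => r' (f' i%:Z)) @: 'I_m).
  rewrite I1E -!imset_comp; apply: eq_imset => k /=.
  by rewrite sr -sigma_f -F_residue.
have c1 : #|F @: 'I_N| = m by rewrite I1E card_imset // card_ord.
have c2 : #|F @: (F @: 'I_N)| = #|(fun i : 'I_m => r' (f' i%:Z)) @: 'I_m|.
  by rewrite I2E card_imset.
have arith (a b n p q s0 t : nat) (c : bool) : (a + p = n)%N -> (b + t = m)%N ->
    p = m -> q = t -> s0 = n -> (p + p <= s0 + q ?= iff c)%N -> (b <= a ?= iff c)%N.
  by move=> h1 h2 h3 h4 h5 [le <-]; split; lia.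
exact: (arith _ _ _ _ _ _ _ _ dA dB c1 c2 (card_ord N) (iterated_image_leqif F)).
Qed.

(** The hypothesis on [fiber_min] says that the cosyzygy is nonzero; it reproduces itself, so
    neither resolution stops along the way. *)
Lemma long_enough_sigma t a b : fibers_in_image -> a < b ->
  fiber_min f (sigma b) < sigma a ->
  long_enough f t.+2 (sigma a) (sigma b) <-> long_enough f' t a b.
Proof.
move=> good; elim: t a b => [|t IH] a b ab gb.
  have sab := sigma_lt a b; rewrite ab in sab.
  split=> // _; right; split; first by apply/sigma_im; exists b.
  by right; split=> //; apply/sigma_im; exists a.
have sab : sigma a < sigma b by rewrite sigma_lt.
have sbI : exists k, f k = sigma b by apply/sigma_im; exists b.
have saI : exists k, f k = sigma a by apply/sigma_im; exists a.
have fgb : f (fiber_min f (sigma b)) = sigma b by apply/(fiber_min_im H).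
have fga : f (fiber_min f (sigma a)) = sigma a by apply/(fiber_min_im H).
have gab : fiber_min f (sigma a) < fiber_min f (sigma b).
  by rewrite ltNge; apply/negP => /(nak_mono H); rewrite fga fgb leNgt sab.
have [bI|nbI] := pselect (exists k, f' k = b).
  have gs : fiber_min f (sigma b) = sigma (fiber_min f' b).
    have f'g : f' (fiber_min f' b) = b by apply/(fiber_min_im H').
    have [c cE] : exists c, sigma c = fiber_min f (sigma b).
      (* Both points have value [sigma b] and the second is in the image; if they differ, the fibre
         has two elements and [good] applies to the first. *)
      apply/sigma_im; have [E|/eqP nE] := eqVneq (fiber_min f (sigma b)) (sigma (fiber_min f' b)).
        by rewrite E; apply/sigma_im; exists (fiber_min f' b).
      by apply: (good _ (sigma (fiber_min f' b))) => //; rewrite fgb sigma_f f'g.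
    rewrite -cE; congr sigma; apply/esym/(fiber_min_uniq H').
    have f'c : f' c = b by apply: sigma_inj; rewrite -sigma_f cE fgb.
    rewrite f'c lexx andbT -sigma_lt -sigma_f.
    have /andP[h _] := fiber_minP H (sigma b).
    have cc : sigma (c - 1) < sigma c by rewrite sigma_lt; lia.
    have h2 : f (sigma (c - 1)) <= f (sigma c - 1) by apply: (nak_mono H); lia.
    by apply: le_lt_trans h2 _; rewrite cE.
  have gba : fiber_min f' b < a by rewrite -sigma_lt -gs.
  have := IH _ _ gba; rewrite -gs => /(_ gab) IHab.
  rewrite [long_enough f' _ _ _]/= -IHab; split=> [[E|[_ h]]|[E|[_ h]]].
  - by rewrite E ltxx in sab.
  - by right.
  - by rewrite E ltxx in ab.
  - by right.
split=> [|[E|[bI _]]]; last 2 first.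
- by rewrite E ltxx in ab.
- by case: nbI.
(* The third step over [A] requires [fiber_min f (sigma b)] to be in the image of [f], which would
   put [b] in the image of [f']. *)
case=> [E|[_]]; first by rewrite E ltxx in sab.
case=> [E|[_]]; first by rewrite E ltxx in gb.
case=> [E|[/sigma_im [c cE] _]]; first by rewrite E ltxx in gab.
by case: nbI; exists c; apply: sigma_inj; rewrite -sigma_f cE.
Qed.

Lemma domdim_sub : fibers_in_image -> domdim A = enat_add (domdim B) 2%N.
Proof.
move=> good; apply: enat_le_ext => t; rewrite (domdim_ge H).
have pred_neq (z : int) : z - 1 <> z by lia.
have start k : f' (k - 1) = f' k <-> f (sigma k - 1) = f (sigma k).
  have kk : sigma (k - 1) < sigma k by rewrite sigma_lt; lia.
  split=> [E|E].
    apply/eqP; rewrite eq_le; apply/andP; split; first by apply: (nak_mono H); lia.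
    by rewrite sigma_f -E -sigma_f; apply: (nak_mono H); lia.
  have [l lE] : exists l, sigma l = sigma k - 1.
    apply/sigma_im; apply: (good _ (sigma k)); [exact: E|exact: pred_neq].
  have lk : l = k - 1.
    have := sigma_lt l k; have := sigma_lt l (k - 1); rewrite lE; lia.
  by apply: sigma_inj; rewrite -!sigma_f -lk lE.
have lift t' k : f' (k - 1) = f' k ->
    long_enough f t'.+2 (sigma k) (f (sigma k)) <-> long_enough f' t' k (f' k).
  move=> Ek; rewrite sigma_f; apply: long_enough_sigma => //; first exact: nak_gt H' k.
  rewrite -sigma_f; have /start E := Ek.
  rewrite ltNge; apply/negP => h.
  have /andP[h1 _] := fiber_minP H (f (sigma k)).
  have : f (sigma k - 1) <= f (fiber_min f (f (sigma k)) - 1) by apply: (nak_mono H); lia.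
  by rewrite E leNgt h1.
(* A non-injective projective shares its fibre with its predecessor, so its top lies in the image
   and it comes from [B]. *)
have onto i : f (i - 1) = f i -> exists2 k, sigma k = i & f' (k - 1) = f' k.
  move=> E; have [k kE] : exists k, sigma k = i.
    by apply/sigma_im; apply: (good _ (i - 1)); [exact/esym|exact/nesym/pred_neq].
  by exists k => //; apply/start; rewrite kE.
have -> : enat_le (Some t) (enat_add (domdim B) 2%N) = enat_le (Some (t - 2)%N) (domdim B).
  by case: (domdim B) => //= n; lia.
(* For [t] below 2 the subtraction truncates to 0 and both sides hold; the only demand is that [f i]
   be a value of [f]. *)
rewrite (domdim_ge H'); case: t => [|[|t]].
- by split.
- split=> // _ i /onto[k kE _]; right; split=> //; by exists i.
rewrite subSS subSS subn0; split=> [h k Ek|h i /onto[k <- Ek]].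
  by apply/lift => //; apply: h; apply/start.
by apply/lift => //; apply: h.
Qed.

Lemma domdim_le2 i i' : (forall j, j + 2%:Z <= f j) -> f i = f i' -> i <> i' ->
  ~ (exists k, f k = i) -> enat_le (domdim A) (Some 2%N).
Proof.
move=> f2 fE ii' nI.
suff : ~ enat_le (Some 3) (domdim A) by case: (domdim A) => //= n; lia.
rewrite (domdim_ge H) => dd.
(* If [i] is not least in its fibre, the projective at [i] is not injective, and its second step
   already asks for [i] in the image. *)
have [E|nE] := eqVneq (f (i - 1)) (f i).
  case: (dd i E) => [h|[_]]; first by have := f2 i; rewrite -h; lia.
  case=> [h|[]//].
  have /andP[h1 _] := fiber_minP H (f i); by rewrite h E ltxx in h1.
have lt : f (i - 1) < f i by rewrite lt_neqAle nE; apply: (nak_mono H); lia.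
(* Now [i] is least in its fibre and [i + 1] belongs to it. The resolution of the projective at
   [i + 1] has endpoints [f (i + 1)], [i + 1], [i], so it fails at the third step; the cosyzygy
   ending at [i] is nonzero because [i + 1 <= f (i - 1)]. *)
have E : f (i + 1 - 1) = f (i + 1).
  rewrite addrK; apply/eqP; rewrite eq_le; apply/andP; split; first by apply: (nak_mono H); lia.
  have i'i : i + 1 <= i'.
    rewrite leNgt; apply/negP => h; have := @nak_mono _ _ _ _ _ _ H i' (i - 1).
    by rewrite -fE => /(_ ltac:(lia)); rewrite leNgt lt.
  by rewrite fE; exact: (nak_mono H).
have gE : fiber_min f (f (i + 1)) = i.
  by apply: (fiber_min_uniq H); rewrite -E addrK lt lexx.
have := dd _ E; rewrite /=; rewrite gE => -[h|[_]]; first by have := f2 (i + 1); rewrite -h; lia.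
have succ_neq (z : int) : z <> z + 1 by lia.
case=> [/succ_neq //|[_]].
case=> [h|[]//].
have /andP[h1 _] := fiber_minP H (i + 1).
by have := f2 (i - 1); rewrite h in h1; lia.
Qed.

Theorem defect_domdim : (forall j, j + 2%:Z <= f j) ->
  ((defect B < defect A)%N -> enat_le (domdim A) (Some 2%N)) /\
  (defect A = defect B -> domdim A = enat_add (domdim B) 2%N).
Proof.
move=> f2; have [le eq] := defect_leqif; have P := fibers_in_imageP.
split=> [lt|E]; last first.
  by apply: domdim_sub; apply/P; rewrite -eq E.
have : ~ fibers_in_image by move/P; rewrite -eq; lia.
move=> nf; apply: contrapT => nd; apply: nf => i i' fE ii'; apply: contrapT => nI.
by apply: nd; exact: (domdim_le2 f2 fE ii' nI).
Qed.

End SubComparison.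

(** * Quotients of the path algebra of a cycle *)

Section CyclicQuiver.
Variables (K : fieldType) (n : nat).
Local Notation Q := (cycle_quiver n).
Local Notation N := n.+1.
Local Notation PA := (path_alg K Q).

Lemma mul_pgen (p q : qpath Q) : (pgen K p : PA) * pgen K q = pbasis K (pcat p q).
Proof. exact: pmulUU. Qed.

Fact arrow_walk (v : 'I_N) (s : seq 'I_N) : is_walk (Q := Q) (ordS v) s ->
  is_walk (Q := Q) v (v :: s).
Proof. by move=> /= ->; rewrite eqxx. Qed.

Definition arrow_path (v : 'I_N) : qpath Q :=
  exist (fun p => is_walk (Q := Q) p.1 p.2) (v, [:: v]) (@arrow_walk v [::] isT).

(** One arrow leaves each vertex, so the path of length [a] from [v] is the trivial path at [v]
    times the [a]-th power of this sum. *)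
Definition arrow_sum : PA := \sum_(v : 'I_N) pgen K (arrow_path v).

Lemma arrow_sum_left (v : 'I_N) : (pgen K (@pnil Q v) : PA) * arrow_sum = pgen K (arrow_path v).
Proof.
rewrite /arrow_sum mulr_sumr (bigD1 v) //= big1 ?addr0 => [|w wv]; rewrite mul_pgen pcat0p.
  by rewrite eqxx.
by rewrite eq_sym (negbTE wv).
Qed.

Lemma arrow_sum_right (v : 'I_N) :
  arrow_sum * (pgen K (@pnil Q (ordS v)) : PA) = pgen K (arrow_path v).
Proof.
rewrite /arrow_sum mulr_suml (bigD1 v) //= big1 ?addr0 => [|w wv]; rewrite mul_pgen pcatp0.
  by rewrite eqxx.
by rewrite /ptgt /= (inj_eq (@ordS_inj _)) (negbTE wv).
Qed.

Lemma pgen_path (p : qpath Q) :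
  pgen K p = (pgen K (@pnil Q (psrc p)) : PA) * arrow_sum ^+ plen p.
Proof.
case: p => -[v s] w; rewrite /psrc /plen /parrows /=.
elim: s v w => [|a s IH] v w.
  by rewrite expr0 mulr1; congr pgen; apply: qpath_eq.
have /= /andP[/eqP av ws] := w; have {}av : a = v by [].
rewrite {a}av in w ws *.
have E : (pgen K (arrow_path v) : PA) * pgen K (@pnil Q (ordS v)) = pgen K (arrow_path v).
  by rewrite mul_pgen pcatp0 /ptgt /= eqxx.
rewrite exprS mulrA arrow_sum_left -E -mulrA -(IH _ ws) mul_pgen.
set p : qpath Q := exist (fun p => is_walk (Q := Q) p.1 p.2) _ w.
have -> : pcat (arrow_path v) (exist (fun p => is_walk (Q := Q) p.1 p.2) (ordS v, s) ws) = Some p.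
  by apply/pcatP.
by [].
Qed.

Lemma long_path (v : 'I_N) (a : nat) : exists p : qpath Q, psrc p = v /\ plen p = a.
Proof.
elim: a v => [|a IH] v; first by exists (@pnil Q v).
have [[[w s] ws] [/= wv sa]] := IH (ordS v); rewrite /psrc /= in wv.
have ws' : is_walk (Q := Q) v (v :: s) by apply: arrow_walk; rewrite -wv; exact: ws.
exists (exist (fun p => is_walk (Q := Q) p.1 p.2) (v, v :: s) ws').
by split=> //; rewrite /plen /= -sa.
Qed.

End CyclicQuiver.

(** [f i - i] is the least length of a path from [i] that vanishes in [A]: finite since the ideal
    contains all long paths, at least 2 since it contains no vertex and no arrow. *)
Lemma cyclic_basis (K : fieldType) (A : falgType K) : cyclic_nakayama A ->
  exists N e (x : A) f, nakayama_basis N e x f /\ forall i, i + 2%:Z <= f i.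
Proof.
move=> [n [phi [phiZ phi_sur [[m m2 Im] I2]]]].
pose N := n.+1.
have [r rE] : exists r : int -> 'I_N, forall i, (r i)%:Z = (i %% N%:Z)%Z.
  suff /choice [r rP] : forall i : int, exists k : 'I_N, k%:Z = (i %% N%:Z)%Z by exists r.
  move=> i; have kN : (absz (i %% N%:Z)%Z < N)%N by lia.
  by exists (Ordinal kN) => /=; lia.
have rS i : r (i + 1) = ordS (r i).
  apply: val_inj => /=; apply/eqP; rewrite -eqz_nat rE.
  rewrite -modz_nat -addn1 PoszD rE modzDml //.
pose x := phi (arrow_sum K n).
pose e i := phi (pgen K (@pnil (cycle_quiver n) (r i))).
have epow v a : exists p : qpath (cycle_quiver n), [/\ psrc p = v, plen p = a &
    phi (pgen K (@pnil (cycle_quiver n) v)) * x ^+ a = phi (pgen K p)].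
  have [p [pv pa]] := long_path v a; exists p; split=> //.
  by rewrite (pgen_path K p) pv pa rmorphM rmorphXn.
have supp (p : qpath (cycle_quiver n)) k : in_arrow_ideal k (pgen K p) <-> (k <= plen p)%N.
  rewrite pgenE; split=> [h|kp q].
    by apply: h; rewrite msuppU oner_eq0 inE.
  by rewrite msuppU oner_eq0 inE => /eqP ->.
have cex v : exists a, phi (pgen K (@pnil (cycle_quiver n) v)) * x ^+ a == 0.
  by exists m; have [p [_ pm ->]] := epow v m; apply/eqP/Im/supp; rewrite pm.
pose c v := ex_minn (cex v).
have cP v a : (phi (pgen K (@pnil (cycle_quiver n) v)) * x ^+ a == 0) = (c v <= a)%N.
  rewrite /c; case: ex_minnP => k /eqP k0 kmin; apply/idP/idP => [/kmin //|ka].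
  by rewrite -(subnKC ka) exprD mulrA k0 mul0r.
have c2 v : (2 <= c v)%N.
  rewrite ltnNge -cP; apply/eqP; have [p [_ p1 ->]] := epow v 1%N.
  by move=> /I2/supp; rewrite p1.
exists N, e, x, (fun i => i + (c (r i))%:Z); split; last by move=> i; have := c2 (r i); lia.
split=> //.
- move=> i; congr (phi (pgen K (pnil _))); apply: val_inj; apply/eqP.
  by rewrite -eqz_nat !rE modzDr.
- move=> i j; rewrite /e -rmorphM mul_pgen pcat0p /psrc /=.
  have <- : (r i == r j) = (i == j %[mod N%:Z])%Z by rewrite -val_eqE -eqz_nat /= !rE.
  by case: eqP => [->|_] //; exact: (rmorph0 phi).
- have <- : phi (pone K (cycle_quiver n)) = 1 := rmorph1 phi.
  rewrite big_mkord /pone rmorph_sum; apply: eq_bigr => i _; rewrite /e; congr (phi (pgen K (pnil _))).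
  by apply: val_inj; apply/eqP; rewrite -eqz_nat rE modz_nat modn_small.
- by move=> i; rewrite /e /x -!rmorphM rS arrow_sum_left arrow_sum_right.
- by move=> i a; rewrite cP; lia.
- by move=> i; have := c2 (r i); lia.
move=> P P0 Plin Pex a; have [y <-] := phi_sur a.
rewrite -(plin_id y) /plin rmorph_sum.
apply: big_ind => //.
  by move=> u v Pu Pv; rewrite -[u]scale1r; apply: Plin.
move=> p _; rewrite phiZ -[_ *: _]addr0; apply: Plin => //.
rewrite (pgen_path K p) rmorphM rmorphXn -/x.
have -> : psrc p = r (psrc p : 'I_N)%:Z.
  by apply: val_inj; apply/eqP; rewrite -eqz_nat rE modz_nat modn_small.
exact: Pex.
Qed.

(** * Socles, translates and projective covers *)

Section Translates.
Variables (K : fieldType) (A : falgType K).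
Variables (N : nat) (e : int -> A) (x : A) (f : int -> int).
Hypothesis H : nakayama_basis N e x f.
Implicit Types (M P S : fmod A).
Local Notation igen := (igen e x).
Local Notation isiv := (isiv e x).

Lemma igen_socle_line M i l (u : M) : igen i l u -> (0 < l)%N ->
  simple_submod <[(u • x ^+ l.-1)%R]>%VS.
Proof.
move=> g l0; have w0 : u • x ^+ l.-1 != 0 by apply: igen_neq0 g _; lia.
split.
- move=> v a /vlineP[k ->].
  have we : u • x ^+ l.-1 • e (i + l.-1%:Z) = u • x ^+ l.-1 by rewrite (igen_act_e H _ _ g) eqxx.
  have [al h] := nak_expand H a we; rewrite ractZl (h 1%N).
    by rewrite big_nat1 expr0 ract1 scalerA memvZ // memv_line.
  by rewrite -ractA -exprD addn1 prednK // (igen_eq0 g).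
- by move=> L0; case/negP: w0; rewrite -memv0 -L0 memv_line.
move=> V sV VL; have [->|/eqP nV] := eqVneq V 0%VS; [by left|right].
apply/eqP; rewrite eqEsubv VL -memvE; exact: (igen_socle_mem H g sV nV).
Qed.

Lemma igen_simple_submod M i l (u : M) (V : {vspace M}) : igen i l u -> (0 < l)%N ->
  simple_submod V -> V = <[(u • x ^+ l.-1)%R]>%VS.
Proof.
move=> g l0 [sV nV Vmin]; have [sL nL _] := igen_socle_line g l0.
by case: (Vmin _ sL) => // ; rewrite -memvE; exact: (igen_socle_mem H g sV nV).
Qed.

Lemma igen_is_socle M i l (u : M) : igen i l u -> (0 < l)%N ->
  is_socle <[(u • x ^+ l.-1)%R]>%VS.
Proof.
move=> g l0; split=> [V /(igen_simple_submod g l0) ->|W]; first exact: subvv.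
by apply; exact: igen_socle_line g l0.
Qed.

Lemma igen_socleE M i l (u : M) (W : {vspace M}) : igen i l u -> (0 < l)%N ->
  is_socle W -> W = <[(u • x ^+ l.-1)%R]>%VS.
Proof.
move=> g l0 [W1 W2]; have [L1 L2] := igen_is_socle g l0.
by apply/eqP; rewrite eqEsubv W2 // L2.
Qed.

Lemma isiv_iso_socle S M i l : isiv M i l -> (0 < l)%N -> iso_socle S M ->
  isiv S (i + l.-1%:Z) 1.
Proof.
move=> [u g] l0 [h [/mmonoP[hh hinj] /(igen_socleE g l0) lh]].
set w := u • x ^+ l.-1 in lh.
have w0 : w != 0 by apply: igen_neq0 g _; lia.
have [s sE] : exists s, w = h s by apply/limgP; rewrite lh memv_line.
have inj y z : h y = h z -> y = z.
  by move=> E; apply/eqP; rewrite -subr_eq0; apply/eqP/hinj; rewrite homB E subrr.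
exists s; split.
- by apply: inj; rewrite hh -sE (igen_act_e H _ _ g) eqxx.
- case=> [|a]; first by rewrite expr0 ract1; apply/eqP => s0; rewrite sE s0 hom0 eqxx in w0.
  apply/eqP/hinj; rewrite hh -sE -ractA -exprD (igen_eq0 g) //; lia.
move=> m; have : h m \in limg h by apply/limgP; exists m.
rewrite lh => /vlineP[k kE]; exists (k *: 1); apply: inj.
by rewrite hh -sE ractZr ract1.
Qed.

Lemma iso_socle_exists M i l : isiv M i l -> (0 < l)%N -> exists S, iso_socle S M.
Proof.
move=> [u g] l0; have [sL _ _] := igen_socle_line g l0.
have [S [h [hm hl]]] := sub_exists sL; exists S, h; split=> //.
by rewrite hl; exact: igen_is_socle g l0.
Qed.

Lemma cover_igen P M (p : 'Hom(P, M)) i l (s : M) : projective_cover p -> igen i l s ->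
  (0 < l)%N -> exists u c, [/\ p u = s, i + c%:Z = f i & igen i c u].
Proof.
move=> [Pp pe ps] g l0; have [hp psur] := (mepiP p).1 pe; have [se sx ss] := g.
have [w wE] := psur s; exists (w • e i).
have pu : p (w • e i) = s by rewrite hp -wE se.
have ue : w • e i • e i = w • e i by rewrite -ractA (nak_idem H).
have [||c ic gc] := projective_cyclic H Pp ue ps.
- move=> m; have [a aE] := ss (p m); exists a, (m - w • e i • a).
  by rewrite memv_ker homB hp pu -aE subrr eqxx addrC subrK.
- apply/eqP => u0; have := igen_neq0 g l0; rewrite expr0 ract1 -pu u0 hom0 eqxx //.
by exists c.
Qed.

Lemma isiv_cover P M i l : is_projective_cover M P -> isiv M i l -> (0 < l)%N ->
  isiv P i (absz (f i - i)%R).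
Proof.
move=> [p pc] [s g] l0; have [u [c [_ ic gc]]] := cover_igen pc g l0.
by exists u; have -> : absz (f i - i)%R = c by lia.
Qed.

Hypothesis f2 : forall j, j + 2%:Z <= f j.

(** A path of positive length ending at [i + 1] ends with the arrow from [i]. Hence
    [A e (i + 1) / A e i x] has dimension at most 1; [not_right_mulx] shows that it is nonzero. *)
Lemma right_decomp i b : exists (c : K) (d : A), b * e (i + 1) = c *: e (i + 1) + d * e i * x.
Proof.
elim/(nak_span H): b => [|c a b [c1 [d1 E1]] [c2 [d2 E2]]|j k].
- by exists 0, 0; rewrite !mul0r scale0r addr0.
- exists (c * c1 + c2), (c *: d1 + d2).
  rewrite mulrDl -scalerAl E1 E2 scalerDr scalerDl scalerA !mulrDl -!scalerAl.
  by rewrite addrACA.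
case: k => [|k].
  rewrite expr0 mulr1 (nak_orth H); case: eqP => [/(nak_mod H) ->|_].
    by exists 1, 0; rewrite scale1r !mul0r addr0.
  by exists 0, 0; rewrite scale0r !mul0r addr0.
exists 0, (e j * x ^+ k); rewrite scale0r add0r.
by rewrite exprSr -!mulrA -(nak_comm H).
Qed.

Lemma not_right_mulx i d : e (i + 1) <> d * x.
Proof.
move=> E; have fi := nak_gt H (i + 1).
pose c := absz (f (i + 1) - (i + 1))%R.
have [d' dE] := nak_normal H d c.
have : e (i + 1) * x ^+ c.-1 == 0.
  rewrite -(nak_idem H) {2}E -!mulrA -exprS prednK; last by rewrite /c; lia.
  rewrite dE mulrA; have -> : e (i + 1) * x ^+ c = 0; last by rewrite mul0r.
  by apply/eqP; rewrite (nak_pow H) /c; lia.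
by rewrite (nak_pow H) /c; lia.
Qed.

(** The presentation of the simple at [i] is left multiplication by [x] from [e (i + 1) A] to
    [e i A]; here it appears as [h u1 = u0 • x], nonzero because [e i A] has length at least 2. Its
    transpose is right multiplication by [x] from [A e i] to [A e (i + 1)], whose cokernel is
    one-dimensional at the vertex [i + 1]. *)
Lemma simple_translate S T i : isiv S i 1 -> is_AR_translate S T -> isiv T (i + 1) 1.
Proof.
move=> [s gs] [T' [P0 [P1 [h [g [q [[cg P1p hh lh sh] qe kq]]]]]] iT].
apply: (isiv_iso (miso_sym iT)).
have [u0 [c0 [gu0 ic0 g0]]] := cover_igen cg gs isT.
have [_ /mepiP[hg gsur] _] := cg.
have [u0e _ u0s] := g0.
have fi := f2 i; have fi1 := nak_gt H (i + 1).
have u0xe : u0 • x • e (i + 1) = u0 • x.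
  by have := igen_act_e H 1 (i + 1) g0; rewrite expr1 eqxx.
have u0x0 : u0 • x != 0.
  by have := igen_neq0 g0 (_ : (1 < c0)%N); rewrite expr1; apply; lia.
have kerg m : m \in lker g <-> exists c, m = u0 • x • c.
  have skg : submod (lker g).
    by move=> v a; rewrite !memv_ker hg => /eqP ->; rewrite ract0l.
  have [a [ac aE]] := igen_submod H g0 skg.
  suff a1 : a = 1%N by rewrite aE a1 expr1.
  have a_le1 : (a <= 1)%N.
    apply/(igen_mem H _ g0 ac)/aE; rewrite expr1 memv_ker hg gu0.
    by rewrite -[x]expr1 (igen_eq0 gs).
  have : ~ (a <= 0)%N.
    move=> /(igen_mem H _ g0 ac)/aE; rewrite expr0 ract1 memv_ker gu0 => /eqP s0.
    by have := igen_neq0 gs (ltn0Sn 0); rewrite s0 ract0l eqxx.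
  by lia.
have [w1 w1E] : exists w, u0 • x = h w.
  apply/limgP; rewrite lh; apply/kerg; exists 1; by rewrite ract1.
pose u1 := w1 • e (i + 1).
have hu1 : h u1 = u0 • x by rewrite hh -w1E u0xe.
have u1e' : u1 • e (i + 1) = u1 by rewrite -ractA (nak_idem H).
have [||c1 ic1 g1] := projective_cyclic H P1p u1e' sh.
- move=> m; have [c cE] : exists c, h m = u0 • x • c.
    by apply/kerg; rewrite -lh; apply/limgP; exists m.
  exists c, (m - u1 • c).
  by rewrite memv_ker homB hh hu1 cE subrr eqxx addrC subrK.
- by apply: contra u0x0 => /eqP E; rewrite -hu1 E hom0.
have [u1e u1x u1s] := g1.
have [hq qsur] := (mepiP q).1 qe.
(* Evaluation at the generator identifies [star P] with [A e j]: [mkstar] gives surjectivity,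
   [star_eq] injectivity for [P1]. *)
have mkstar P j c (u : P) (b : A) : igen j c u -> j + c%:Z = f j -> b * e j = b ->
    exists y : star P, vsval y u = b.
  move=> gu jc be.
  have bc : b * x ^+ c = 0.
    rewrite -be -mulrA; have -> : e j * x ^+ c = 0; last by rewrite mulr0.
    by apply/eqP; rewrite (nak_pow H); lia.
  have [k hk ku] := igen_hom H (M' := regmod A) gu be bc.
  exists (Subvs ((HomsP k).2 hk)); exact: ku.
have star_eq (y z : star P1) : vsval y u1 = vsval z u1 -> y = z.
  move=> E; apply: val_inj; apply/lfunP => m; have [a ->] := u1s m.
  by rewrite ((HomsP _).1 (subvsP y)) ((HomsP _).1 (subvsP z)) E.
have q0 (y : star P1) (d : A) : vsval y u1 = d * e i * x -> q y = 0.
  move=> yE; have [z zE] : exists z : star P0, vsval z u0 = d * e i.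
    by apply: (mkstar _ _ _ _ _ g0) => //; rewrite -mulrA (nak_idem H).
  apply/eqP; rewrite -memv_ker kq; apply/limgP; exists z; apply: star_eq.
  by rewrite star_mapE // hu1 ((HomsP _).1 (subvsP z)) zE yE.
have [y1 y1E] : exists y : star P1, vsval y u1 = e (i + 1).
  by apply: (mkstar _ _ _ _ _ g1) => //; rewrite (nak_idem H).
pose t := q y1.
have t0 : t != 0.
  rewrite -memv_ker kq; apply/negP => /limgP[z zE].
  have := y1E; rewrite zE star_mapE // hu1 ((HomsP _).1 (subvsP z)).
  by move=> /esym; apply: not_right_mulx.
have tspan y : exists k : K, y = k *: t.
  have [z ->] := qsur y; have [c [d E]] := right_decomp i (vsval z u1).
  exists c; apply/eqP; rewrite -subr_eq0 -homZ -homB; apply/eqP/(q0 _ d).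
  rewrite linearB /= add_lfunE opp_lfunE scale_lfunE y1E.
  have -> : vsval z u1 = vsval z u1 * e (i + 1).
    by rewrite -{1}u1e ((HomsP _).1 (subvsP z)).
  by rewrite E addrC addKr.
have te : t • (e (i + 1) : A^c) = t.
  rewrite /t -hq; congr (q _); apply: star_eq.
  by rewrite star_actE y1E (nak_idem H).
have tx : t • (x : A^c) = 0.
  rewrite /t -hq; apply: (q0 _ 1); rewrite star_actE y1E mul1r.
  by rewrite (nak_comm H).
have [xi xit] : exists xi : 'Hom(T', K^o), xi t = 1.
  have [xi xiE] : exists xi : 'Hom(T', K^o), xi =1 coord [tuple t] ord0.
    by apply: lin_hom => c y z; rewrite linearP.
  exists xi; rewrite xiE (coord_free ord0 ord0) ?eqxx // seq1_free //.
have dual_eq (a b : dual T') : (a : 'Hom(T', K^o)) t = (b : 'Hom(T', K^o)) t -> a = b.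
  by move=> E; apply/lfunP => y; have [k ->] := tspan y; rewrite !homZ E.
exists (xi : dual T'); split.
- by apply: dual_eq; rewrite /ract /= dual_actE te.
- have xx : (xi : dual T') • x = 0.
    by apply: dual_eq; rewrite /ract /= dual_actE tx hom0 zero_lfunE.
  case=> [|a]; last by rewrite exprS ractA xx ract0l eqxx.
  rewrite expr0 ract1; apply/eqP => xi0.
  by have := xit; rewrite xi0 zero_lfunE => /esym/eqP; rewrite oner_eq0.
move=> m; exists ((m : 'Hom(T', K^o)) t *: 1); apply: dual_eq.
by rewrite ractZr ract1 scale_lfunE xit; rewrite /GRing.scale /= mulr1.
Qed.

End Translates.

(** * Increasing enumeration of a periodic set of integers *)

Section PeriodicEnumeration.
Variables (N : nat) (Y : int -> Prop).
Hypothesis N0 : (0 < N)%N.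
Hypothesis Yper : forall i q, Y (i + q * N%:Z) <-> Y i.

Lemma periodic_enumeration : (exists i, Y i) -> exists (m : nat) (sigma : int -> int),
  [/\ (0 < m)%N, forall k l, (sigma k < sigma l) = (k < l),
      forall j, Y j <-> exists k, sigma k = j
    & forall k q, sigma (k + q * m%:Z) = sigma k + q * N%:Z].
Proof.
move=> [i0 Yi0]; pose s := [seq i <- iota 0 N | `[< Y i%:Z >]]; pose m := size s.
have sP (k : nat) : (k \in s) = (k < N)%N && `[< Y k%:Z >].
  by rewrite mem_filter mem_iota /= add0n andbC.
have index_of (j : int) : Y j -> exists2 r, (r < m)%N & exists q, j = (nth 0%N s r)%:Z + q * N%:Z.
  move=> Yj; have rs : absz (j %% N%:Z)%Z \in s.
    rewrite sP; have -> : (absz (j %% N%:Z)%Z < N)%N by lia.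
    apply/asboolP; have -> : (absz (j %% N%:Z)%Z)%:Z = j + (- (j %/ N%:Z)%Z) * N%:Z.
      by have := divz_eq j N%:Z; lia.
    exact/Yper.
  exists (index (absz (j %% N%:Z)%Z) s); first by rewrite index_mem.
  exists (j %/ N%:Z)%Z; rewrite nth_index //; have := divz_eq j N%:Z; lia.
have m0 : (0 < m)%N by have [r rm _] := index_of _ Yi0; exact: leq_ltn_trans rm.
have sN r : (r < m)%N -> (nth 0%N s r < N)%N.
  by move=> rm; have := mem_nth 0%N rm; rewrite sP => /andP[].
have sY r : (r < m)%N -> Y (nth 0%N s r)%:Z.
  by move=> rm; have := mem_nth 0%N rm; rewrite sP => /andP[_ /asboolP].
have slt r r' : (r < r')%N -> (r' < m)%N -> (nth 0%N s r < nth 0%N s r')%N.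
  move=> rr rm; have ss : sorted ltn s.
    by apply: (sorted_filter ltn_trans); exact: iota_ltn_sorted.
  have := @sorted_ltn_nth nat ltn ltn_trans 0%N s ss r r'.
  by rewrite !inE; apply=> //; exact: ltn_trans rm.
(* [s] lists the members in [0, N); [m] steps of the index correspond to one period [N]. *)
pose sigma k : int := (nth 0%N s (absz (k %% m%:Z)%Z))%:Z + (k %/ m%:Z)%Z * N%:Z.
have modm k : (absz (k %% m%:Z)%Z < m)%N by lia.
have mono (k l : int) : k < l -> sigma k < sigma l.
  move=> kl; rewrite /sigma.
  have := sN _ (modm k); have := sN _ (modm l).
  have := slt (absz (k %% m%:Z)%Z) (absz (l %% m%:Z)%Z).
  have := modm k; have := modm l.
  have := divz_eq k m%:Z; have := divz_eq l m%:Z.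
  have : 0 <= (k %% m%:Z)%Z by lia.
  have : 0 <= (l %% m%:Z)%Z by lia.
  move: (k %/ _)%Z (l %/ _)%Z (k %% _)%Z (l %% _)%Z => q q' r r' r0 r0' lE kE rm rm'.
  have qq : q <= q' by nia.
  have [qE|qn] := eqVneq q q'; last by move=> _ h1 h2; nia.
  move=> h _ _; have : (absz r < absz r')%N.
    by move: kl; rewrite kE lE qE ltrD2l; lia.
  by move=> /h -/(_ rm); rewrite qE; lia.
exists m, sigma; split=> //.
- move=> k l; apply/idP/idP => [|/mono //]; rewrite !ltNge; apply: contra.
  by rewrite le_eqVlt => /orP[/eqP ->|/mono/ltW].
- move=> j; split=> [/index_of[r rm [q jE]]|[k <-]].
    exists (r%:Z + q * m%:Z); rewrite /sigma.
    rewrite [r%:Z + _]addrC modzMDl modz_nat divzMDl; last by lia.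
    rewrite modn_small // jE divz_nat divn_small // addr0 //.
  by apply/Yper/sY.
move=> k q; rewrite /sigma [k + _]addrC modzMDl divzMDl; last by lia.
by rewrite mulrDl addrA addrAC.
Qed.

End PeriodicEnumeration.

(** * The syzygy filtered algebra as a corner algebra *)

Section CyclicGenerator.
Variables (K : fieldType) (A : falgType K).
Variables (N : nat) (e : int -> A) (x : A) (f : int -> int).
Hypothesis H : nakayama_basis N e x f.

(* For an idempotent [eps], this says that [M] is isomorphic to [eps A]. *)
Definition generated_by (M : fmod A) (eps : A) : Prop := exists U : M,
  [/\ U • eps = U, forall m, exists a, m = U • a & forall a, U • a = 0 -> eps * a = 0].

Lemma generated_mdsum n (P : 'I_n -> fmod A) (y : 'I_n -> int) :
  (forall i, isiv e x (P i) (y i) (absz (f (y i) - y i)%R)) ->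
  (forall i j, (y i = y j %[mod N%:Z])%Z -> i = j) ->
  generated_by (mdsum P) (\sum_(i < n) e (y i)).
Proof.
elim: n P y => [|n IH] P y Piv yinj.
  rewrite /mdsum !big_ord0; exists 0; split.
  - by rewrite ract0l.
  - by move=> m; exists 0; exact: rV0_eq.
  - by move=> a _; rewrite mul0r.
have orth i j : i != j -> e (y i) * e (y j) = 0.
  by move=> ij; rewrite (nak_orth H); case: eqP => // /yinj E; rewrite E eqxx in ij.
have [U [Ue Us U0]] := IH (fun i => P (lift ord0 i)) (fun i => y (lift ord0 i))
  (fun i => Piv _) (fun i j E => lift_inj (yinj _ _ E)).
have [u g] := Piv ord0; have [ue ux us] := g.
rewrite /mdsum !big_ord_recl -/(mdsum _).
set e0 := e (y ord0); set eps := \sum_(i < n) _ in Ue U0 *.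
have e0eps : e0 * eps = 0.
  by rewrite /e0 /eps mulr_sumr big1 // => i _; rewrite orth // neq_lift.
have epse0 : eps * e0 = 0.
  by rewrite /e0 /eps mulr_suml big1 // => i _; rewrite orth // eq_sym neq_lift.
have ueps : u • eps = 0 by rewrite -ue -ractA e0eps ract0r.
have Ue0 : U • e0 = 0 by rewrite -Ue -ractA epse0 ract0r.
have actE (z : mprod (P ord0) (mdsum (fun i => P (lift ord0 i)))) a : z • a = (z.1 • a, z.2 • a) by [].
exists ((u, U) : mprod (P ord0) (mdsum (fun i => P (lift ord0 i)))); split.
- by rewrite actE /= !ractDr ue ueps Ue0 Ue addr0 add0r.
- move=> [m1 m2]; have [a1 ->] := us m1; have [a2 ->] := Us m2.
  exists (e0 * a1 + eps * a2); rewrite actE /= !ractDr !ractA ue ueps Ue0 Ue.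
  by rewrite !ract0l addr0 add0r.
move=> a; rewrite actE /= => -[ua Ua]; rewrite mulrDl U0 // addr0.
apply: (igen_ann H (M' := regmod A) g _ _ ua); first exact: (nak_idem H).
by apply/eqP; rewrite [_ == _](nak_pow H); have := nak_gt H (y ord0); lia.
Qed.

(** An endomorphism of [eps A] is left multiplication by its value at the generator. As modules are
    right modules, composition becomes the product of [eps A eps] in the same order. *)
Lemma corner_embedding (M : fmod A) (eps : A) (B : falgType K) :
  generated_by M eps -> eps * eps = eps -> iso_End M B ->
  exists rho : B -> A, [/\ linear rho, injective rho, forall s t, rho (s * t) = rho s * rho t,
    rho 1 = eps & forall a, eps * a * eps = a <-> exists t, rho t = a].
Proof.
move=> [U [Ue Us U0]] ee [phi [kphi lphi phi1 phiM]].
have phiH t : mhom (phi t) by apply/HomsP; rewrite -lphi; apply/limgP; exists t.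
have uniq a b : eps * a = a -> eps * b = b -> U • a = U • b -> a = b.
  move=> ea eb E; apply/eqP; rewrite -subr_eq0 -ea -eb -mulrBr; apply/eqP/U0.
  by rewrite ractBr E subrr.
have /choice [rho rhoP] : forall t, exists a, phi t U = U • a /\ eps * a * eps = a.
  (* Multiplying by [eps] on both sides leaves [U • a] unchanged and selects the unique
     representative in the corner. *)
  move=> t; have [a aE] := Us (phi t U); exists (eps * a * eps); split.
    by rewrite -{1}Ue phiH aE -!mulrA ractA Ue ractA.
  by rewrite !mulrA ee -!mulrA ee.
have rhoU t : phi t U = U • rho t by have [] := rhoP t.
have rhoe t : eps * rho t * eps = rho t by have [] := rhoP t.
have rhol t : eps * rho t = rho t by rewrite -[in LHS]rhoe !mulrA ee rhoe.
exists rho; split.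
- move=> c s t; apply: uniq; rewrite ?rhol // ?mulrDr -?scalerAr ?rhol //.
  by rewrite -rhoU homD homZ add_lfunE scale_lfunE ractDr ractZr !rhoU.
- move=> s t E; have : phi s = phi t.
    apply/lfunP => m; have [a ->] := Us m.
    by rewrite !phiH !rhoU E.
  have /lker0P inj : lker phi == 0%VS by rewrite kphi.
  exact: inj.
- move=> s t; apply: uniq; rewrite ?mulrA ?rhol //.
  by rewrite -rhoU phiM comp_lfunE rhoU phiH rhoU ractA.
- by apply: uniq; rewrite ?rhol ?ee // -rhoU phi1 id_lfunE Ue.
move=> a; split=> [ea|[t <-]]; last exact: rhoe.
have al : eps * a = a by rewrite -ea !mulrA ee.
have [k hk kU] : exists2 k : 'Hom(M, M), mhom k & k U = U • a.
  apply: cyclic_hom => // b /U0 eb.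
  by rewrite -ea -ractA -!mulrA eb !mulr0 ract0r.
have [t tE] : exists t, k = phi t by apply/limgP; rewrite lphi; apply/HomsP.
by exists t; apply: uniq; rewrite ?rhol // -rhoU -tE kU.
Qed.

Hypothesis f2 : forall j, j + 2%:Z <= f j.

(** The socle of [k, f k) sits at [f k - 1] and its translate at [f k], so the projectives [P i]
    start at the image of [f], each residue class occurring once. *)
Lemma syzygy_projectives n (S T P : 'I_n -> fmod A) :
  representatives (fun S => exists2 P, indec_proj P & iso_socle S P) S ->
  (forall i, is_AR_translate (S i) (T i)) ->
  (forall i, is_projective_cover (T i) (P i)) ->
  exists y : 'I_n -> int, [/\ forall i, isiv e x (P i) (y i) (absz (f (y i) - y i)%R),
    forall i j, (y i = y j %[mod N%:Z])%Z -> i = j,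
    forall i, exists k, f k = y i
  & forall k, exists i, (y i = f k %[mod N%:Z])%Z].
Proof.
move=> [SC Sinj Ssur] ST TP.
have soc Q k : isiv e x Q k (absz (f k - k)%R) -> forall R, iso_socle R Q ->
    isiv e x R (f k - 1) 1.
  move=> iv R RQ; have fk := nak_gt H k.
  have := isiv_iso_socle H iv (_ : (0 < absz (f k - k)%R)%N) RQ.
  have -> : k + (absz (f k - k)%R).-1%:Z = f k - 1 by lia.
  by apply; lia.
have /choice [y yP] : forall i, exists j, (exists k, f k = j) /\ isiv e x (S i) (j - 1) 1.
  move=> i; have [Q /(indec_proj_isiv H)[k Qk] SQ] := SC i.
  exists (f k%:Z); split; first by exists k%:Z.
  exact: soc Qk _ SQ.
exists y; split.
- move=> i; have [_ Si] := yP i.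
  have := simple_translate H f2 Si (ST i); rewrite subrK => Ti.
  exact: (isiv_cover H (TP i) Ti).
- move=> i j E; apply: Sinj; have [_ Si] := yP i; have [_ Sj] := yP j.
  apply: (isiv_miso H (isiv_mod H _ Si) Sj).
  by apply/eqP; rewrite eqz_modDr; apply/eqP.
- by move=> i; have [] := yP i.
move=> k; have fk := nak_gt H k.
have [Q Qk] : exists Q, isiv e x Q k (absz (f k - k)%R) by apply: (isiv_exists H); lia.
have [R RQ] : exists R, iso_socle R Q by apply: (iso_socle_exists H Qk); lia.
have Qip : indec_proj Q.
  apply/(indec_proj_isiv H); have [k' Qk'] := isiv_modn H Qk.
  have Qp : projective Q by apply: (isiv_projective H Qk); lia.
  have := isiv_projective_len H Qk' (_ : (0 < _)%N) Qp => h.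
  exists k'; have <- : absz (f k - k)%R = absz (f k'%:Z - k'%:Z)%R by lia.
  exact: Qk'.
have [|i iR] := Ssur R; first by exists Q.
exists i; have [_ Si] := yP i.
have := isiv_top H (isiv_iso iR (soc _ _ Qk _ RQ)) Si isT.
by move/eqP; rewrite eqz_modDr => /eqP.
Qed.

End CyclicGenerator.

(** * The corner algebra at the vertices of the image of [f] *)

Section Corner.
Variables (K : fieldType) (A B : falgType K).
Variables (N : nat) (e : int -> A) (x : A) (f : int -> int).
Hypothesis H : nakayama_basis N e x f.
Variables (m : nat) (sigma f' : int -> int).
Hypothesis m0 : (0 < m)%N.
Hypothesis sigma_lt : forall k l, (sigma k < sigma l) = (k < l).
Hypothesis sigma_per : forall k q, sigma (k + q * m%:Z) = sigma k + q * N%:Z.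
Hypothesis sigma_f : forall k, f (sigma k) = sigma (f' k).
Variables (eps : A) (rho : B -> A).
Hypothesis eps_in : forall k, eps * e (sigma k) = e (sigma k) /\ e (sigma k) * eps = e (sigma k).
Hypothesis eps_out : forall j, ~ (exists k, sigma k = j) -> eps * e j = 0 /\ e j * eps = 0.
Hypothesis rho_lin : linear rho.
Hypothesis rho_inj : injective rho.
Hypothesis rho_mul : forall s t, rho (s * t) = rho s * rho t.
Hypothesis rho1 : rho 1 = eps.
Hypothesis rho_im : forall a, eps * a * eps = a <-> exists t, rho t = a.

(** In the corner, the arrows are the paths [G k] between consecutive vertices of the image, and [X]
    is their sum. *)
Let gap k : nat := absz (sigma (k + 1) - sigma k)%R.
Let G k := e (sigma k) * x ^+ gap k.
Let X := \sum_(0 <= k < m) G k%:Z.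

Lemma sigma_le k l : (sigma k <= sigma l) = (k <= l).
Proof. by rewrite !leNgt sigma_lt. Qed.

Lemma sigma_mod k l : (sigma k == sigma l %[mod N%:Z])%Z = (k == l %[mod m%:Z])%Z.
Proof.
rewrite !eqz_mod_dvd; apply/dvdzP/dvdzP => -[q qE]; exists q.
  have E : sigma (l + q * m%:Z) = sigma k by rewrite sigma_per -qE addrC subrK.
  have := sigma_lt (l + q * m%:Z) k; have := sigma_lt k (l + q * m%:Z).
  rewrite E ltxx => h1 h2; have {h1 h2} : k = l + q * m%:Z.
    by apply/eqP; rewrite eq_le !leNgt -h1 -h2.
  by move=> ->; rewrite addrC addKr.
have -> : k = l + q * m%:Z by rewrite -qE addrC subrK.
by rewrite sigma_per addrC addKr.
Qed.

Lemma e_sigma k l : e (sigma k) * e (sigma l) = if (k == l %[mod m%:Z])%Z then e (sigma k) else 0.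
Proof. by rewrite (nak_orth H) sigma_mod. Qed.

Lemma G_right k : G k = x ^+ gap k * e (sigma (k + 1)).
Proof.
rewrite /G (nak_commX H); congr (_ * e _).
have : sigma k < sigma (k + 1) by rewrite sigma_lt; lia.
by rewrite /gap; move: (sigma k) (sigma (k + 1)) => a b; lia.
Qed.

Lemma periodic_selection (V : zmodType) (F : int -> V) l : (forall k q, F (k + q * m%:Z) = F k) ->
  \sum_(0 <= k < m) (if (k%:Z == l %[mod m%:Z])%Z then F k%:Z else 0) = F l.
Proof.
move=> Fper; have rm : (absz (l %% m%:Z)%Z < m)%N by lia.
have rE : (absz (l %% m%:Z)%Z)%:Z = (l %% m%:Z)%Z by lia.
rewrite (bigD1_seq (absz (l %% m%:Z)%Z)) ?mem_index_iota ?iota_uniq //= rE modz_mod eqxx.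
rewrite big1_seq ?addr0.
  by rewrite [in RHS](divz_eq l m%:Z) addrC Fper.
move=> k /andP[kr]; rewrite mem_index_iota => /andP[_ km].
by case: eqP => // E; move: kr; rewrite -E modz_nat modn_small // eqxx.
Qed.

Lemma G_per k q : G (k + q * m%:Z) = G k.
Proof.
rewrite /G /gap -addrA [q * _ + 1]addrC addrA !sigma_per; congr (_ * x ^+ absz _).
  by apply: (nak_mod H); rewrite addrC modzMDl.
by rewrite opprD addrACA subrr addr0.
Qed.

Lemma e_sigma_per k q : e (sigma (k + q * m%:Z)) = e (sigma k).
Proof. by apply: (nak_mod H); rewrite sigma_per addrC modzMDl. Qed.

Lemma e_mul_X k : e (sigma k) * X = G k.
Proof.
rewrite -[RHS](periodic_selection _ G_per) /X mulr_sumr; apply: eq_bigr => l _.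
rewrite /G mulrA e_sigma eq_sym; case: eqP => [E|_]; last by rewrite mul0r.
by congr (_ * _); apply: (nak_mod H); apply/eqP; rewrite sigma_mod; apply/eqP.
Qed.

Lemma X_mul_e k : X * e (sigma (k + 1)) = G k.
Proof.
rewrite -[RHS](periodic_selection _ G_per) /X mulr_suml; apply: eq_bigr => l _.
rewrite G_right -mulrA e_sigma eqz_modDr; case: ifP => _ //; by rewrite mulr0.
Qed.

Lemma e_mul_Xn k (a : nat) :
  e (sigma k) * X ^+ a = e (sigma k) * x ^+ absz (sigma (k + a%:Z) - sigma k)%R.
Proof.
elim: a => [|a IH]; first by rewrite addr0 subrr !expr0.
have s1 : sigma k <= sigma (k + a%:Z) by rewrite sigma_le; lia.
have s2 : sigma (k + a%:Z) < sigma (k + a%:Z + 1) by rewrite sigma_lt; lia.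
have cX : e (sigma k) * x ^+ absz (sigma (k + a%:Z) - sigma k)%R =
    x ^+ absz (sigma (k + a%:Z) - sigma k)%R * e (sigma (k + a%:Z)).
  rewrite (nak_commX H); congr (_ * e _).
  by move: (sigma k) (sigma (k + a%:Z)) s1 => u v; lia.
rewrite exprSr mulrA IH cX -mulrA e_mul_X /G mulrA -cX -mulrA -exprD; congr (_ * x ^+ _).
have -> : k + a.+1%:Z = k + a%:Z + 1 by lia.
by rewrite /gap; move: (sigma k) (sigma (k + a%:Z)) (sigma (k + a%:Z + 1)) s1 s2 => u v w; lia.
Qed.

Lemma eps_sum : eps = \sum_(0 <= k < m) e (sigma k%:Z).
Proof.
rewrite -[LHS]mulr1 -[RHS]mulr1 -(nak_sum H) !mulr_sumr; apply: eq_bigr => j _.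
have [[k <-]|nk] := pselect (exists k, sigma k = j%:Z).
  have [-> _] := eps_in k; rewrite mulr_suml -[LHS](periodic_selection k e_sigma_per).
  by apply: eq_bigr => l _; rewrite e_sigma.
have [-> _] := eps_out nk; rewrite mulr_suml big1 // => l _.
rewrite (nak_orth H); case: eqP => // /eqP; rewrite eqz_mod_dvd => /dvdzP[q qE].
case: nk; exists (l%:Z - q * m%:Z).
by rewrite -mulNr sigma_per mulNr -qE opprB addrC subrK.
Qed.

Lemma corner_basis : exists e' x', nakayama_basis m (e' : int -> B) x' f'.
Proof.
have rhoD s t : rho (s + t) = rho s + rho t by have := rho_lin 1 s t; rewrite !scale1r.
have rho0 : rho 0 = 0 by apply: (addrI (rho 0)); rewrite -rhoD !addr0.
have rhoZ c s : rho (c *: s) = c *: rho s by have := rho_lin c s 0; rewrite !addr0 rho0 addr0.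
have eps_idem : eps * eps = eps by rewrite -rho1 -rho_mul mul1r.
have /choice [e' eE] : forall k, exists t, rho t = e (sigma k).
  move=> k; apply/rho_im; have [h1 h2] := eps_in k; by rewrite h1 h2.
have [x' xE] : exists t, rho t = X.
  apply/rho_im; rewrite /X mulr_sumr mulr_suml; apply: eq_bigr => k _.
  rewrite {1}/G mulrA (eps_in _).1 -/(G k) G_right -mulrA (eps_in _).2 //.
have rhoX s a : rho (s * x' ^+ a) = rho s * X ^+ a.
  elim: a => [|a IH]; first by rewrite !expr0 !mulr1.
  by rewrite !exprSr !mulrA rho_mul IH xE.
have rho_eq0 s : (rho s == 0) = (s == 0) by rewrite -rho0 (inj_eq rho_inj).
exists e', x'; split=> //.
- by move=> i; apply: rho_inj; rewrite !eE -[m%:Z]mul1r e_sigma_per.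
- move=> i j; apply: rho_inj; rewrite rho_mul !eE e_sigma.
  by case: ifP => _; rewrite ?eE ?rho0.
- apply: rho_inj; rewrite rho1 eps_sum (big_morph rho rhoD rho0).
  by apply: eq_bigr => k _; rewrite eE.
- by move=> i; apply: rho_inj; rewrite !rho_mul !eE xE e_mul_X X_mul_e.
(* Vanishing in [A] means [sigma (f' i) <= sigma (i + a)], and [sigma] reflects the order. *)
- move=> i a; rewrite -rho_eq0 rhoX eE e_mul_Xn (nak_pow H) sigma_f.
  have : sigma i <= sigma (i + a%:Z) by rewrite sigma_le; lia.
  by move=> h; rewrite -[RHS]sigma_le; congr (_ <= _); lia.
- by move=> i; rewrite -sigma_lt -sigma_f; exact: (nak_gt H).
move=> Q Q0 Qlin Qe a.
(* Spanning is inherited from [A]: cutting [e i * x ^+ k] by [eps] gives 0 unless both ends [i] and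
   [i + k] lie in the image, and then it is a basis element of the corner. *)
suff key b : exists t, rho t = eps * b * eps /\ Q t.
  have [t [tE Qt]] := key (rho a).
  have /rho_im E : exists t, rho t = rho a by exists a.
  by rewrite E in tE; rewrite -(rho_inj tE).
elim/(nak_span H): b => [|c b b' [t [tE Qt]] [t' [tE' Qt']]|i k].
- by exists 0; rewrite mulr0 mul0r rho0.
- exists (c *: t + t'); split; last exact: Qlin.
  by rewrite rho_lin tE tE' mulrDr mulrDl -scalerAr -scalerAl.
have [[p pE]|np] := pselect (exists p, sigma p = i); last first.
  by exists 0; rewrite mulrA (eps_out np).1 !mul0r rho0.
have [[q qE]|nq] := pselect (exists q, sigma q = i + k%:Z); last first.
  by exists 0; rewrite (nak_commX H) -!mulrA (eps_out nq).2 !mulr0 rho0.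
exists (e' p * x' ^+ absz (q - p)%R); split; last exact: Qe.
have pq : p <= q by rewrite -sigma_le pE qE; lia.
rewrite rhoX eE e_mul_Xn.
have -> : p + (absz (q - p)%R)%:Z = q by lia.
have -> : absz (sigma q - sigma p)%R = k by lia.
rewrite -pE mulrA (eps_in p).1 (nak_commX H) -mulrA.
by have -> : sigma p + k%:Z = sigma q; [rewrite pE qE|rewrite (eps_in q).2].
Qed.

End Corner.

(** * Application to the syzygy filtered algebra *)

Lemma syzygy_filtered_domdim (K : fieldType) (Lambda Theta : falgType K) :
  cyclic_nakayama Lambda -> iso_syzygy_filtered Lambda Theta ->
  ((defect Theta < defect Lambda)%N -> enat_le (domdim Lambda) (Some 2%N)) /\
  (defect Lambda = defect Theta -> domdim Lambda = enat_add (domdim Theta) 2%N).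
Proof.
move=> hLambda heps; have [N [e [x [f [H f2]]]]] := cyclic_basis hLambda.
have [n [S [T [P [repS ST TP iE]]]]] := heps.
have [y [Piv yinj yim ysur]] := syzygy_projectives H f2 repS ST TP.
pose Y j := exists i, f i = j.
have Yper i q : Y (i + q * N%:Z) <-> Y i.
  split=> -[k kE]; last by exists (k + q * N%:Z); rewrite (nak_fperZ H) kE.
  by exists (k - q * N%:Z); rewrite -mulNr (nak_fperZ H) kE mulNr addrK.
have [|m [sigma [m0 sigma_lt sigma_im sigma_per]]] := periodic_enumeration (nak_gt0 H) Yper.
  by exists (f 0), 0.
have /choice [f' fE] : forall k, exists l, sigma l = f (sigma k).
  by move=> k; apply/sigma_im; exists (sigma k).
pose eps := \sum_(i < n) e (y i).
have gen : generated_by (mdsum P) eps.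
  by have := generated_mdsum H Piv yinj.
have eps_in k : eps * e (sigma k) = e (sigma k) /\ e (sigma k) * eps = e (sigma k).
  have [l lE] : exists l, f l = sigma k by apply/sigma_im; exists k.
  have [i iE'] := ysur l; have ye : e (y i) = e (sigma k) by rewrite -lE; exact: (nak_mod H).
  have uniq j : j != i -> e (y j) * e (y i) = 0 /\ e (y i) * e (y j) = 0.
    move=> ji; rewrite !(nak_orth H); split; case: eqP => // /yinj E; by rewrite E eqxx in ji.
  rewrite -ye; split.
    rewrite mulr_suml (bigD1 i) //= (nak_idem H) big1 ?addr0 // => j /uniq [-> _] //.
  by rewrite mulr_sumr (bigD1 i) //= (nak_idem H) big1 ?addr0 // => j /uniq [_ ->].
have eps_out j : ~ (exists k, sigma k = j) -> eps * e j = 0 /\ e j * eps = 0.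
  move=> nj; have nE i : (y i == j %[mod N%:Z])%Z = false.
    apply/negP; rewrite eqz_mod_dvd => /dvdzP[q qE]; apply/nj/sigma_im.
    have [k kE] := yim i; exists (k - q * N%:Z).
    by rewrite -mulNr (nak_fperZ H) kE mulNr -qE opprB addrC subrK.
  rewrite /eps mulr_suml mulr_sumr !big1 // => i _; rewrite (nak_orth H) ?nE //.
  by rewrite eq_sym nE.
have ee : eps * eps = eps.
  rewrite {2}/eps mulr_sumr; apply: eq_bigr => i _.
  have [k kE] : exists k, sigma k = y i by apply/sigma_im; exact: yim.
  by rewrite -kE (eps_in k).1.
have [rho [rho_lin rho_inj rho_mul rho1 rho_im]] := corner_embedding gen ee iE.
have [e' [x' H']] := corner_basis H m0 sigma_lt sigma_per (fun k => esym (fE k))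
  eps_in eps_out rho_lin rho_inj rho_mul rho1 rho_im.
have [r rE] := residue_exists H.
exact: (defect_domdim H H' sigma_lt sigma_im sigma_per (fun k => esym (fE k)) rE f2).
Qed.

Local Close Scope ring_scope.

Theorem theoremB (K : fieldType) (Lambda Theta : falgType K)
    (hLambda : cyclic_nakayama Lambda) (hTheta : nakayama Theta)
    (heps : iso_syzygy_filtered Lambda Theta) (hdef : defect Theta <> 0) :
  ((defect Theta < defect Lambda)%N -> enat_le (domdim Lambda) (Some 2)) /\
  (defect Lambda = defect Theta -> domdim Lambda = enat_add (domdim Theta) 2).
Proof. exact: syzygy_filtered_domdim. Qed.
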